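(* Let $V(w):=1-w$ and $\eta:=\mathbbm{1}_{]-1,0[}$. For every sequence $\{\varepsilon_n\}$ satisfying $$\varepsilon_n>0,\qquad \varepsilon_{n+1}\le\frac1{16}\,\varepsilon_n\qquad\text{for every }n\in\mathbb{N},$$ there are an initial datum $u_0\in L^\infty(\mathbb{R})$ with $0\le u_0\le1$ and $\mathrm{TotVar}\,u_0<+\infty$, and a sequence $\{t_n\}$, such that for every $n\in\mathbb{N}$ $$t_n>0,\qquad \mathrm{TotVar}\,w_{\varepsilon_n}(t,\cdot)>\mathrm{TotVar}\,w_{\varepsilon_n}(0,\cdot)\quad\text{for a.e. }t\in\,]0,t_n[\,,$$ where, for $\varepsilon>0$, $w_\varepsilon:=u_\varepsilon*\eta_\varepsilon$ and $u_\varepsilon$ is the solution of the Cauchy problem $$\partial_t u_\varepsilon+\partial_x\big[V(u_\varepsilon*\eta_\varepsilon)u_\varepsilon\big]=0,\qquad u_\varepsilon(0,\cdot)=u_0,\qquad \eta_\varepsilon(x):=\frac1\varepsilon\,\eta\Big(\frac x\varepsilon\Big).$$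
   Context: Notation: $\mathbbm{1}_E$ is the characteristic function of $E$; $\mathbb{R}_+=[0,+\infty[$; $\mathrm{TotVar}$ is the total variation of a function on $\mathbb{R}$. The symbol $*$ denotes convolution in the $x$ variable only, so that for $\eta=\mathbbm{1}_{]-1,0[}$ one has $$w_\varepsilon(t,x)=\frac1\varepsilon\int_x^{x+\varepsilon}u_\varepsilon(t,y)\,dy .$$ The solution $u_\varepsilon$ is the unique function in $L^\infty(\mathbb{R}_+\times\mathbb{R})$ solving the nonlocal Cauchy problem in the sense of distributions, i.e. $\iint_{\mathbb{R}_+\times\mathbb{R}}u_\varepsilon[\partial_t\varphi+V(u_\varepsilon*\eta_\varepsilon)\partial_x\varphi]\,dx\,dt+\int_{\mathbb{R}}u_0(x)\varphi(0,x)\,dx=0$ for every $\varphi\in C^\infty_c(\mathbb{R}_+\times\mathbb{R})$; for the present $V,\eta$ and any measurable $u_0$ with $0\le u_0\le1$ it is known that it exists, is unique, satisfies $0\le u_\varepsilon\le 1$, and has a representative in $C^0(\mathbb{R}_+,L^1_{\mathrm{loc}}(\mathbb{R}))$, which is used. *)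

(* Defs.v *)
From HB Require Import structures.
From mathcomp Require Import all_boot all_order all_algebra.
From mathcomp Require Import all_classical all_reals all_analysis.

Set Implicit Arguments.
Unset Strict Implicit.
Unset Printing Implicit Defensive.

Import Order.TTheory GRing.Theory Num.Theory.
Import numFieldNormedType.Exports.

Local Open Scope classical_set_scope.
Local Open Scope ring_scope.

(* A point of the plane is a pair (t, x). *)

Notation leb R := (@lebesgue_measure R).
Notation leb2 R := (@lebesgue_measure R \x @lebesgue_measure R)%E.

Definition half_plane (R : realType) : set (R * R) := [set p | 0 <= p.1].
Arguments half_plane : clear implicits.

Definition TotVar (R : realType) (f : R -> R) : \bar R :=
  ereal_sup [set total_variation ab.1 ab.2 f | ab in [set ab : R * R | ab.1 <= ab.2]].

Definition rescale (R : realType) (eta : R -> R) (eps : R) : R -> R :=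
  fun x => eps^-1 * eta (x / eps).

Definition convolution (R : realType) (f g : R -> R) : R -> R :=
  fun x => \int[leb R]_y (f y * g (x - y)).

Definition nonlocal_avg (R : realType) (u : R * R -> R) (k : R -> R) (t : R) : R -> R :=
  convolution (fun y => u (t, y)) k.

(* [true] is the direction of t, [false] the direction of x. *)
Definition dir (R : realType) (b : bool) : R * R := if b then (1, 0) else (0, 1).
Arguments dir : clear implicits.

Definition iter_partial (R : realType) (s : seq bool) (phi : R * R -> R) : R * R -> R :=
  foldr (fun b g => 'D_(dir R b) g) phi s.

Definition smooth (R : realType) (phi : R * R -> R) : Prop :=
  forall s : seq bool, continuous (iter_partial s phi) /\
    forall b p, derivable (iter_partial s phi) p (dir R b).

(* C_c^oo(R_+ x R) is the set of the restrictions to the closed half-plane of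
   these functions; [nonlocal_solution] only uses their values on it. *)
Definition test_function (R : realType) (phi : R * R -> R) : Prop :=
  smooth phi /\ compact (closure [set p | phi p != 0]).

(* u restricted to R_+ x R is in C^0(R_+, L^1_loc(R)). *)
Definition C0_L1loc (R : realType) (u : R * R -> R) : Prop :=
  (forall t : R, 0 <= t -> locally_integrable setT (fun x => u (t, x))) /\
  (forall (K : set R) (t : R), compact K -> 0 <= t ->
    (\int[leb R]_(x in K) `|u (s, x) - u (t, x)|%:E)%E
      @[s --> within [set s | 0 <= s] (nbhs t)] --> 0%E).

Definition weak_solution (R : realType) (V k u0 : R -> R) (u : R * R -> R) : Prop :=
  forall phi : R * R -> R, test_function phi ->
    \int[leb2 R]_(p in half_plane R)
       (u p * ('D_(dir R true) phi p
               + V (nonlocal_avg u k p.1 p.2) * 'D_(dir R false) phi p))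
    + \int[leb R]_x (u0 x * phi (0, x)) = 0.

(* u is a representative, continuous in time with values in L^1_loc, of an
   L^oo(R_+ x R) distributional solution of
   d_t u + d_x [V (u * k) u] = 0, u(0, .) = u0. *)
Definition nonlocal_solution (R : realType) (V k u0 : R -> R) (u : R * R -> R) : Prop :=
  [/\ u \* \1_(half_plane R) \in Lfun (leb2 R) +oo%E,
      C0_L1loc u & weak_solution V k u0 u].

(* Main.v *)
(* The datum is a superposition of far apart pieces, one for each scale
   e = eps_i: a pair of blocks on [c - 5e/4, c - e/2] and [c, c + 3e/4] of height
   A = 2^-(i+1). Testing the equation on thin strips with moving edges shows that
   the mass of a window at time t is, up to inequalities, the initial mass between
   the points where two backward trajectories of speed 1 - w start. So the values
   of w at finitely many points at a small time can be compared with those at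
   time 0, first with crude speeds and then with speeds frozen at their initial
   values up to O(t).

   Let h = eps_n. On the piece of scale h, w(0, .) has two maxima, at windows
   that contain exactly one block, and a minimum between them, at a window whose
   ends lie in the two blocks. The maxima persist, while at the minimum the right
   end moves faster than the left one (1 - 3A/8 against 1 - A/2), so w decreases
   there and the variation grows at least like A^2 t / (8h). The pieces of scale
   at most h/16 do not lose variation, because a window containing both blocks
   keeps them; each of the n pieces of scale at least 16h loses only O(t^2),
   because there w is locally constant at its maxima and vanishes in the dip. *)

Require Import Defs.
From HB Require Import structures.
From mathcomp Require Import all_boot all_order all_algebra.
From mathcomp Require Import all_classical all_reals all_analysis.
From mathcomp Require Import measurable_realfun.
From mathcomp Require Import ring lra.

Import Order.TTheory GRing.Theory Num.Theory.
Import numFieldNormedType.Exports.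

Local Open Scope classical_set_scope.
Local Open Scope ring_scope.

Set Implicit Arguments.
Unset Strict Implicit.
Unset Printing Implicit Defensive.

(** * Smooth cut-offs of the plane *)

(** A solution is only bounded and measurable, so it has no characteristics to follow; but [w] is
    Lipschitz in both variables. Edges are therefore moved along backward Euler polygons of the
    speed 1 - w: during a step h the speed differs from a constant by O(h), the flux through the
    edges is O(h^2), and N steps of length T/N leave an error O(1/N). Only bounds on the speeds near
    the two ends of a window are kept; they suffice because the primitive of the datum is monotone.
    The times t_n have to be fixed before the solution, whose essential bound M is not prescribed. M
    enters only the errors of the polygons, which vanish in the limit; the masses so obtained lie
    between 0 and a bound on the total mass of the datum, and the resulting bound K on the speed
    depends only on the datum and on the scale. *)

Section FlatExp.
Context {R : realType}.
Implicit Type x : R.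

(** The powers x^-k make the family closed under differentiation; [k = 0] is the classical function
    that is flat at 0. *)
Definition flat_exp (k : nat) x : R :=
  if 0 < x then x^-1 ^+ k * expR (- x^-1) else 0.

Lemma flat_exp_le0 k x : x <= 0 -> flat_exp k x = 0.
Proof. by rewrite /flat_exp leNgt => /negbTE ->. Qed.

Lemma flat_exp_ge0 k x : 0 <= flat_exp k x.
Proof.
rewrite /flat_exp; case: ifPn => // x0.
by rewrite mulr_ge0 ?expR_ge0// exprn_ge0// invr_ge0 ltW.
Qed.

(** The term of degree k + 2 in the series of exp (1/x) absorbs x^-k and leaves x^2. A bound of
    order two is what yields the derivative 0 at the origin. *)
Lemma flat_exp_quadratic k x : flat_exp k x <= (k.+2)`!%:R * x ^+ 2.
Proof.
rewrite /flat_exp; case: ifPn => x0; last by rewrite mulr_ge0// sqr_ge0.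
have xV0 : 0 < x^-1 by rewrite invr_gt0.
have : x^-1 ^+ k.+2 / (k.+2)`!%:R <= expR x^-1.
  by rewrite (le_trans _ (expR_ge1Dxn k.+1 (ltW xV0)))// lerDr ler01.
rewrite ler_pdivrMr ?ltr0n ?fact_gt0// => h.
rewrite expRN ler_pdivrMr ?expR_gt0//.
have -> : x^-1 ^+ k = x^-1 ^+ k.+2 * x ^+ 2.
  by rewrite -addn2 exprD -mulrA -exprMn mulVf ?gt_eqF// expr1n mulr1.
rewrite [X in _ <= X](_ : _ = expR x^-1 * (k.+2)`!%:R * x ^+ 2); last by ring.
by rewrite ler_wpM2r// sqr_ge0.
Qed.

Lemma is_derive_flat_exp k x :
  is_derive x 1 (flat_exp k) (flat_exp k.+2 x - k%:R * flat_exp k.+1 x).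
Proof.
have [x0|x0|->] := ltgtP x 0.
- rewrite !flat_exp_le0 ?ltW// mulr0 subr0.
  apply: (@near_eq_is_derive _ _ _ (cst 0)).
  by apply: filterS (lt_nbhsl x0) => y y0; rewrite flat_exp_le0// ltW.
- rewrite /flat_exp x0.
  have xn0 : x != 0 by rewrite gt_eqF.
  apply: (@near_eq_is_derive _ _ _ ((fun y => y^-1) ^+ k * (expR \o (fun y => - y^-1)))).
    by apply: filterS (lt_nbhsr x0) => y y0; rewrite y0 /= !fctE.
  have dV : is_derive x 1 (fun y : R => y^-1) (- x ^- 2).
    by apply: (is_derive_eq (@is_deriveV _ id _ _ _ xn0 _)); rewrite /GRing.scale/= mulr1.
  have dN : is_derive x 1 (fun y : R => - y^-1) (x ^- 2).
    by apply: (is_derive_eq (is_deriveN dV)); rewrite opprK.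
  have dE : is_derive x 1 (expR \o (fun y => - y^-1)) (expR (- x^-1) * x ^- 2).
    exact: is_derive1_comp.
  apply: is_derive_eq.
  rewrite /GRing.scale/= !fctE -!exprVn.
  change (x^-1 ^+ k * (expR (- x^-1) * x^-1 ^+ 2) +
    expR (- x^-1) * (k%:R * x^-1 ^+ k.-1 * - x^-1 ^+ 2) =
    x^-1 ^+ k.+2 * expR (- x^-1) - k%:R * (x^-1 ^+ k.+1 * expR (- x^-1)) :> R).
  move: (x^-1) => y; move: (expR (- y)) => e; case: k => [|k]; rewrite /= ?exprS ?expr0; ring.
- rewrite !flat_exp_le0// mulr0 subr0.
  (* At 0 the difference quotient is at most [c] times |h|, by the quadratic bound. *)
  set c : R := (k.+2)`!%:R; have c0 : 0 < c by rewrite ltr0n fact_gt0.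
  suff H : h^-1 *: ((flat_exp k \o shift 0) (h *: 1) - flat_exp k 0) @[h --> 0^'] --> (0 : R).
    by apply: DeriveDef; [exact: cvgP H|exact: cvg_lim H].
  apply/cvgr0Pnorm_le => e e0.
  have ec0 : 0 < e / c by rewrite divr_gt0.
  near=> h.
  have h0 : h != 0 by near: h; exact: nbhs_dnbhs_neq.
  have hc : `|h| <= e / c.
    near: h; exact: dnbhs0_le.
  rewrite /= [h *: 1]mulr1 addr0 (flat_exp_le0 _ (lexx 0)) subr0.
  rewrite /GRing.scale/= normrM normfV (ger0_norm (flat_exp_ge0 _ _)).
  rewrite ler_pdivrMl ?normr_gt0//.
  rewrite (le_trans (flat_exp_quadratic _ _))// -/c -normr_id -real_normK ?num_real//.
  rewrite normr_id expr2 mulrA mulrC ler_wpM2l//.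
  by rewrite mulrC -ler_pdivlMr.
Unshelve. all: by end_near. Qed.
End FlatExp.

Section PlaneSmooth.
Context {R : realType}.
Implicit Types (p v : R * R) (f g : R * R -> R).

(** [smooth] quantifies over all words of partial derivatives. A syntactic class of differentiable
    functions that contains its own derivatives settles all orders at once. Inverses are there for
    the quotient in [step]. *)
Inductive elementary : (R * R -> R) -> Prop :=
| elementary_cst c : elementary (cst c)
| elementary_flat k a b c :
    elementary (fun p => flat_exp k (a * p.1 + b * p.2 + c))
| elementaryD f g : elementary f -> elementary g -> elementary (f + g)
| elementaryM f g : elementary f -> elementary g -> elementary (f * g)
| elementaryV f : (forall p, f p != 0) -> elementary f ->
    elementary (fun p => (f p)^-1).

Lemma differentiable_affine a b c p :
  differentiable (fun p : R * R => a * p.1 + b * p.2 + c) p.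
Proof.
have fst_d : differentiable (@fst R R) p.
  by apply: (@linear_differentiable R _ _ (@fst R R)) => ?; exact: cvg_fst.
have snd_d : differentiable (@snd R R) p.
  by apply: (@linear_differentiable R _ _ (@snd R R)) => ?; exact: cvg_snd.
by apply: differentiableD => //; apply: differentiableD; apply: differentiableM.
Qed.

Lemma is_derive_affine a b c p v :
  is_derive p v (fun p : R * R => a * p.1 + b * p.2 + c) (a * v.1 + b * v.2).
Proof.
have d1 : is_derive p v (@fst R R) v.1.
  have h (q : R * R) : @fst R R x @[x --> q] --> q.1 by exact: cvg_fst.
  apply: DeriveDef.
    exact/diff_derivable/(@linear_differentiable R _ _ (@fst R R)).
  by rewrite deriveE ?diff_lin//; exact: (@linear_differentiable R _ _ (@fst R R)).
have d2 : is_derive p v (@snd R R) v.2.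
  have h (q : R * R) : @snd R R x @[x --> q] --> q.2 by exact: cvg_snd.
  apply: DeriveDef.
    exact/diff_derivable/(@linear_differentiable R _ _ (@snd R R)).
  by rewrite deriveE ?diff_lin//; exact: (@linear_differentiable R _ _ (@snd R R)).
have -> : (fun p : R * R => a * p.1 + b * p.2 + c) =
  (cst a * @fst R R + cst b * @snd R R + cst c) by apply/funext.
have dc x : is_derive p v (cst x : R * R -> R) 0 by exact: is_derive_cst.
apply: is_derive_eq (is_deriveD (is_deriveD (is_deriveM (dc a) d1)
  (is_deriveM (dc b) d2)) (dc c)) _.
by rewrite /GRing.scale/= !mulr0 !addr0.
Qed.

Lemma is_derive_comp_plane (h : R -> R) (l : R * R -> R) p v dh dl :
  differentiable l p -> is_derive p v l dl -> is_derive (l p) 1 h dh ->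
  differentiable (h \o l) p /\ is_derive p v (h \o l) (dh * dl).
Proof.
move=> l_d dl_p [h_d h_v].
have h_d' : differentiable h (l p) by apply/derivable1_diffP.
have hl_d : differentiable (h \o l) p by apply: differentiable_comp.
split; first exact: hl_d.
apply: DeriveDef; first exact/diff_derivable.
rewrite (deriveE _ hl_d) (diff_comp l_d h_d')/= -(deriveE _ l_d).
by rewrite (deriv1E h_d) derive1E h_v derive_val mulrC.
Qed.

Lemma differentiable_elementary f : elementary f -> forall p, differentiable f p.
Proof.
elim=> [c p|k a b c p|{}f g _ fd _ gd p|{}f g _ fd _ gd p|{}f f0 _ fd p].
- exact: differentiable_cst.
- have := is_derive_comp_plane (differentiable_affine a b c p)
    (is_derive_affine a b c p 0) (is_derive_flat_exp k _).
  by case.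
- exact: differentiableD.
- exact: differentiableM.
- exact: differentiableV.
Qed.

Lemma elementary_derive f v : elementary f -> elementary ('D_v f).
Proof.
move=> el; have dif := differentiable_elementary.
elim: el => [c|k a b c|{}f g fe fd ge gd|{}f g fe fd ge gd|{}f f0 fe fd].
- rewrite (_ : 'D_v _ = cst 0); first exact: elementary_cst.
  by apply/funext => p; rewrite derive_cst.
- rewrite (_ : 'D_v _ = ((fun p => flat_exp k.+2 (a * p.1 + b * p.2 + c)) +
    cst (- k%:R) * (fun p => flat_exp k.+1 (a * p.1 + b * p.2 + c))) *
    cst (a * v.1 + b * v.2)).
    apply: elementaryM; last exact: elementary_cst.
    apply: elementaryD; first exact: elementary_flat.
    by apply: elementaryM; [exact: elementary_cst|exact: elementary_flat].
  apply/funext => p.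
  have [_ h] := is_derive_comp_plane (differentiable_affine a b c p)
    (is_derive_affine a b c p v) (is_derive_flat_exp k _).
  by rewrite derive_val !fctE mulNr.
- rewrite (_ : 'D_v _ = 'D_v f + 'D_v g); first exact: elementaryD.
  by apply/funext => p; rewrite deriveD//; apply/diff_derivable/dif.
- rewrite (_ : 'D_v _ = f * 'D_v g + g * 'D_v f).
    by apply: elementaryD; apply: elementaryM.
  by apply/funext => p; rewrite deriveM//; apply/diff_derivable/dif.
- rewrite (_ : 'D_v _ = cst (-1) * ((fun p => (f p)^-1) * (fun p => (f p)^-1)) * 'D_v f).
    apply: elementaryM => //; apply: elementaryM; first exact: elementary_cst.
    by apply: elementaryM; exact: elementaryV.
  apply/funext => p; rewrite deriveV//; last exact/diff_derivable/dif.
  change (- f p ^- 2 * 'D_v f p = -1 * ((f p)^-1 * (f p)^-1) * 'D_v f p).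
  by rewrite -invfM -expr2 mulN1r.
Qed.

Lemma elementary_smooth f : elementary f -> smooth f.
Proof.
move=> fe s.
have se : elementary (iter_partial s f).
  by elim: s => //= b s IH; exact: elementary_derive.
split=> [p|b p]; last exact/diff_derivable/differentiable_elementary.
exact/differentiable_continuous/differentiable_elementary.
Qed.

End PlaneSmooth.

Section Step.
Context {R : realType}.
Implicit Types (x : R) (p v : R * R).

(** Smooth transition from 0 on x <= 0 to 1 on x >= 1; the denominator is positive because x and 1 -
    x are not both nonpositive. *)
Definition step x : R := flat_exp 0 x / (flat_exp 0 x + flat_exp 0 (1 - x)).

Lemma step_den_gt0 x : 0 < flat_exp 0 x + flat_exp 0 (1 - x).
Proof.
have [x0|x0] := leP x 0.
  rewrite flat_exp_le0// add0r /flat_exp ifT; last by lra.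
  by rewrite expr0 mul1r expR_gt0.
rewrite ltr_pwDl ?flat_exp_ge0// /flat_exp x0.
by rewrite expr0 mul1r expR_gt0.
Qed.

Lemma step_le0 x : x <= 0 -> step x = 0.
Proof. by move=> x0; rewrite /step flat_exp_le0// mul0r. Qed.

Lemma step_ge1 x : 1 <= x -> step x = 1.
Proof.
move=> x1; have := step_den_gt0 x; rewrite /step.
rewrite (@flat_exp_le0 _ 0 (1 - x)) ?subr_le0// addr0 => h.
by rewrite divff// gt_eqF.
Qed.

Lemma step_ge0 x : 0 <= step x.
Proof. by rewrite divr_ge0 ?flat_exp_ge0// ltW// step_den_gt0. Qed.

Lemma step_le1 x : step x <= 1.
Proof. by rewrite ler_pdivrMr ?step_den_gt0// mul1r lerDl flat_exp_ge0. Qed.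

Lemma elementary_step a b c :
  elementary (fun p => step (a * p.1 + b * p.2 + c)).
Proof.
rewrite (_ : (fun p => _) = (fun p => flat_exp 0 (a * p.1 + b * p.2 + c)) *
  (fun p => ((fun p => flat_exp 0 (a * p.1 + b * p.2 + c)) p +
  (fun p => flat_exp 0 (- a * p.1 + - b * p.2 + (1 - c))) p)^-1)).
  apply: elementaryM; first exact: elementary_flat.
  apply: (@elementaryV _ ((fun p => flat_exp 0 (a * p.1 + b * p.2 + c)) +
   (fun p => flat_exp 0 (- a * p.1 + - b * p.2 + (1 - c))))) => [p|].
    have := step_den_gt0 (a * p.1 + b * p.2 + c).
    rewrite (_ : 1 - _ = - a * p.1 + - b * p.2 + (1 - c)); last by ring.
    by move/gt_eqF/negbT.
  by apply: elementaryD; exact: elementary_flat.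
apply/funext => p; rewrite fctE /step.
by rewrite (_ : 1 - _ = - a * p.1 + - b * p.2 + (1 - c)); last by ring.
Qed.

Definition dstep x : R := (derive1 step) x.

(** A difference quotient of [step] is one of a function of the plane in the direction of t, so the
    smoothness of elementary functions also yields the derivative of [step] and its continuity. *)
Lemma step_plane x :
  (fun h : R => h^-1 *: ((step \o shift x) (h *: 1) - step x)) =
  (fun h : R => h^-1 *: (((fun p : R * R => step (1 * p.1 + 0 * p.2 + 0)) \o shift (x, 0)) (h *: (1, 0))
     - (fun p : R * R => step (1 * p.1 + 0 * p.2 + 0)) (x, 0))).
Proof.
apply/funext => h /=; congr (_ *: (step _ - step _)).
  by rewrite mul1r mul0r !addr0.
by rewrite mul1r mul0r !addr0.
Qed.

Lemma is_derive_step x : is_derive x 1 step (dstep x).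
Proof.
rewrite /dstep derive1E; apply: derivableP; rewrite /derivable step_plane.
by have [_ /(_ true (x, 0))] := elementary_smooth (elementary_step 1 0 0) [::].
Qed.

Lemma continuous_dstep : continuous dstep.
Proof.
have -> : dstep = 'D_(dir R true) (fun p : R * R => step (1 * p.1 + 0 * p.2 + 0))
   \o (fun x => (x, 0)).
  apply/funext => x /=; rewrite /dstep derive1E /derive step_plane//.
have [cD _] := elementary_smooth (elementary_step 1 0 0) [:: true].
move=> x; apply: continuous_comp; last exact: cD.
by apply: (@cvg_pair _ _ _ (nbhs x) (nbhs x) (nbhs (0 : R)) _ _ _ id (cst 0)); [exact: cvg_id|exact: cvg_cst].
Qed.

Lemma dstep_lt0 x : x < 0 -> dstep x = 0.
Proof.
move=> x0; rewrite /dstep derive1E (@near_eq_derive _ _ _ _ (cst 0)) ?derive_cst//.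
by apply: filterS (lt_nbhsl x0) => y y0; rewrite step_le0// ltW.
Qed.

Lemma dstep_gt1 x : 1 < x -> dstep x = 0.
Proof.
move=> x0; rewrite /dstep derive1E (@near_eq_derive _ R R _ (cst 1)) ?derive_cst//.
by apply: filterS (lt_nbhsr x0) => y y0; rewrite step_ge1// ltW.
Qed.

Lemma dstep_bounded : exists2 C : R, 0 <= C & forall x, `|dstep x| <= C.
Proof.
have [|c _ Hc] := @EVT_max R (fun x => `|dstep x|) 0 1 ler01.
  apply: continuous_subspaceT => x.
  by apply: (@continuous_comp _ _ _ dstep); [exact: continuous_dstep|exact: norm_continuous].
exists `|dstep c|; first exact: normr_ge0.
move=> x.
have [x0|x0] := ltP x 0; first by rewrite dstep_lt0// normr0.
have [x1|x1] := ltP 1 x; first by rewrite dstep_gt1// normr0.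
by apply: Hc; rewrite in_itv/= x0 x1.
Qed.

Lemma is_derive_step_affine a b c p v :
  is_derive p v (fun p : R * R => step (a * p.1 + b * p.2 + c))
    (dstep (a * p.1 + b * p.2 + c) * (a * v.1 + b * v.2)).
Proof.
by case: (is_derive_comp_plane (differentiable_affine a b c p)
  (is_derive_affine a b c p v) (is_derive_step _)).
Qed.

Lemma is_derive_step_scaled (s k x : R) :
  is_derive x 1 (fun t => step ((t - s) / k)) (k^-1 * dstep ((x - s) / k)).
Proof.
have h : is_derive x 1 (fun t : R => (t - s) / k) k^-1.
  have dB : is_derive x 1 (fun t : R => t - s) 1.
    by apply: is_derive_eq (is_deriveB (is_derive_id x 1) (is_derive_cst s x 1)) _;
      rewrite subr0.
  have -> : (fun t : R => (t - s) / k) = k^-1 *: (fun t : R => t - s).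
    by apply/funext => t; rewrite mulrC.
  by apply: is_derive_eq (is_deriveZ _ dB) _; rewrite /GRing.scale/= mulr1.
by apply: is_derive_eq (is_derive1_comp (is_derive_step _) h) _; rewrite mulrC.
Qed.

Lemma continuous_dstep_scaled (s k : R) :
  continuous (fun t => k^-1 * dstep ((t - s) / k)).
Proof.
move=> t; apply: cvgM; first exact: cvg_cst.
apply: (@continuous_comp _ _ _ (fun t => (t - s) / k) dstep); last exact: continuous_dstep.
apply: cvgM; last exact: cvg_cst.
by apply: cvgB; [exact: cvg_id|exact: cvg_cst].
Qed.

Lemma integral_dstep (s k : R) : 0 < k ->
  \int[leb R]_(t in `[s, s + k]) (k^-1 * dstep ((t - s) / k)) = 1.
Proof.
move=> k0; rewrite /Rintegral.
have d x := is_derive_step_scaled s k x.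
rewrite (@continuous_FTC2 _ _ (fun t => step ((t - s) / k))).
- by rewrite addrAC !subrr add0r mul0r divff ?gt_eqF// step_ge1// step_le0//= subr0.
- by rewrite ltrDl.
- exact/continuous_subspaceT/continuous_dstep_scaled.
- have c x : {for x, continuous (fun t => step ((t - s) / k))}.
    exact/differentiable_continuous/derivable1_diffP.
  by split=> [x _| |]; [|exact/cvg_at_right_filter/c|exact/cvg_at_left_filter/c].
- by move=> x _; rewrite derive1E derive_val.
Qed.

End Step.

(** * Integrals of bounded functions over intervals and boxes *)

Section BoundedIntegrals.
Context {R : realType}.
Implicit Types (f g : R -> R) (a b M B : R).

Lemma bounded_integrable d (T : measurableType d)
    (mu : {measure set T -> \bar R}) (A : set T) (f : T -> R) (M : R) :
  measurable A -> (mu A < +oo)%E -> measurable_fun setT f ->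
  (forall x, `|f x| <= M) -> mu.-integrable A (EFin \o f).
Proof.
move=> mA Aoo mf fM; apply: measurable_bounded_integrable => //.
  exact: measurable_funTS.
by exists M; split; [exact: num_real|move=> N MN x _; exact: le_trans (fM x) (ltW MN)].
Qed.

Lemma integrable_EFinB d (T : measurableType d)
    (mu : {measure set T -> \bar R}) (D : set T) (f g : T -> R) :
  measurable D -> mu.-integrable D (EFin \o f) -> mu.-integrable D (EFin \o g) ->
  mu.-integrable D (EFin \o (fun x => f x - g x)).
Proof.
move=> mD fi gi; have := integrableB mD fi gi.
by apply: eq_integrable => // x _; rewrite /= EFinB.
Qed.

Lemma lebesgue_itvcc_lty a b : (leb R `[a, b]%classic < +oo)%E.
Proof.
by rewrite lebesgue_measure_itv/=; case: ifPn => _; rewrite -?EFinB ltry.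
Qed.

Lemma bounded_integrable_itv f M a b : measurable_fun setT f ->
  (forall x, `|f x| <= M) -> (leb R).-integrable `[a, b] (EFin \o f).
Proof.
move=> mf fM; apply: (@bounded_integrable _ _ (leb R) `[a, b]%classic f M) => //.
exact: lebesgue_itvcc_lty.
Qed.

Lemma Rintegral_itv_split f M a b c : measurable_fun setT f ->
  (forall x, `|f x| <= M) -> a <= b -> b <= c ->
  \int[leb R]_(x in `[a, c]) f x =
  \int[leb R]_(x in `[a, b]) f x + \int[leb R]_(x in `[b, c]) f x.
Proof.
move=> mf fM ab bc.
have fi := bounded_integrable_itv _ _ mf fM.
apply/eqP; rewrite addrC -subr_eq; apply/eqP.
rewrite (@Rintegral_itvB _ _ (BLeft a) (BRight c) b (fi a c)) ?bnd_simp//.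
apply: Rintegral_itv_obnd_cbnd.
by apply: integrableS (fi b c) => //; exact: subset_itv_oc_cc.
Qed.

Lemma Rintegral_itv_cst a b r : a <= b ->
  \int[leb R]_(x in `[a, b]) r = r * (b - a).
Proof.
move=> ab; transitivity (r * fine (leb R `[a, b]%classic)).
  exact: Rintegral_cst.
rewrite lebesgue_measure_itv/= lte_fin; congr (_ * _).
by case: ltgtP ab => [//|//|->]; rewrite ?subrr.
Qed.

Lemma normr_Rintegral_itv_le f M B a b : measurable_fun setT f ->
  (forall x, `|f x| <= M) -> a <= b -> (forall x, a <= x <= b -> `|f x| <= B) ->
  `|\int[leb R]_(x in `[a, b]) f x| <= B * (b - a).
Proof.
move=> mf fM ab fB; have fi := bounded_integrable_itv a b mf fM.
rewrite (le_trans (le_normr_Rintegral _ fi))// -Rintegral_itv_cst//.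
apply: le_Rintegral => //.
- exact: integrable_norm.
- by apply: (@bounded_integrable_itv _ `|B|) => //.
Qed.

(** The bound does not see the interval [[a, b]]: for an edge bump, of height O(1/d) on a length d,
    it gives O(1) whatever d is. *)
Lemma normr_Rintegral_concentrated f M B a b c d : measurable_fun setT f ->
  (forall x, `|f x| <= M) -> 0 <= B -> a <= b -> c <= d ->
  (forall x, c <= x <= d -> `|f x| <= B) ->
  (forall x, x < c \/ d < x -> f x = 0) ->
  `|\int[leb R]_(x in `[a, b]) f x| <= B * (d - c).
Proof.
move=> mf fM B0 ab cd fB f0; have fi := bounded_integrable_itv a b mf fM.
have ii : (leb R).-integrable `[a, b] (EFin \o (fun x => B * \1_(`[c, d]%classic) x)).
  apply: (@bounded_integrable_itv _ `|B|).
    by apply: measurable_funM => //; exact: measurable_indic.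
  move=> x; rewrite normrM ler_piMr// indicE.
  by case: (_ \in _); rewrite ?normr1 ?normr0.
rewrite (le_trans (le_normr_Rintegral _ fi))//.
apply: (@le_trans _ _ (\int[leb R]_(x in `[a, b]) (B * \1_(`[c, d]%classic) x))).
  apply: le_Rintegral => //; first exact: integrable_norm.
  move=> x _; rewrite indicE mem_setE in_itv/=.
  case: (boolP (c <= x <= d)) => [/fB|]; first by rewrite mulr1.
  rewrite negb_and -!ltNge => /orP h.
  by rewrite f0// normr0 mulr0.
rewrite RintegralZl//; last first.
  apply: (@bounded_integrable_itv _ 1); first exact: measurable_indic.
  by move=> x; rewrite indicE; case: (_ \in _); rewrite ?normr1 ?normr0.
rewrite ler_wpM2l// /Rintegral integral_indic//.
rewrite [leRHS](_ : _ = fine (leb R `[c, d]%classic)); last first.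
  rewrite lebesgue_measure_itv/= lte_fin; case: ltgtP cd => // ->; by rewrite subrr.
apply: fine_le.
- rewrite ge0_fin_numE//; apply: le_lt_trans (lebesgue_itvcc_lty c d).
  by apply: le_measure; rewrite ?inE//; exact: measurableI.
- by rewrite ge0_fin_numE//; exact: lebesgue_itvcc_lty.
- by apply: le_measure; rewrite ?inE//; exact: measurableI.
Qed.

Lemma measurable_half_plane : measurable (half_plane R).
Proof.
rewrite (_ : half_plane R = fst @^-1` `[0, +oo[%classic).
  by rewrite -[X in measurable X]setTI; exact: measurable_fst.
by apply/seteqP; split => p /=; rewrite in_itv/= andbT.
Qed.

(** As [0 <= t1], the support lies in the half-plane; the restriction to [half_plane] disappears and
    Fubini on the whole plane reduces to the two intervals. *)
Lemma Rintegral_box (F : R * R -> R) (B t1 t2 x1 x2 : R) :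
  measurable_fun setT F -> (forall p, `|F p| <= B) -> 0 <= t1 ->
  (forall p, F p != 0 -> t1 <= p.1 <= t2 /\ x1 <= p.2 <= x2) ->
  [/\ (leb2 R).-integrable (half_plane R) (EFin \o F),
   (leb R).-integrable `[t1, t2] (fun t => (\int[leb R]_(x in `[x1, x2]) F (t, x))%:E) &
   \int[leb2 R]_(p in half_plane R) F p =
   \int[leb R]_(t in `[t1, t2]) \int[leb R]_(x in `[x1, x2]) F (t, x)].
Proof.
move=> mF FB t10 F0.
pose bx := `[t1, t2]%classic `*` `[x1, x2]%classic.
have mbx : measurable bx by apply: measurableX.
have bxoo : (leb2 R bx < +oo)%E.
  rewrite /bx product_measure1E//.
  by rewrite lte_mul_pinfty// ?ge0_fin_numE// lebesgue_itvcc_lty.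
have Fbx : (EFin \o F) \_ bx = EFin \o F.
  apply/funext => p; rewrite patchE; case: ifPn => // /negP pbx /=.
  case: (eqVneq (F p) 0) => [->//|/F0 [p1 p2]]; exfalso; apply: pbx.
  by rewrite inE; split; rewrite /= in_itv/=.
have iF : (leb2 R).-integrable setT (EFin \o F).
  have iF : (leb2 R).-integrable bx (EFin \o F).
    exact: (@bounded_integrable _ _ (leb2 R) bx F B).
  by rewrite -Fbx; apply/(@integrable_mkcond _ _ _ (leb2 R) bx).
have mh := measurable_half_plane.
have mFt t : measurable_fun setT (fun x => F (t, x)).
  by apply: (measurableT_comp mF); exact: measurable_pair1.
have Ft t : (\int[leb R]_x (EFin \o F) (t, x))%E =
    (\int[leb R]_(x in `[x1, x2]) F (t, x))%:E.
  rewrite /Rintegral fineK; last first.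
    apply: integrable_fin_num => //.
    by apply: (bounded_integrable_itv _ _ (mFt t)) => x; exact: FB.
  rewrite [RHS]integral_mkcond/=; apply: eq_integral => x _.
  rewrite patchE/=; case: ifPn => // /negP xx.
  case: (eqVneq (F (t, x)) 0) => [->//|/F0 [_ p2]]; exfalso; apply: xx.
  by rewrite inE/= in_itv/=.
have Ft0 : (fun t => (\int[leb R]_(x in `[x1, x2]) F (t, x))%:E) =
  (fun t => (\int[leb R]_(x in `[x1, x2]) F (t, x))%:E) \_ `[t1, t2]%classic.
  apply/funext => t; rewrite patchE; case: ifPn => // /negP tt.
  congr EFin; rewrite /Rintegral integral0_eq// => x _.
  case: (eqVneq (F (t, x)) 0) => [->//|/F0 [p1 _]]; exfalso; apply: tt.
  by rewrite inE/= in_itv/=.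
have iG : (leb R).-integrable setT (fun t => (\int[leb R]_(x in `[x1, x2]) F (t, x))%:E).
  by have := integrable_fubini_F iF; apply: eq_integrable => // t _; exact: Ft.
split.
- by apply: integrableS iF.
- by apply: integrableS iG.
- have -> : \int[leb2 R]_(p in half_plane R) F p = \int[leb2 R]_p F p.
    rewrite /Rintegral integral_mkcond; congr fine; apply: eq_integral => p _.
    rewrite patchE; case: ifPn => // /negP ph.
    case: (eqVneq (F p) 0) => [->//|/F0 [p1 _]]; exfalso; apply: ph.
    by rewrite inE/half_plane/=; lra.
  rewrite /Rintegral -(integral12_prod_meas1 iF); congr fine.
  rewrite [RHS]integral_mkcond -Ft0; apply: eq_integral => t _; exact: Ft.
Qed.

End BoundedIntegrals.

(** * Smoothed strips with moving edges *)

Section TestFunctions.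
Context {R : realType}.
Implicit Types (p : R * R) (a b c d k s t x : R).

Lemma compact_support_test (phi : R * R -> R) a b c d :
  smooth phi -> (forall p, phi p != 0 -> a <= p.1 <= b /\ c <= p.2 <= d) ->
  test_function phi.
Proof.
move=> sphi phi0; split=> //.
pose K := `[a, b]%classic `*` `[c, d]%classic : set (R * R).
have cK : compact K by apply: compact_setX; exact: segment_compact.
have clK : closed K.
  have -> : K = fst @^-1` `[a, b]%classic `&` snd @^-1` `[c, d]%classic by [].
  apply: closedI; apply: closed_comp => [q _|]; first exact: cvg_fst.
  - exact: itv_closed.
  - exact: cvg_snd.
  - exact: itv_closed.
apply: (subclosed_compact (@closed_closure _ _) cK).
rewrite (closure_id K).1//; apply: closure_subset => p /phi0 [p1 p2].
by split; rewrite /= in_itv/=.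
Qed.

(** Smoothed indicator of what lies to the right of an edge which is at [a] at time [s] and moves
    with speed [c]. Thus [strip] is the smoothed region between two moving edges, and [bump], the
    derivative of a transition of width [k], has integral 1 over [[s, s + k]]. *)
Definition ramp a c d s p : R := step ((p.2 - (a + c * (p.1 - s))) / d).
Definition cutoff s1 k1 s2 k2 t : R := step ((t - s1) / k1) - step ((t - s2) / k2).
Definition strip a c1 b c2 d s p : R := ramp a c1 d s p - ramp b c2 d s p.
Definition bump k s t : R := k^-1 * dstep ((t - s) / k).

Lemma rampE a c d s :
  ramp a c d s = (fun p => step ((- c / d) * p.1 + d^-1 * p.2 + (c * s - a) / d)).
Proof. by apply/funext => p; rewrite /ramp; congr step; ring. Qed.

Lemma cutoffE s1 k1 s2 k2 : (fun p => cutoff s1 k1 s2 k2 p.1) =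
  (fun p => step (k1^-1 * p.1 + 0 * p.2 + - s1 / k1)) +
  cst (-1) * (fun p => step (k2^-1 * p.1 + 0 * p.2 + - s2 / k2)).
Proof.
apply/funext => p; rewrite /cutoff !fctE mulN1r.
by congr (step _ - step _); ring.
Qed.

Lemma elementary_cutoff_strip s1 k1 s2 k2 a c1 b c2 d s :
  elementary (fun p => cutoff s1 k1 s2 k2 p.1 * strip a c1 b c2 d s p).
Proof.
rewrite (_ : (fun p => _) = (fun p => cutoff s1 k1 s2 k2 p.1) *
  (ramp a c1 d s + cst (-1) * ramp b c2 d s)); last first.
  by apply/funext => p; rewrite !fctE /strip mulN1r.
rewrite cutoffE !rampE.
have E := @elementary_step R; have C := @elementary_cst R (-1).
exact: (elementaryM (elementaryD (E _ _ _) (elementaryM C (E _ _ _)))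
  (elementaryD (E _ _ _) (elementaryM C (E _ _ _)))).
Qed.

(** The derivative falls on the time cutoff or on one of the two edges. An edge of speed [c]
    contributes its bump times [v.2 - c * v.1], so in the equation only the speed of the flow
    relative to the edge appears. *)
Lemma is_derive_cutoff_strip s1 k1 s2 k2 a c1 b c2 d s p v :
  is_derive p v (fun p => cutoff s1 k1 s2 k2 p.1 * strip a c1 b c2 d s p)
   ((bump k1 s1 p.1 - bump k2 s2 p.1) * strip a c1 b c2 d s p * v.1 +
    cutoff s1 k1 s2 k2 p.1 *
     (bump d (a + c1 * (p.1 - s)) p.2 * (v.2 - c1 * v.1)
      - bump d (b + c2 * (p.1 - s)) p.2 * (v.2 - c2 * v.1))).
Proof.
have dr a' c' : is_derive p v (ramp a' c' d s)
    (bump d (a' + c' * (p.1 - s)) p.2 * (v.2 - c' * v.1)).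
  rewrite rampE; apply: is_derive_eq (is_derive_step_affine _ _ _ _ _) _.
  rewrite /bump (_ : (p.2 - (a' + c' * (p.1 - s))) / d =
    - c' / d * p.1 + d^-1 * p.2 + (c' * s - a') / d); last by ring.
  ring.
have dt s' k' : is_derive p v (fun p => step ((p.1 - s') / k')) (bump k' s' p.1 * v.1).
  rewrite (_ : (fun p => _) = (fun p => step (k'^-1 * p.1 + 0 * p.2 + - s' / k'))); last first.
    by apply/funext => q; congr step; ring.
  apply: is_derive_eq (is_derive_step_affine _ _ _ _ _) _.
  rewrite /bump (_ : (p.1 - s') / k' = k'^-1 * p.1 + 0 * p.2 + - s' / k'); last by ring.
  ring.
have ds : is_derive p v (strip a c1 b c2 d s)
    (bump d (a + c1 * (p.1 - s)) p.2 * (v.2 - c1 * v.1) -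
     bump d (b + c2 * (p.1 - s)) p.2 * (v.2 - c2 * v.1)).
  exact: is_deriveB.
have dc : is_derive p v (fun p => cutoff s1 k1 s2 k2 p.1)
    (bump k1 s1 p.1 * v.1 - bump k2 s2 p.1 * v.1).
  exact: is_deriveB.
apply: is_derive_eq (is_deriveM dc ds) _.
change (cutoff s1 k1 s2 k2 p.1 * (bump d (a + c1 * (p.1 - s)) p.2 * (v.2 - c1 * v.1) -
     bump d (b + c2 * (p.1 - s)) p.2 * (v.2 - c2 * v.1)) +
   strip a c1 b c2 d s p * (bump k1 s1 p.1 * v.1 - bump k2 s2 p.1 * v.1) =
   (bump k1 s1 p.1 - bump k2 s2 p.1) * strip a c1 b c2 d s p * v.1 +
    cutoff s1 k1 s2 k2 p.1 *
     (bump d (a + c1 * (p.1 - s)) p.2 * (v.2 - c1 * v.1)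
      - bump d (b + c2 * (p.1 - s)) p.2 * (v.2 - c2 * v.1)) :> R).
by rewrite addrC -mulrBl; congr (_ + _); rewrite mulrC -!mulrA [v.1 * _]mulrC.
Qed.

Lemma step_div_eq0 k x : 0 < k -> x <= 0 -> step (x / k) = 0.
Proof. by move=> k0 x0; rewrite step_le0// mulr_le0_ge0// invr_ge0 ltW. Qed.

Lemma step_div_eq1 k x : 0 < k -> k <= x -> step (x / k) = 1.
Proof. by move=> k0 x0; rewrite step_ge1// ler_pdivlMr// mul1r. Qed.

Lemma cutoff_eq0 s1 k1 s2 k2 t : 0 < k1 -> 0 < k2 ->
  (t < s1 /\ t < s2) \/ (s1 + k1 < t /\ s2 + k2 < t) -> cutoff s1 k1 s2 k2 t = 0.
Proof.
move=> k10 k20 [[h1 h2]|[h1 h2]]; rewrite /cutoff.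
  by rewrite !step_div_eq0// ?subrr ?subr_le0 ?ltW.
by rewrite !step_div_eq1// ?subrr// lerBrDl ltW.
Qed.

(** At a fixed time a strip is a [cutoff] in the space variable, with both widths equal to [d]. *)
Lemma strip_eq0 a c1 b c2 d s p : 0 < d ->
  (p.2 < a + c1 * (p.1 - s) /\ p.2 < b + c2 * (p.1 - s)) \/
  (a + c1 * (p.1 - s) + d < p.2 /\ b + c2 * (p.1 - s) + d < p.2) ->
  strip a c1 b c2 d s p = 0.
Proof. by move=> d0; exact: (@cutoff_eq0 _ _ _ _ p.2 d0 d0). Qed.

Lemma cutoff_norm_le1 s1 k1 s2 k2 t : `|cutoff s1 k1 s2 k2 t| <= 1.
Proof.
have := step_ge0 ((t - s1) / k1); have := step_le1 ((t - s1) / k1).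
have := step_ge0 ((t - s2) / k2); have := step_le1 ((t - s2) / k2).
by rewrite /cutoff ler_norml; lra.
Qed.

Lemma bump_eq0 k s t : 0 < k -> t < s \/ s + k < t -> bump k s t = 0.
Proof.
move=> k0 [h|h]; rewrite /bump.
  by rewrite dstep_lt0 ?mulr0// pmulr_llt0 ?invr_gt0// subr_lt0.
by rewrite dstep_gt1 ?mulr0// ltr_pdivlMr// mul1r ltrBrDl.
Qed.

Lemma bump_norm_le (C : R) k s t : (forall x, `|dstep x| <= C) -> 0 < k ->
  `|bump k s t| <= C / k.
Proof.
move=> dC k0; rewrite /bump normrM normfV (gtr0_norm k0) mulrC.
by rewrite ler_wpM2r// invr_ge0 ltW.
Qed.

Lemma continuous_bump k s : continuous (bump k s).
Proof. exact: continuous_dstep_scaled. Qed.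

End TestFunctions.

(** * Measurability of the strips and comparison with sharp windows *)

Section BumpMeasurability.
Context {R : realType}.
Implicit Types (a b c d k s t x : R).

Lemma measurable_step : measurable_fun setT (@step R).
Proof.
apply: continuous_measurable_fun => x.
by apply/differentiable_continuous/derivable1_diffP; case: (is_derive_step x).
Qed.

Lemma measurable_dstep : measurable_fun setT (@dstep R).
Proof. by apply: continuous_measurable_fun; exact: continuous_dstep. Qed.

Lemma measurable_slanted a c s d :
  measurable_fun setT (fun p : R * R => (p.2 - (a + c * (p.1 - s))) / d).
Proof.
apply: measurable_funM => //; apply: measurable_funB => //.
apply: measurable_funD => //; apply: measurable_funM => //.
by apply: measurable_funB.
Qed.

Lemma measurable_ramp a c d s : measurable_fun setT (ramp a c d s).
Proof. exact: (measurableT_comp measurable_step (measurable_slanted a c s d)). Qed.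

Lemma measurable_strip a c1 b c2 d s : measurable_fun setT (strip a c1 b c2 d s).
Proof. by apply: measurable_funB; exact: measurable_ramp. Qed.

Lemma measurable_bump k s : measurable_fun setT (bump k s).
Proof. by apply: continuous_measurable_fun; exact: continuous_bump. Qed.

Lemma measurable_slanted_bump a c s d :
  measurable_fun setT (fun p : R * R => bump d (a + c * (p.1 - s)) p.2).
Proof.
apply: measurable_funM => //.
exact: (measurableT_comp measurable_dstep (measurable_slanted a c s d)).
Qed.

Lemma measurable_cutoff s1 k1 s2 k2 : measurable_fun setT (cutoff s1 k1 s2 k2).
Proof.
have m s k : measurable_fun setT (fun t : R => step ((t - s) / k)).
  apply: (measurableT_comp measurable_step).
  by apply: measurable_funM => //; apply: measurable_funB.
exact: measurable_funB.
Qed.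

Lemma measurable_slice (F : R * R -> R) t : measurable_fun setT F ->
  measurable_fun setT (fun x => F (t, x)).
Proof. by move=> mF; apply: (measurableT_comp mF); exact: measurable_pair1. Qed.

(** Three errors add up: [f] against [g], and the smoothed edges at [alpha] and [beta] against the
    sharp ones at [a] and [b]. An edge differs from its sharp version only within distance [r],
    which costs [2 * r * M]. *)
Lemma ramp_average (f g : R -> R) (M a b x1 x2 alpha beta d r : R) :
  measurable_fun setT f -> measurable_fun setT g ->
  (forall x, `|f x| <= M) -> (forall x, `|g x| <= M) ->
  0 < d -> x1 <= a -> a <= b -> b <= x2 ->
  `|alpha - a| + d <= r -> `|beta - b| + d <= r ->
  `|\int[leb R]_(x in `[x1, x2]) (f x * (step ((x - alpha) / d) - step ((x - beta) / d)))
     - \int[leb R]_(x in `[a, b]) g x| <=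
  \int[leb R]_(x in `[x1, x2]) `|f x - g x| + 4 * r * M.
Proof.
move=> mf mg fM gM d0 x1a ab bx2 ra rb.
have M0 : 0 <= M := le_trans (normr_ge0 _) (fM 0).
have r0 : 0 <= r by apply: le_trans ra; rewrite addr_ge0// ltW.
have x12 : x1 <= x2 by lra.
have mstep c : measurable_fun setT (fun x : R => step ((x - c) / d)).
  apply: (measurableT_comp measurable_step).
  by apply: measurable_funM => //; apply: measurable_funB.
pose h x := step ((x - alpha) / d) - step ((x - beta) / d).
have mh : measurable_fun setT h by exact: measurable_funB.
have h1 x : `|h x| <= 1 by exact: (cutoff_norm_le1 _ _ _ _ x).
(* The indicator of [[a, b]] is split into one jump per edge, so that each jump is compared with its
   own transition. *)
pose ia x : R := (a <= x)%R%:R; pose ib x : R := (b < x)%R%:R.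
have mia : measurable_fun setT ia.
  rewrite (_ : ia = \1_(`[a, +oo[%classic)); first exact: measurable_indic.
  by apply/funext => x; rewrite indicE mem_setE in_itv/= andbT.
have mib : measurable_fun setT ib.
  rewrite (_ : ib = \1_(`]b, +oo[%classic)); first exact: measurable_indic.
  by apply/funext => x; rewrite indicE mem_setE in_itv/= andbT.
have b01 (bb : bool) : 0 <= (bb%:R : R) <= 1 by case: bb; rewrite /= ?lexx ler01.
have iab x : `|ia x - ib x| <= 1.
  by have := b01 (a <= x); have := b01 (b < x); rewrite /ia /ib ler_norml; lra.
have gE : \int[leb R]_(x in `[a, b]) g x =
    \int[leb R]_(x in `[x1, x2]) (g x * (ia x - ib x)).
  rewrite [LHS]Rintegral_mkcond [RHS]Rintegral_mkcond; congr fine.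
  apply: eq_integral => x _; congr EFin; rewrite !patchE !mem_setE !in_itv/= /ia /ib.
  case: (leP a x) => ax; case: (leP x b) => xb; case: (leP x1 x) => ?; case: (leP x x2) => ? /=;
    rewrite ?subr0 ?subrr ?mulr1 ?mulr0//; lra.
pose F1 x := (f x - g x) * h x.
pose Fa x := g x * (step ((x - alpha) / d) - ia x).
pose Fb x := g x * (step ((x - beta) / d) - ib x).
have bnd (u : R -> R) (c : R) (w : R -> R) : (forall x, `|w x| <= c) -> measurable_fun setT w ->
   (leb R).-integrable `[x1, x2] (EFin \o w).
  by move=> wc mw; apply: bounded_integrable_itv mw wc.
have s01 c x : 0 <= step ((x - c) / d) <= 1 by rewrite step_ge0 step_le1.
have FaM x : `|Fa x| <= M.
  rewrite /Fa normrM -[leRHS]mulr1 ler_pM// ler_norml.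
  by have := b01 (a <= x); have := s01 alpha x; rewrite /ia; lra.
have FbM x : `|Fb x| <= M.
  rewrite /Fb normrM -[leRHS]mulr1 ler_pM// ler_norml.
  by have := b01 (b < x); have := s01 beta x; rewrite /ib; lra.
have fgM x : `|f x - g x| <= M + M by rewrite (le_trans (ler_normB _ _))// lerD.
have F1M x : `|F1 x| <= M + M.
  by rewrite /F1 normrM -[leRHS]mulr1 ler_pM.
have mF1 : measurable_fun setT F1 by apply: measurable_funM => //; exact: measurable_funB.
have mFa : measurable_fun setT Fa by apply: measurable_funM => //; exact: measurable_funB.
have mFb : measurable_fun setT Fb by apply: measurable_funM => //; exact: measurable_funB.
have iF1 := bnd (cst 0) _ _ F1M mF1.
have iFa := bnd (cst 0) _ _ FaM mFa.
have iFb := bnd (cst 0) _ _ FbM mFb.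
have ifh : (leb R).-integrable `[x1, x2] (EFin \o (fun x => f x * h x)).
  apply: (@bounded_integrable_itv _ _ M) => [|x]; first exact: measurable_funM.
  by rewrite normrM -[leRHS]mulr1 ler_pM.
have igi : (leb R).-integrable `[x1, x2] (EFin \o (fun x => g x * (ia x - ib x))).
  apply: (@bounded_integrable_itv _ _ M) => [|x].
    by apply: measurable_funM => //; exact: measurable_funB.
  by rewrite normrM -[leRHS]mulr1 ler_pM.
have iFab : (leb R).-integrable `[x1, x2] (EFin \o (fun x => Fa x - Fb x)).
  apply: (@bounded_integrable_itv _ _ (M + M)) => [|x]; first exact: measurable_funB.
  by rewrite (le_trans (ler_normB _ _))// lerD.
rewrite gE -RintegralB//.
have -> : \int[leb R]_(x in `[x1, x2]) (f x * h x - g x * (ia x - ib x)) =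
    \int[leb R]_(x in `[x1, x2]) (F1 x + (Fa x - Fb x)).
  by apply: eq_Rintegral => x _; rewrite /F1 /Fa /Fb /h; ring.
rewrite RintegralD// RintegralB// (le_trans (ler_normD _ _))// lerD//.
  rewrite (le_trans (le_normr_Rintegral _ iF1))//; apply: le_Rintegral => //.
  - exact: integrable_norm.
  - apply: (@bounded_integrable_itv _ _ (M + M)) => [|x]; last by rewrite normr_id.
    by apply: measurableT_comp => //; exact: measurable_funB.
  - by move=> x _; rewrite /F1 normrM ler_piMr.
have dist c e x : `|c - e| + d <= r -> x < e - r \/ e + r < x ->
    step ((x - c) / d) = (e <= x)%R%:R /\ step ((x - c) / d) = (e < x)%R%:R.
  move=> cer xer; have := lerB_dist c e; have := ler_norm (c - e) => h2 h3.
  have := ler_norm (- (c - e)); rewrite normrN => h4.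
  case: xer => xer.
    rewrite step_div_eq0//; last lra.
    by rewrite (leNgt e) (lt_le_trans xer) ?lerBlDr ?lerDl//= ltNge (ltW (lt_le_trans xer _))// lerBlDr lerDl.
  rewrite step_div_eq1//; last lra.
  by rewrite (ltW (le_lt_trans _ xer)) ?lerDl// (le_lt_trans _ xer) ?lerDl.
rewrite (le_trans (ler_normB _ _))// (_ : 4 * r * M = 2 * r * M + 2 * r * M); last by ring.
have rr e : 2 * r * M = M * (e + r - (e - r)) by ring.
apply: lerD.
  rewrite (rr a); apply: (normr_Rintegral_concentrated mFa FaM M0 x12) => //; first lra.
  by move=> x /(dist _ _ _ ra)[+ _]; rewrite /Fa /ia => ->; rewrite subrr mulr0.
rewrite (rr b); apply: (normr_Rintegral_concentrated mFb FbM M0 x12) => //; first lra.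
by move=> x /(dist _ _ _ rb)[_ +]; rewrite /Fb /ib => ->; rewrite subrr mulr0.
Qed.

End BumpMeasurability.

(** * Transport of mass along moving strips *)

Section StripIdentity.
Context {R : realType}.
Implicit Types (a b c d k s t x : R).

Lemma Rintegral_half_box (F : R * R -> R) (B t1 t2 x1 x2 : R) :
  measurable_fun setT F -> (forall p, `|F p| <= B) -> 0 <= t1 ->
  (forall p, 0 <= p.1 -> F p != 0 -> t1 <= p.1 <= t2 /\ x1 <= p.2 <= x2) ->
  [/\ (leb2 R).-integrable (half_plane R) (EFin \o F),
   (leb R).-integrable `[t1, t2] (fun t => (\int[leb R]_(x in `[x1, x2]) F (t, x))%:E) &
   \int[leb2 R]_(p in half_plane R) F p =
   \int[leb R]_(t in `[t1, t2]) \int[leb R]_(x in `[x1, x2]) F (t, x)].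
Proof.
move=> mF FB t10 F0.
pose G p := F p * \1_(half_plane R) p.
have ind01 p : `|\1_(half_plane R) p : R| <= 1.
  by rewrite indicE; case: (_ \in _); rewrite ?normr1 ?normr0.
have mG : measurable_fun setT G.
  apply: measurable_funM => //; apply: measurable_indic; exact: measurable_half_plane.
have GB p : `|G p| <= B.
  rewrite /G normrM (le_trans _ (FB p))// ler_piMr//.
have FG p : 0 <= p.1 -> G p = F p.
  by move=> p0; rewrite /G indicE mem_set ?mulr1.
have G0 p : G p != 0 -> t1 <= p.1 <= t2 /\ x1 <= p.2 <= x2.
  have [p0|p0] := leP 0 p.1; first by rewrite FG//; exact: F0.
  rewrite /G indicE memNset ?mulr0 ?eqxx// /half_plane/= leNgt p0//.
have [iG iGt GE] := Rintegral_box mG GB t10 G0; split.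
- by apply: eq_integrable iG; [exact: measurable_half_plane|move=> p; rewrite inE => /FG /= ->].
- apply: eq_integrable iGt => // t; rewrite inE/= in_itv/= => /andP[tt _].
  congr EFin; apply: eq_Rintegral => x _; apply: FG; exact: le_trans tt.
- rewrite (_ : \int[leb2 R]_(p in half_plane R) F p = \int[leb2 R]_(p in half_plane R) G p).
    rewrite GE; apply: eq_Rintegral => t; rewrite inE/= in_itv/= => /andP[tt _].
    apply: eq_Rintegral => x _; apply: FG; exact: le_trans tt.
  by apply: eq_Rintegral => p; rewrite inE => /FG.
Qed.

Lemma normr_Rintegral_half_box (F : R * R -> R) (B K t1 t2 x1 x2 : R) :
  measurable_fun setT F -> (forall p, `|F p| <= B) -> 0 <= t1 -> t1 <= t2 ->
  (forall p, 0 <= p.1 -> F p != 0 -> t1 <= p.1 <= t2 /\ x1 <= p.2 <= x2) ->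
  (forall t, t1 <= t <= t2 -> `|\int[leb R]_(x in `[x1, x2]) F (t, x)| <= K) ->
  `|\int[leb2 R]_(p in half_plane R) F p| <= K * (t2 - t1).
Proof.
move=> mF FB t10 t12 F0 FK; have [_ iG ->] := Rintegral_half_box mF FB t10 F0.
rewrite (le_trans (le_normr_Rintegral _ iG))// -Rintegral_itv_cst//.
apply: le_Rintegral => //.
- exact: integrable_norm.
- exact: (@bounded_integrable_itv _ _ `|K|).
Qed.

Definition mass (v : R * R -> R) t a b : R := \int[leb R]_(x in `[a, b]) v (t, x).
Definition avg (v : R * R -> R) (eps t x : R) : R := eps^-1 * mass v t x (x + eps).

Context (v : R * R -> R) (u0 : R -> R) (M eps C : R).
Context (mv : measurable_fun setT v) (vM : forall p, `|v p| <= M).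
Context (eps0 : 0 < eps) (C0 : 0 <= C) (dC : forall x, `|dstep x| <= C).

Let M0 : 0 <= M. Proof. exact: le_trans (normr_ge0 _) (vM (0, 0)). Qed.

Lemma mass_norm_le t a b : a <= b -> `|mass v t a b| <= M * (b - a).
Proof.
by move=> ab; apply: (@normr_Rintegral_itv_le _ _ M) => //; exact: measurable_slice.
Qed.

Lemma avg_norm_le t x : `|avg v eps t x| <= M.
Proof.
rewrite /avg normrM normfV (gtr0_norm eps0) ler_pdivrMl//.
rewrite (le_trans (mass_norm_le _ _))//; first by rewrite lerDl ltW.
by rewrite addrAC subrr add0r mulrC.
Qed.

(** The window is a section of a measurable set of the product, and [v + M] is nonnegative, so the
    measurability part of Tonelli's theorem applies; the constant is subtracted afterwards. *)
Lemma measurable_avg : measurable_fun setT (fun p => avg v eps p.1 p.2).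
Proof.
pose D := [set q : (R * R) * R | q.1.2 <= q.2 <= q.1.2 + eps].
have mD : measurable D.
  have m1 : measurable_fun setT (fun q : (R * R) * R => (q.1.2 <= q.2) && (q.2 <= q.1.2 + eps)).
    have m12 : measurable_fun setT (fun q : (R * R) * R => q.1.2).
      exact: (measurableT_comp measurable_snd measurable_fst).
    apply: measurable_and; apply: measurable_fun_ler => //.
    by apply: measurable_funD.
  by have := m1 measurableT [set true] I; rewrite setTI.
pose F (q : (R * R) * R) : \bar R := ((v (q.1.1, q.2) + M) * \1_D q)%:E.
have mF : measurable_fun setT F.
  apply/measurable_EFinP; apply: measurable_funM; last exact: measurable_indic.
  apply: measurable_funD => //; apply: (measurableT_comp mv).
  apply/measurable_fun_pairP; split => /=.
    exact: (measurableT_comp measurable_fst measurable_fst).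
  exact: measurable_snd.
have F0 q : (0 <= F q)%E.
  rewrite lee_fin mulr_ge0//; first by have := vM (q.1.1, q.2); rewrite ler_norml; lra.
have mG := measurable_fun_fubini_tonelli_F (m2 := leb R) F mF F0.
have -> : (fun p => avg v eps p.1 p.2) =
    (fun p => eps^-1 * (fine (fubini_F (leb R) F p) - M * eps)).
  apply/funext => p; rewrite /avg /mass; congr (_ * _).
  rewrite (_ : fine _ = \int[leb R]_(x in `[p.2, p.2 + eps]) (v (p.1, x) + M)).
    rewrite RintegralD//.
    - rewrite Rintegral_itv_cst ?lerDl ?ltW//; ring.
    - by apply: (@bounded_integrable_itv _ _ M) => //; exact: measurable_slice.
    - exact: (@bounded_integrable_itv _ _ `|M|).
  rewrite [RHS]Rintegral_mkcond; congr fine; apply: eq_integral => x _.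
  have DE : ((p, x) \in D) = (p.2 <= x <= p.2 + eps) by apply/idP/idP; rewrite inE.
  rewrite /F indicE DE patchE mem_setE in_itv/=.
  by case: ifPn => _; rewrite /= ?mulr1 ?mulr0.
apply: measurable_funM => //; apply: measurable_funB => //.
exact: (measurableT_comp (fine_measurable _) mG).
Qed.

(** Mass crossing a smoothed edge: density times the speed of the flow relative to the edge,
    localised in time by the cutoff. *)
Definition endpoint_flux a c d s s1 k1 s2 k2 (p : R * R) : R :=
  v p * (cutoff s1 k1 s2 k2 p.1 *
    (bump d (a + c * (p.1 - s)) p.2 * (1 - avg v eps p.1 p.2 - c))).

Lemma measurable_endpoint_flux a c d s s1 k1 s2 k2 :
  measurable_fun setT (endpoint_flux a c d s s1 k1 s2 k2).
Proof.
apply: measurable_funM => //; apply: measurable_funM.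
  exact: (measurableT_comp (measurable_cutoff _ _ _ _) measurable_fst).
apply: measurable_funM; first exact: measurable_slanted_bump.
by apply: measurable_funB => //; apply: measurable_funB => //; exact: measurable_avg.
Qed.

Lemma endpoint_flux_norm_le a c d s s1 k1 s2 k2 p : 0 < d ->
  `|endpoint_flux a c d s s1 k1 s2 k2 p| <= M * (1 * (C / d * (1 + M + `|c|))).
Proof.
move=> d0; rewrite /endpoint_flux normrM ler_pM// normrM.
rewrite ler_pM ?cutoff_norm_le1// normrM ler_pM ?bump_norm_le//.
rewrite (le_trans (ler_normB _ _))// lerD// (le_trans (ler_normB _ _))//.
by rewrite normr1 lerD// avg_norm_le.
Qed.

(** Once integrated, the mass of the strip averaged over the short time interval [[s', s' + k]]. *)
Definition edge_mass k s' a c1 b c2 d s (p : R * R) : R :=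
  v p * (bump k s' p.1 * strip a c1 b c2 d s p).

Lemma measurable_edge_mass k s' a c1 b c2 d s :
  measurable_fun setT (edge_mass k s' a c1 b c2 d s).
Proof.
apply: measurable_funM => //; apply: measurable_funM; last exact: measurable_strip.
exact: (measurableT_comp (measurable_bump _ _) measurable_fst).
Qed.

Lemma strip_norm_le1 a c1 b c2 d s p : `|strip a c1 b c2 d s p| <= 1.
Proof. exact: (cutoff_norm_le1 _ _ _ _ p.2). Qed.

Lemma edge_mass_norm_le k s' a c1 b c2 d s p : 0 < k ->
  `|edge_mass k s' a c1 b c2 d s p| <= M * (C / k * 1).
Proof.
move=> k0; rewrite /edge_mass normrM ler_pM// normrM.
by rewrite ler_pM ?bump_norm_le ?strip_norm_le1.
Qed.

Lemma strip_support a c1 b c2 d s T p : 0 < d -> 0 <= p.1 <= T ->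
  strip a c1 b c2 d s p != 0 ->
  - (`|a| + `|b| + (`|c1| + `|c2|) * (T + `|s|) + d) <= p.2 <=
    `|a| + `|b| + (`|c1| + `|c2|) * (T + `|s|) + d.
Proof.
move=> d0 pT; apply: contraNT.
have ps : `|p.1 - s| <= T + `|s|.
  by rewrite (le_trans (ler_normB _ _))// lerD2r ger0_norm; lra.
have h c : `|c * (p.1 - s)| <= `|c| * (T + `|s|) by rewrite normrM ler_wpM2l.
have := h c1; have := h c2; rewrite mulrDl.
set u := c1 * _; set w := c2 * _; set U := `|c1| * _; set W := `|c2| * _.
rewrite !ler_norml => wW uU; have := ler_norm a; have := ler_norm (- a).
have := ler_norm b; have := ler_norm (- b); rewrite !normrN => b1 b2 a1 a2.
have nb := normr_ge0 b; have na := normr_ge0 a.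
rewrite negb_and -!ltNge => /orP px; rewrite strip_eq0// -/u -/w.
by case: px => px; [left|right]; split; lra.
Qed.

(** The equation is assumed for test functions with measurable partial derivatives, which the strips
    have: measurability of the integrand is what lets [v] replace the given solution up to a null
    set. *)
Context (weak : forall phi : R * R -> R, test_function phi ->
  (forall i : bool, measurable_fun setT ('D_(dir R i) phi : R * R -> R)) ->
  \int[leb2 R]_(p in half_plane R)
     (v p * ('D_(dir R true) phi p + (1 - avg v eps p.1 p.2) * 'D_(dir R false) phi p))
  + \int[leb R]_x (u0 x * phi (0, x)) = 0).

Definition strip_radius a b c1 c2 d s T : R :=
  `|a| + `|b| + (`|c1| + `|c2|) * (T + `|s|) + d.

Lemma cutoff_support s1 k1 s2 k2 t : 0 < k1 -> 0 < k2 -> 0 <= t ->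
  cutoff s1 k1 s2 k2 t != 0 -> 0 <= t <= `|s1| + `|s2| + k1 + k2.
Proof.
move=> k10 k20 t0; apply: contraNT; rewrite t0/= -ltNge => h.
have := ler_norm s1; have := ler_norm s2.
have := normr_ge0 s1; have := normr_ge0 s2 => h1 h2 h3 h4.
by rewrite cutoff_eq0//; right; split; lra.
Qed.

Lemma bump_support s1 k1 t : 0 < k1 -> bump k1 s1 t != 0 -> s1 <= t <= s1 + k1.
Proof.
move=> k10; apply: contraNT; rewrite negb_and -!ltNge => /orP h.
by rewrite bump_eq0.
Qed.

Lemma edge_mass_support k s' a c1 b c2 d s T (p : R * R) : 0 < k -> 0 < d -> s' + k <= T ->
  0 <= p.1 -> edge_mass k s' a c1 b c2 d s p != 0 ->
  s' <= p.1 <= s' + k /\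
  - strip_radius a b c1 c2 d s T <= p.2 <= strip_radius a b c1 c2 d s T.
Proof.
move=> k0 d0 kT p0; rewrite mulf_eq0 negb_or => /andP[_].
rewrite mulf_eq0 negb_or => /andP[h1 h2].
have h := bump_support k0 h1; split=> //.
by apply: (strip_support d0 _ h2); lra.
Qed.

Lemma endpoint_flux_support a c d s s1 k1 s2 k2 t1 L T (p : R * R) : 0 < d ->
  (forall t, 0 <= t -> cutoff s1 k1 s2 k2 t != 0 -> t1 <= t <= t1 + L) ->
  t1 + L <= T -> 0 <= p.1 -> endpoint_flux a c d s s1 k1 s2 k2 p != 0 ->
  t1 <= p.1 <= t1 + L /\
  - (`|a| + `|c| * (T + `|s|) + d) <= p.2 <= `|a| + `|c| * (T + `|s|) + d.
Proof.
move=> d0 hc LT p0; rewrite mulf_eq0 negb_or => /andP[_].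
rewrite mulf_eq0 negb_or => /andP[/(hc _ p0) h1].
rewrite mulf_eq0 negb_or => /andP[h2 _].
split=> //; have := bump_support d0 h2.
have ps : `|p.1 - s| <= T + `|s|.
  by rewrite (le_trans (ler_normB _ _))// lerD2r ger0_norm; lra.
have : `|c * (p.1 - s)| <= `|c| * (T + `|s|) by rewrite normrM ler_wpM2l.
set w := c * _; set W := `|c| * _; rewrite ler_norml.
have := ler_norm a; have := ler_norm (- a); rewrite normrN; lra.
Qed.

(** The weak equation tested with a cutoff times a strip: the time derivative of the cutoff gives
    the masses of the strip near the times [s1] and [s2], the derivatives of the strip give the
    fluxes through its two edges. *)
Lemma strip_identity s1 k1 s2 k2 a c1 b c2 d s : 0 < k1 -> 0 < k2 -> 0 < d ->
  \int[leb2 R]_(p in half_plane R) edge_mass k1 s1 a c1 b c2 d s p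
  - \int[leb2 R]_(p in half_plane R) edge_mass k2 s2 a c1 b c2 d s p
  + (\int[leb2 R]_(p in half_plane R) endpoint_flux a c1 d s s1 k1 s2 k2 p
     - \int[leb2 R]_(p in half_plane R) endpoint_flux b c2 d s s1 k1 s2 k2 p)
  + \int[leb R]_x (u0 x * (cutoff s1 k1 s2 k2 0 * strip a c1 b c2 d s (0, x))) = 0.
Proof.
move=> k10 k20 d0.
pose T := `|s1| + `|s2| + k1 + k2.
have [T0 T1 T2] : [/\ 0 <= T, s1 + k1 <= T & s2 + k2 <= T].
  have := ler_norm s1; have := ler_norm s2.
  by have := normr_ge0 s1; have := normr_ge0 s2; rewrite /T; split; lra.
have iE k' s' : 0 < k' -> s' + k' <= T ->
    (leb2 R).-integrable (half_plane R) (EFin \o edge_mass k' s' a c1 b c2 d s).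
  move=> k'0 kT; have [] := @Rintegral_half_box (edge_mass k' s' a c1 b c2 d s) _ 0 T
    (- strip_radius a b c1 c2 d s T) (strip_radius a b c1 c2 d s T)
    (measurable_edge_mass _ _ _ _ _ _ _ _)
    (fun p => edge_mass_norm_le s' a c1 b c2 d s p k'0) (lexx 0) => //.
  by move=> p p0 /(edge_mass_support k'0 d0 kT p0)[h ?]; split=> //; lra.
have iF a' c' : (leb2 R).-integrable (half_plane R)
    (EFin \o endpoint_flux a' c' d s s1 k1 s2 k2).
  have cs t : 0 <= t -> cutoff s1 k1 s2 k2 t != 0 -> 0 <= t <= 0 + T.
    by rewrite add0r; exact: cutoff_support.
  have T00 : 0 + T <= T by rewrite add0r.
  by have [] := Rintegral_half_box (measurable_endpoint_flux _ _ _ _ _ _ _ _)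
    (fun p => endpoint_flux_norm_le a' c' s s1 k1 s2 k2 p d0) (lexx 0)
    (fun p => @endpoint_flux_support a' c' d s s1 k1 s2 k2 0 T T p d0 cs T00).
have mh := @measurable_half_plane R.
have sphi := elementary_smooth (elementary_cutoff_strip s1 k1 s2 k2 a c1 b c2 d s).
(* Test functions live on the whole plane, so the support has to be bounded at negative times too;
   neither transition of the cutoff starts before [t0]. *)
pose t0 := - `|s1| - `|s2|.
have tphi : test_function (fun p => cutoff s1 k1 s2 k2 p.1 * strip a c1 b c2 d s p).
  pose Y := `|a| + `|b| + (`|c1| + `|c2|) * (T - t0 + `|s|) + d.
  apply: (@compact_support_test _ _ t0 T (- Y) Y sphi) => p.
  rewrite mulf_eq0 negb_or => /andP[h1 h2].
  have pT : t0 <= p.1 <= T.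
    apply: contraNT h1; rewrite negb_and -!ltNge /t0 /T => h.
    have := ler_norm (- s1); have := ler_norm (- s2); rewrite !normrN.
    have := ler_norm s1; have := ler_norm s2.
    have := normr_ge0 s1; have := normr_ge0 s2 => ? ? ? ? ? ?.
    by rewrite cutoff_eq0//; case/orP: h => h; [left|right]; split; lra.
  split=> //.
  have ps : 0 <= `|p.1| <= T - t0.
    rewrite normr_ge0/= ler_norml; have := normr_ge0 s1; have := normr_ge0 s2.
    by move: pT; rewrite /T /t0; lra.
  have [p0|p0] := leP 0 p.1.
    by apply: (strip_support d0 _ h2); rewrite p0/= -[p.1]ger0_norm//; lra.
  (* a strip at a negative time is a strip at a positive time with opposite slopes *)
  have h2' : strip a (- c1) b (- c2) d (- s) (- p.1, p.2) != 0.
    move: h2; rewrite /strip /ramp /=.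
    by rewrite (_ : - c1 * (- p.1 - - s) = c1 * (p.1 - s)) 1?(_ : - c2 * (- p.1 - - s) = c2 * (p.1 - s)); [|ring|ring].
  have := @strip_support a (- c1) b (- c2) d (- s) (T - t0) (- p.1, p.2) d0 _ h2'.
  by rewrite !normrN /=; apply; move: ps; rewrite ltr0_norm//; lra.
have mphi e : measurable_fun setT ('D_(dir R e)
    (fun p => cutoff s1 k1 s2 k2 p.1 * strip a c1 b c2 d s p)).
  rewrite (_ : 'D_(dir R e) _ = (fun p => (bump k1 s1 p.1 - bump k2 s2 p.1) *
    strip a c1 b c2 d s p * (dir R e).1 + cutoff s1 k1 s2 k2 p.1 *
     (bump d (a + c1 * (p.1 - s)) p.2 * ((dir R e).2 - c1 * (dir R e).1)
      - bump d (b + c2 * (p.1 - s)) p.2 * ((dir R e).2 - c2 * (dir R e).1)))); last first.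
    apply/funext => p.
    by have -> := @derive_val _ _ _ _ _ _ _ (is_derive_cutoff_strip s1 k1 s2 k2 a c1 b c2 d s p (dir R e)).
  have mb k s' : measurable_fun setT (fun p : R * R => bump k s' p.1).
    exact: (measurableT_comp (measurable_bump _ _) measurable_fst).
  apply: measurable_funD; apply: measurable_funM => //.
  - apply: measurable_funM; last exact: measurable_strip.
    by apply: measurable_funB; exact: mb.
  - exact: (measurableT_comp (measurable_cutoff _ _ _ _) measurable_fst).
  - by apply: measurable_funB; apply: measurable_funM => //; exact: measurable_slanted_bump.
have := weak tphi mphi; congr (_ + _ = 0).
rewrite -RintegralB//; [|exact: iE|exact: iE].
rewrite -RintegralB//.
rewrite -RintegralD//; first last.
- exact: (integrable_EFinB (mu := leb2 R)).
- by apply: (integrable_EFinB (mu := leb2 R)) => //; exact: iE.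
apply: eq_Rintegral => p _.
have dp v' := is_derive_cutoff_strip s1 k1 s2 k2 a c1 b c2 d s p v'.
have -> := @derive_val _ _ _ _ _ _ _ (dp (dir R true)).
have -> := @derive_val _ _ _ _ _ _ _ (dp (dir R false)).
rewrite /edge_mass /endpoint_flux.
have alg (y e1 e2 st cu f1 f2 V : R) :
    y * ((e1 - e2) * st * 1 + cu * (f1 * (0 - c1 * 1) - f2 * (0 - c2 * 1)) +
      V * ((e1 - e2) * st * 0 + cu * (f1 * (1 - c1 * 0) - f2 * (1 - c2 * 0)))) =
    y * (e1 * st) - y * (e2 * st) +
      (y * (cu * (f1 * (V - c1))) - y * (cu * (f2 * (V - c2)))) by ring.
exact: alg.
Qed.

Context (mu0 : measurable_fun setT u0) (u0M : forall x, `|u0 x| <= M).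
Context (vcont : forall X t, 0 <= t -> forall e : R, 0 < e ->
  exists2 del : R, 0 < del & forall s, 0 <= s -> `|s - t| <= del ->
    \int[leb R]_(x in `[- X, X]) `|v (s, x) - v (t, x)| <= e).

(** The width [d] cancels: the edge bump is at most [C / d] on a length [d]. The bound therefore
    persists as [d] tends to 0, and it is small when the edge follows the flow up to [omega]. *)
Lemma flux_bound (a c d s s1 k1 s2 k2 t1 L omega : R) : 0 < d -> 0 <= t1 -> 0 <= L ->
  0 <= omega ->
  (forall t, 0 <= t -> cutoff s1 k1 s2 k2 t != 0 -> t1 <= t <= t1 + L) ->
  (forall t x, t1 <= t <= t1 + L -> a + c * (t - s) <= x <= a + c * (t - s) + d ->
    `|1 - avg v eps t x - c| <= omega) ->
  `|\int[leb2 R]_(p in half_plane R) endpoint_flux a c d s s1 k1 s2 k2 p|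
    <= M * C * omega * L.
Proof.
move=> d0 t10 L0 om0 hcut hV.
pose X := `|a| + `|c| * (t1 + L + `|s|) + d.
have X0 : 0 <= X.
  by rewrite /X !addr_ge0 ?mulr_ge0 ?addr_ge0 ?normr_ge0// ltW.
rewrite [leRHS](_ : _ = (M * (1 * (C / d * omega)) * d) * (t1 + L - t1)); last first.
  rewrite addrAC subrr add0r mul1r; congr (_ * L); rewrite -!mulrA; congr (_ * (_ * _)).
  by rewrite mulrCA mulVf ?mulr1// gt_eqF.
apply: (normr_Rintegral_half_box (B := M * (1 * (C / d * (1 + M + `|c|)))) (x1 := - X) (x2 := X)).
- exact: measurable_endpoint_flux.
- by move=> p; exact: endpoint_flux_norm_le.
- by [].
- by rewrite lerDl.
- by move=> p p0; apply: (endpoint_flux_support d0 hcut).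
move=> t tt; set al := a + c * (t - s).
rewrite [X in _ <= _ * X](_ : d = al + d - al); last by ring.
apply: (normr_Rintegral_concentrated (M := M * (1 * (C / d * (1 + M + `|c|))))).
- exact: (@measurable_slice _ _ t (measurable_endpoint_flux a c d s s1 k1 s2 k2)).
- by move=> x; exact: endpoint_flux_norm_le.
- by rewrite mulr_ge0// mul1r mulr_ge0// divr_ge0// ltW.
- lra.
- by rewrite lerDl ltW.
- move=> x xd; rewrite /endpoint_flux normrM ler_pM// normrM.
  rewrite ler_pM ?cutoff_norm_le1// normrM ler_pM ?bump_norm_le//.
  exact: hV.
- by move=> x xd; rewrite /endpoint_flux bump_eq0 ?mul0r ?mulr0.
Qed.

(** During the averaging time an edge moves by at most its speed times [k] and is smeared over [d],
    whence [r]; continuity in L^1 controls the change of [v] by [e]. *)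
Lemma edge_mass_bound (s' k d a c1 b c2 s e r X : R) : 0 <= s' -> 0 < k -> 0 < d ->
  a + c1 * (s' - s) <= b + c2 * (s' - s) ->
  `|c1| * k + d <= r -> `|c2| * k + d <= r ->
  strip_radius a b c1 c2 d s (s' + k) <= X ->
  (forall t, s' <= t <= s' + k ->
    \int[leb R]_(x in `[- X, X]) `|v (t, x) - v (s', x)| <= e) ->
  `|\int[leb2 R]_(p in half_plane R) edge_mass k s' a c1 b c2 d s p
    - mass v s' (a + c1 * (s' - s)) (b + c2 * (s' - s))| <= C * (e + 4 * r * M).
Proof.
move=> s'0 k0 d0 ab r1 r2 rX hv.
have hX : [/\ - X <= a + c1 * (s' - s) & b + c2 * (s' - s) <= X].
  have ps : `|s' - s| <= s' + k + `|s|.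
    by rewrite (le_trans (ler_normB _ _))// lerD2r ger0_norm; lra.
  have h c : `|c * (s' - s)| <= `|c| * (s' + k + `|s|) by rewrite normrM ler_wpM2l.
  move: rX; rewrite /strip_radius; have := h c1; have := h c2; rewrite mulrDl.
  have := mulr_ge0 (normr_ge0 c1) (le_trans (normr_ge0 _) ps).
  have := mulr_ge0 (normr_ge0 c2) (le_trans (normr_ge0 _) ps).
  set u := c1 * _; set w := c2 * _; set U := `|c1| * _; set W := `|c2| * _.
  rewrite !ler_norml; have := ler_norm a; have := ler_norm (- a).
  have := ler_norm b; have := ler_norm (- b); rewrite !normrN.
  by have := normr_ge0 b; have := normr_ge0 a; split; lra.
have [X1 X2] := hX.
set m := mass _ _ _ _.
have sup p : 0 <= p.1 -> edge_mass k s' a c1 b c2 d s p != 0 ->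
    s' <= p.1 <= s' + k /\ - X <= p.2 <= X.
  by move=> p0 /(edge_mass_support k0 d0 (lexx _) p0)[h1 h2]; split=> //; lra.
have [_ iG ->] := Rintegral_half_box (measurable_edge_mass k s' a c1 b c2 d s)
  (fun p => edge_mass_norm_le s' a c1 b c2 d s p k0) s'0 sup.
have kC t : `|bump k s' t| <= C / k by exact: bump_norm_le.
have ib : (leb R).-integrable `[s', s' + k] (EFin \o bump k s').
  by apply: (@bounded_integrable_itv _ _ (C / k)) => //; exact: measurable_bump.
have -> : m = \int[leb R]_(t in `[s', s' + k]) (bump k s' t * m).
  by rewrite RintegralZr// integral_dstep// mul1r.
have ibm : (leb R).-integrable `[s', s' + k] (EFin \o (fun t => bump k s' t * m)).
  apply: (@bounded_integrable_itv _ _ (C / k * `|m|)) => [|t].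
    by apply: measurable_funM => //; exact: measurable_bump.
  by rewrite normrM ler_wpM2r.
rewrite -RintegralB//.
have iGb := integrable_EFinB _ iG ibm.
rewrite (le_trans (le_normr_Rintegral _ (iGb _)))//.
rewrite [leRHS](_ : _ = \int[leb R]_(t in `[s', s' + k]) (C / k * (e + 4 * r * M))); last first.
  rewrite Rintegral_itv_cst ?lerDl ?ltW// addrAC subrr add0r.
  by rewrite [RHS]mulrAC divfK// gt_eqF.
apply: le_Rintegral => //.
- exact: integrable_norm (iGb _).
- exact: (@bounded_integrable_itv _ _ `|C / k * (e + 4 * r * M)|).
move=> t; rewrite /= in_itv/= => tt.
have -> : \int[leb R]_(x in `[- X, X]) edge_mass k s' a c1 b c2 d s (t, x) =
    bump k s' t * \int[leb R]_(x in `[- X, X]) (v (t, x) * strip a c1 b c2 d s (t, x)).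
  rewrite -RintegralZl//.
    by apply: eq_Rintegral => x _; rewrite /edge_mass/= mulrCA.
  apply: (@bounded_integrable_itv _ _ M) => [|x].
    apply: measurable_funM; first exact: measurable_slice.
    exact: (@measurable_slice _ _ t (measurable_strip _ _ _ _ _ _)).
  by rewrite normrM -[leRHS]mulr1 ler_pM// strip_norm_le1.
rewrite -mulrBr normrM ler_pM//.
have dist c : `|c| * k + d <= r ->
    forall a', `|a' + c * (t - s) - (a' + c * (s' - s))| + d <= r.
  move=> cr a'; apply: le_trans cr.
  rewrite lerD2r (_ : _ - _ = c * (t - s')); last by ring.
  by rewrite normrM ler_wpM2l// ger0_norm; lra.
rewrite (le_trans (ramp_average (measurable_slice _ mv) (measurable_slice _ mv)
  (fun x => vM (t, x)) (fun x => vM (s', x)) d0 X1 ab X2 (dist _ r1 a) (dist _ r2 b)))//.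
by rewrite lerD2r hv.
Qed.

(** Each edge follows the flow up to an error [om], so it lets through at most [M * C * om] per unit
    of time; the widths of all transitions are then sent to 0. *)
Lemma transport_step (s h a b c1 c2 d0 om : R) : 0 <= s -> 0 <= h -> 0 < d0 ->
  0 <= om -> a <= b -> a + c1 * h <= b + c2 * h ->
  (forall t x, s <= t <= s + h + d0 -> a + c1 * (t - s) <= x <= a + c1 * (t - s) + d0 ->
    `|1 - avg v eps t x - c1| <= om) ->
  (forall t x, s <= t <= s + h + d0 -> b + c2 * (t - s) <= x <= b + c2 * (t - s) + d0 ->
    `|1 - avg v eps t x - c2| <= om) ->
  `|mass v (s + h) (a + c1 * h) (b + c2 * h) - mass v s a b| <= 2 * (M * C * om) * h.
Proof.
move=> s0 h0 d00 om0 ab abh ha hb; apply/ler_addgt0Pr => e e0.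
pose X := strip_radius a b c1 c2 1 s (s + h + 1).
pose e1 := e / (8 * (C + 1)).
have C10 : 0 < C + 1 by rewrite ltr_wpDl.
have e10 : 0 < e1 by rewrite divr_gt0// mulr_gt0.
have [del1 del10 hd1] := vcont X s0 e10.
have sh0 : 0 <= s + h by rewrite addr_ge0.
have [del2 del20 hd2] := vcont X sh0 e10.
(* [N] bounds the total coefficient of the common width [k] of the time and space transitions in the
   error. *)
pose N := 2 * (M * C * om) + 8 * C * (`|c1| + `|c2| + 1) * M + 1.
have MCo : 0 <= M * C * om by rewrite !mulr_ge0.
have NN : 0 <= 8 * C * (`|c1| + `|c2| + 1) * M.
  by rewrite !mulr_ge0// !addr_ge0.
have N0 : 0 < N by rewrite ltr_pwDr// addr_ge0// mulr_ge0.
pose k := Num.min (Num.min d0 1) (Num.min (Num.min del1 del2) (e / (2 * N))).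
have k0 : 0 < k.
  by rewrite !lt_min d00 ltr01 del10 del20 divr_gt0// mulr_gt0.
have [kd0 k1 kdel1 kdel2 kN] : [/\ k <= d0, k <= 1, k <= del1, k <= del2 & k <= e / (2 * N)].
  by split; rewrite /k !ge_min lexx ?orbT.
have kNe : k * N <= e / 2.
  by move: kN; rewrite -ler_pdivlMr// -[e / 2 / N]mulrA -invfM.
pose r := (`|c1| + `|c2| + 1) * k.
have r1 : `|c1| * k + k <= r.
  by rewrite /r !mulrDl mul1r lerD2r lerDl mulr_ge0// ltW.
have r2 : `|c2| * k + k <= r.
  by rewrite /r !mulrDl mul1r lerD2r lerDr mulr_ge0// ltW.
have := @strip_identity s k (s + h) k a c1 b c2 k s k0 k0 k0.
(* Both transitions of the cutoff start at or after time 0, so the datum does not contribute. *)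
have -> : \int[leb R]_x (u0 x * (cutoff s k (s + h) k 0 * strip a c1 b c2 k s (0, x))) = 0.
  rewrite /Rintegral integral0_eq// => x _; congr EFin.
  by rewrite /cutoff !step_div_eq0 ?subrr ?mul0r ?mulr0// sub0r oppr_le0.
rewrite addr0.
have hcut t : 0 <= t -> cutoff s k (s + h) k t != 0 -> s <= t <= s + (h + k).
  move=> t0; apply: contraNT; rewrite negb_and -!ltNge => /orP hh.
  rewrite cutoff_eq0//; move: hh h0 k0; clear => hh h0 k0.
  by case: hh => hh; [left|right]; split; lra.
have hk0 : 0 <= h + k by rewrite addr_ge0// ltW.
have fa : `|\int[leb2 R]_(p in half_plane R) endpoint_flux a c1 k s s k (s + h) k p|
    <= M * C * om * (h + k).
  apply: (flux_bound k0 s0 hk0 om0 hcut) => t x tt xx.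
  by apply: ha; move: tt xx kd0; clear => *; lra.
have fb : `|\int[leb2 R]_(p in half_plane R) endpoint_flux b c2 k s s k (s + h) k p|
    <= M * C * om * (h + k).
  apply: (flux_bound k0 s0 hk0 om0 hcut) => t x tt xx.
  by apply: hb; move: tt xx kd0; clear => *; lra.
have radX T : T <= s + h + 1 -> strip_radius a b c1 c2 k s T <= X.
  move=> TT; rewrite /X /strip_radius lerD// lerD2l ler_wpM2l ?addr_ge0//.
  by rewrite lerD2r.
have e_s : `|\int[leb2 R]_(p in half_plane R) edge_mass k s a c1 b c2 k s p - mass v s a b|
    <= C * (e1 + 4 * r * M).
  have := @edge_mass_bound s k k a c1 b c2 s e1 r X s0 k0 k0.
  rewrite subrr !mulr0 !addr0; apply => //; first by apply: radX; move: h0 k1; clear => *; lra.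
  by move=> t tt; apply: hd1; rewrite ?ger0_norm; move: tt kdel1 s0; clear => *; lra.
have e_sh : `|\int[leb2 R]_(p in half_plane R) edge_mass k (s + h) a c1 b c2 k s p
     - mass v (s + h) (a + c1 * h) (b + c2 * h)| <= C * (e1 + 4 * r * M).
  have := @edge_mass_bound (s + h) k k a c1 b c2 s e1 r X sh0 k0 k0.
  rewrite [s + h - s]addrAC subrr add0r; apply => //; first by apply: radX; move: h0 k1; clear => *; lra.
  by move=> t tt; apply: hd2; rewrite ?ger0_norm; move: tt kdel2 sh0; clear => *; lra.
have Ce1 : C * e1 <= e / 8.
  rewrite /e1 invfM mulrCA ler_pM2l// -[leRHS]mulr1 mulrCA ler_pM2l ?invr_gt0//.
  by rewrite ler_pdivrMr// mul1r lerDl.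
have kN' : 2 * (M * C * om) * k + 2 * (C * (4 * r * M)) <= e / 2.
  apply: le_trans kNe.
  have -> : k * N = 2 * (M * C * om) * k + 2 * (C * (4 * r * M)) + k by rewrite /N /r; ring.
  by rewrite lerDl ltW.
rewrite mulrDr in fa; rewrite mulrDr in fb; rewrite mulrDr in e_s; rewrite mulrDr in e_sh.
rewrite -mulrA in kN'; rewrite -mulrA.
have alg (I1 I2 I3 I4 m1 m2 q1 q2 q3 q4 : R) : `|I3| <= q1 + q2 ->
    `|I4| <= q1 + q2 -> `|I1 - m1| <= q3 + q4 -> `|I2 - m2| <= q3 + q4 ->
    q3 <= e / 8 -> 2 * q2 + 2 * q4 <= e / 2 -> I1 - I2 + (I3 - I4) = 0 ->
    `|m2 - m1| <= 2 * q1 + e.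
  by rewrite !ler_norml; move: e0; clear => *; lra.
exact: (alg _ _ _ _ _ _ _ _ _ _ fa fb e_s e_sh Ce1 kN').
Qed.

(** The datum enters through the weak equation, the slice at time 0 through continuity in time; a
    cutoff that closes on [[0, k]] compares the two as [k] tends to 0. *)
Lemma initial_mass (a b : R) : a <= b -> mass v 0 a b = \int[leb R]_(x in `[a, b]) u0 x.
Proof.
move=> ab; apply/eqP; rewrite -subr_eq0 -normr_le0; apply/ler_addgt0Pr => e e0.
rewrite add0r.
pose X := strip_radius a b 0 0 1 0 1.
pose e1 := e / (8 * (C + 1)).
have C10 : 0 < C + 1 by rewrite ltr_wpDl.
have e10 : 0 < e1 by rewrite divr_gt0// mulr_gt0.
have [del1 del10 hd1] := vcont X (lexx 0) e10.
pose N := 2 * (M * C * (1 + M)) + 4 * (C * M) + 4 * M + 1.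
have MCo : 0 <= M * C * (1 + M) by rewrite !mulr_ge0// addr_ge0.
have CM0 : 0 <= C * M by rewrite mulr_ge0.
have N0 : 0 < N by rewrite /N; have := M0; lra.
pose k := Num.min 1 (Num.min del1 (e / (2 * N))).
have k0 : 0 < k.
  by rewrite !lt_min ltr01 del10 divr_gt0// mulr_gt0.
have [k1 kdel1 kN] : [/\ k <= 1, k <= del1 & k <= e / (2 * N)].
  by split; rewrite /k !ge_min lexx ?orbT.
have kNe : k * N <= e / 2.
  by move: kN; rewrite -ler_pdivlMr// -[e / 2 / N]mulrA -invfM.
have radX : strip_radius a b 0 0 k 0 (0 + k) <= X.
  by rewrite /X /strip_radius normr0 addr0 !mul0r !addr0 lerD2l.
have k00 : `|0 : R| * k + k <= k by rewrite normr0 mul0r add0r.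
(* The cutoff opens on [-2, -1], outside the half-plane: it equals 1 at time 0 and the datum term
   survives. The edges are at rest and the cutoff lasts only a time [k], so a crude bound on the
   flux is enough. *)
have := @strip_identity (- 2) 1 0 k a 0 b 0 k 0 ltr01 k0 k0.
have -> : \int[leb2 R]_(p in half_plane R) edge_mass 1 (- 2) a 0 b 0 k 0 p = 0.
  rewrite /Rintegral integral0_eq// => p p0; congr EFin.
  rewrite /edge_mass bump_eq0 ?mul0r ?mulr0//; right.
  by apply: lt_le_trans p0; rewrite addrC subr_lt0 ltr1n.
have cut0 : cutoff (- 2) 1 0 k 0 = 1 :> R.
  rewrite /cutoff (step_div_eq0 k0) ?subrr// step_div_eq1 ?subr0//; lra.
have -> : \int[leb R]_x (u0 x * (cutoff (- 2) 1 0 k 0 * strip a 0 b 0 k 0 (0, x))) =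
  \int[leb R]_(x in `[- X, X]) (u0 x * (step ((x - a) / k) - step ((x - b) / k))).
  rewrite [RHS]Rintegral_mkcond; apply: eq_Rintegral => x _; rewrite cut0 mul1r patchE.
  have sE : strip a 0 b 0 k 0 (0, x) = step ((x - a) / k) - step ((x - b) / k).
    by rewrite /strip /ramp /= !mul0r !addr0.
  rewrite -sE; case: ifPn => // /negP xX.
  have [->|sn0] := eqVneq (strip a 0 b 0 k 0 (0, x)) 0; first by rewrite mulr0.
  exfalso; apply: xX; rewrite inE/= in_itv/=.
  have := @strip_support a 0 b 0 k 0 (0 + k) (0, x) k0 _ sn0.
  rewrite /= add0r lexx ltW// => /(_ isT).
  by move: radX; rewrite /strip_radius add0r; lra.
have hcut t : 0 <= t -> cutoff (- 2) 1 0 k t != 0 -> 0 <= t <= 0 + k.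
  move=> t0; apply: contraNT; rewrite negb_and -!ltNge => /orP hh.
  by rewrite cutoff_eq0//; right; split; lra.
have aM c : forall t x, 0 <= t <= 0 + k -> c + 0 * (t - 0) <= x <= c + 0 * (t - 0) + k ->
    `|1 - avg v eps t x - 0| <= 1 + M.
  move=> t x _ _; rewrite subr0 (le_trans (ler_normB _ _))// normr1 lerD2l.
  exact: avg_norm_le.
have M10 : 0 <= 1 + M by rewrite addr_ge0.
have fa := flux_bound k0 (lexx 0) (ltW k0) M10 hcut (aM a).
have fb := flux_bound k0 (lexx 0) (ltW k0) M10 hcut (aM b).
have e_0 : `|\int[leb2 R]_(p in half_plane R) edge_mass k 0 a 0 b 0 k 0 p
     - mass v 0 a b| <= C * (e1 + 4 * k * M).
  have := @edge_mass_bound 0 k k a 0 b 0 0 e1 k X (lexx 0) k0 k0.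
  rewrite !mul0r !addr0; apply => //.
  move=> t /andP[t0]; rewrite add0r => tk; apply: hd1 => //.
  by rewrite subr0 ger0_norm// (le_trans tk).
have [aX bX] : - X <= a /\ b <= X.
  rewrite /X /strip_radius normr0 addr0 !mul0r.
  rewrite addr0 -addrA lerNl; split.
    by rewrite (le_trans (ler_norm _))// normrN lerDl addr_ge0.
  by rewrite (le_trans (ler_norm _))// addrCA lerDl addr_ge0.
have kk c : `|c - c| + k <= k by rewrite subrr normr0 add0r.
have e_u := ramp_average mu0 mu0 u0M u0M k0 aX ab bX (kk a) (kk b).
have u00 : \int[leb R]_(x in `[- X, X]) `|u0 x - u0 x| = 0.
  by rewrite /Rintegral integral0_eq// => x _; rewrite subrr normr0.
rewrite u00 add0r in e_u.
have Ce1 : C * e1 <= e / 8.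
  rewrite /e1 invfM mulrCA ler_pM2l// -[leRHS]mulr1 mulrCA ler_pM2l ?invr_gt0//.
  by rewrite ler_pdivrMr// mul1r lerDl.
have kN' : 2 * (M * C * (1 + M) * k) + C * (4 * k * M) + 4 * k * M <= e / 2.
  apply: le_trans kNe.
  have -> : k * N = 2 * (M * C * (1 + M) * k) + C * (4 * k * M) + 4 * k * M + k.
    by rewrite /N; ring.
  by rewrite lerDl ltW.
rewrite mulrDr in e_0; have alg (I2 I3 I4 I5 m1 m2 q1 q3 q4 q5 : R) : `|I3| <= q1 ->
    `|I4| <= q1 -> `|I2 - m1| <= q3 + q4 -> `|I5 - m2| <= q5 ->
    q3 <= e / 8 -> 2 * q1 + q4 + q5 <= e / 2 -> 0 - I2 + (I3 - I4) + I5 = 0 ->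
    `|m1 - m2| <= e.
  by rewrite !ler_norml; move: e0; clear => *; lra.
exact: (alg _ _ _ _ _ _ _ _ _ _ fa fb e_0 e_u Ce1 kN').
Qed.

End StripIdentity.

(** * Backward Euler polygons in place of characteristics *)

Section EulerPolygons.
Context {R : realType} (m : R -> R -> R -> R) (V : R -> R -> R) (Z : R -> R).
Context (L D K : R) (D0 : 0 <= D).
Context (VK : forall t x, 0 <= t -> `|V t x| <= K).
Context (Vlip : forall t x y, 0 <= t -> `|V t x - V t y| <= L * `|x - y|).
Context (step_err : forall s h a b, 0 <= s -> 0 <= h -> a <= b ->
  a - h * V (s + h) a <= b - h * V (s + h) b ->
  `|m (s + h) a b - m s (a - h * V (s + h) a) (b - h * V (s + h) b)| <= D * h ^+ 2).
Context (m0 : forall a b, a <= b -> m 0 a b = Z b - Z a).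

(** Runs backwards from time [T]; each step uses the speed at its later time, which is the form of
    [step_err]. *)
Fixpoint euler (T h : R) (j : nat) (x : R) : R :=
  if j is j'.+1 then
    let y := euler T h j' x in y - h * V (T - j'%:R * h) y
  else x.

Section Polygon.
Context (T h : R) (N : nat) (h0 : 0 <= h) (hN : N%:R * h <= T) (hL : h * L <= 1).

Let T_ge j : (j <= N)%N -> j%:R * h <= T.
Proof. by move=> jN; apply: le_trans hN; rewrite ler_wpM2r// ler_nat. Qed.

(** The condition [h * L <= 1] makes one step nondecreasing in its starting point, so the two
    polygons never cross; [step_err] is available only for ordered edges. *)
Lemma euler_mono j a b : (j <= N)%N -> a <= b -> euler T h j a <= euler T h j b.
Proof.
move=> + ab; elim: j => //= j IH jN; have {}IH := IH (ltnW jN).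
set x := euler _ _ _ a in IH *; set y := euler _ _ _ b in IH *.
have t0 : 0 <= T - j%:R * h by rewrite subr_ge0; apply/T_ge/ltnW.
have /ler_normlW := Vlip y x t0; rewrite ger0_norm ?subr_ge0// => VL.
have := ler_wpM2l h0 VL; rewrite mulrBr mulrA => h1.
have : h * L * (y - x) <= y - x by rewrite ler_piMl// subr_ge0.
by move: h1; move: (h * V _ _) (h * V _ _) (h * L * _) => *; lra.
Qed.

Lemma euler_error j a b : (j <= N)%N -> a <= b ->
  `|m T a b - m (T - j%:R * h) (euler T h j a) (euler T h j b)| <= j%:R * (D * h ^+ 2).
Proof.
move=> + ab; elim: j => [_|j IH jN].
  by rewrite !mul0r subr0 subrr normr0.
have {}IH := IH (ltnW jN).
have t0 : 0 <= T - j.+1%:R * h by rewrite subr_ge0; apply/T_ge.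
have tE : T - j%:R * h = T - j.+1%:R * h + h by rewrite -natr1; ring.
have ab1 := euler_mono (ltnW jN) ab; have := euler_mono jN ab.
rewrite /= in ab1 *; rewrite tE => ab2.
have := step_err t0 h0 ab1 ab2; rewrite -tE => h2.
have -> : j.+1%:R * (D * h ^+ 2) = j%:R * (D * h ^+ 2) + D * h ^+ 2.
  by rewrite -natr1 mulrDl mul1r.
exact: le_trans (ler_distD _ _ _) (lerD IH h2).
Qed.

Lemma euler_dist j x : (j <= N)%N -> `|euler T h j x - x| <= j%:R * h * K.
Proof.
elim: j => [_|j IH jN] /=; first by rewrite subrr normr0 !mul0r.
have {}IH := IH (ltnW jN).
have t0 : 0 <= T - j%:R * h by rewrite subr_ge0; apply/T_ge/ltnW.
rewrite addrAC (le_trans (ler_normB _ _))// -natr1 mulrDl mul1r mulrDl lerD//.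
by rewrite normrM ger0_norm// ler_wpM2l// VK.
Qed.

Let K0 : 0 <= K.
Proof. by apply: le_trans (VK 0 (lexx 0)); rewrite normr_ge0. Qed.

Lemma euler_ge x v j : (j <= N)%N ->
  (forall t y, 0 <= t <= T -> `|y - x| <= K * T -> V t y <= v) ->
  x - j%:R * h * v <= euler T h j x.
Proof.
move=> + Vv; elim: j => [_|j IH jN] /=; first by rewrite !mul0r subr0.
have {}IH := IH (ltnW jN).
have t0 : 0 <= T - j%:R * h by rewrite subr_ge0; apply/T_ge/ltnW.
have tT : 0 <= T - j%:R * h <= T by rewrite t0 gerBl mulr_ge0.
have eK : `|euler T h j x - x| <= K * T.
  rewrite (le_trans (euler_dist _ (ltnW jN)))// mulrC ler_wpM2l//.
  exact/T_ge/ltnW.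
have := ler_wpM2l h0 (Vv _ _ tT eK).
by move: IH; rewrite -natr1; move: (h * V _ _) => q; lra.
Qed.

Lemma euler_le x v j : (j <= N)%N ->
  (forall t y, 0 <= t <= T -> `|y - x| <= K * T -> v <= V t y) ->
  euler T h j x <= x - j%:R * h * v.
Proof.
move=> + Vv; elim: j => [_|j IH jN] /=; first by rewrite !mul0r subr0.
have {}IH := IH (ltnW jN).
have t0 : 0 <= T - j%:R * h by rewrite subr_ge0; apply/T_ge/ltnW.
have tT : 0 <= T - j%:R * h <= T by rewrite t0 gerBl mulr_ge0.
have eK : `|euler T h j x - x| <= K * T.
  rewrite (le_trans (euler_dist _ (ltnW jN)))// mulrC ler_wpM2l//.
  exact/T_ge/ltnW.
have := ler_wpM2l h0 (Vv _ _ tT eK).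
by move: IH; rewrite -natr1; move: (h * V _ _) => q; lra.
Qed.

End Polygon.

(** The end points [a0] and [b0] of two polygons stand for the feet of two backward trajectories;
    bounds on the speed near the starting points bound the total displacements. *)
Lemma backward_paths T a b eta : 0 <= T -> a <= b -> 0 < eta ->
  exists a0 b0, [/\ a0 <= b0, `|m T a b - (Z b0 - Z a0)| <= eta,
   (forall v, (forall t y, 0 <= t <= T -> `|y - a| <= K * T -> V t y <= v) ->
     a - T * v <= a0),
   (forall v, (forall t y, 0 <= t <= T -> `|y - a| <= K * T -> v <= V t y) ->
     a0 <= a - T * v) &
   (forall v, (forall t y, 0 <= t <= T -> `|y - b| <= K * T -> V t y <= v) ->
     b - T * v <= b0) /\
   (forall v, (forall t y, 0 <= t <= T -> `|y - b| <= K * T -> v <= V t y) ->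
     b0 <= b - T * v)].
Proof.
move=> T0 ab eta0.
(* With N > [B], the step [T / N] satisfies [h * L <= 1], and the N local errors [D * h ^+ 2] add up
   to D T^2 / N, which is at most [eta]. *)
pose B := `|T * L| + D * T ^+ 2 / eta.
have B0 : 0 <= B by rewrite addr_ge0// divr_ge0 ?mulr_ge0 ?sqr_ge0// ltW.
pose N := (Num.truncn B).+1.
have NB : B < N%:R by apply: truncnS_gt.
have N0 : (0 : R) < N%:R by rewrite ltr0n.
pose h := T / N%:R.
have h0 : 0 <= h by rewrite divr_ge0// ltW.
have NhT : N%:R * h = T by rewrite mulrC divfK// gt_eqF.
have hN : N%:R * h <= T by rewrite NhT.
have hL : h * L <= 1.
  rewrite /h mulrAC ler_pdivrMr// mul1r (le_trans (ler_norm _))// ltW//.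
  by apply: le_lt_trans NB; rewrite lerDl divr_ge0 ?mulr_ge0 ?sqr_ge0// ltW.
exists (euler T h N a), (euler T h N b); split.
- exact: (euler_mono h0 hN hL).
- have mono := euler_mono h0 hN hL (leqnn N) ab.
  have := euler_error h0 hN hL (leqnn N) ab; rewrite NhT subrr m0// => err.
  apply: le_trans err _.
  have -> : N%:R * (D * h ^+ 2) = D * T ^+ 2 / N%:R.
    by rewrite /h; field; rewrite gt_eqF.
  rewrite ler_pdivrMr// -ler_pdivrMl// [X in X <= _]mulrC ltW//; apply: le_lt_trans NB.
  by rewrite lerDr.
- by move=> v Hv; have := euler_ge h0 hN (leqnn N) Hv; rewrite NhT.
- by move=> v Hv; have := euler_le h0 hN (leqnn N) Hv; rewrite NhT.
- by split=> v Hv; [have := euler_ge h0 hN (leqnn N) Hv|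
    have := euler_le h0 hN (leqnn N) Hv]; rewrite NhT.
Qed.

Context (Znd : {homo Z : x y / x <= y}).

(** Wherever the feet are, the increase of the monotone [Z] between them lies in [0, mu]. The bound
    does not involve the constants with which the polygons were controlled. *)
Lemma mass_bounds mu T a b : 0 <= T -> a <= b -> (forall x y, Z y - Z x <= mu) ->
  0 <= m T a b <= mu.
Proof.
move=> T0 ab Zmu; apply/andP; split; apply/ler_addgt0Pr => e e0;
  have [a0 [b0 [ab0 err _ _ _]]] := backward_paths T0 ab e0.
  by move: err (Znd ab0); rewrite ler_norml; lra.
by move: err (Zmu a0 b0); rewrite ler_norml; lra.
Qed.

(** An upper bound on the speed at the left end and a lower bound at the right end confine the feet
    to a smaller interval, and [Z] is monotone. *)
Lemma mass_le T a b v w : 0 <= T -> a <= b ->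
  (forall t y, 0 <= t <= T -> `|y - a| <= K * T -> V t y <= v) ->
  (forall t y, 0 <= t <= T -> `|y - b| <= K * T -> w <= V t y) ->
  m T a b <= Z (b - T * w) - Z (a - T * v).
Proof.
move=> T0 ab Hv Hw; apply/ler_addgt0Pr => e e0.
have [a0 [b0 [ab0 err h1 _ [_ h2]]]] := backward_paths T0 ab e0.
have := Znd (h1 _ Hv); have := Znd (h2 _ Hw).
by move: err; rewrite ler_norml; lra.
Qed.

Lemma mass_ge T a b v w : 0 <= T -> a <= b ->
  (forall t y, 0 <= t <= T -> `|y - a| <= K * T -> v <= V t y) ->
  (forall t y, 0 <= t <= T -> `|y - b| <= K * T -> V t y <= w) ->
  Z (b - T * w) - Z (a - T * v) <= m T a b.
Proof.
move=> T0 ab Hv Hw; apply/ler_addgt0Pr => e e0.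
have [a0 [b0 [ab0 err _ h1 [h2 _]]]] := backward_paths T0 ab e0.
have := Znd (h1 _ Hv); have := Znd (h2 _ Hw).
by move: err; rewrite ler_norml; lra.
Qed.

End EulerPolygons.

(* What is used of the solution: [Z] is a primitive of the initial datum and [w]
   the nonlocal average; a window of length [eps] carries the mass of the
   interval obtained by moving its endpoints backwards along the flow. *)
Record transported {R : realType} (eps K : R) (Z : R -> R) (w : R -> R -> R) : Prop :=
  Transported {
    transported0 : forall x, eps * w 0 x = Z (x + eps) - Z x ;
    transported_le : forall T x v v', 0 <= T ->
      (forall t y, 0 <= t <= T -> `|y - x| <= K * T -> 1 - w t y <= v) ->
      (forall t y, 0 <= t <= T -> `|y - (x + eps)| <= K * T -> v' <= 1 - w t y) ->
      eps * w T x <= Z (x + eps - T * v') - Z (x - T * v) ;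
    transported_ge : forall T x v v', 0 <= T ->
      (forall t y, 0 <= t <= T -> `|y - x| <= K * T -> v <= 1 - w t y) ->
      (forall t y, 0 <= t <= T -> `|y - (x + eps)| <= K * T -> 1 - w t y <= v') ->
      Z (x + eps - T * v') - Z (x - T * v) <= eps * w T x ;
    transported_speed : forall t y, 0 <= t -> `|1 - w t y| <= K }.

(** * Bounded solutions transport the mass of their datum *)

Section Transported.
Context {R : realType} (v : R * R -> R) (u0 Z : R -> R) (M eps mu : R).
Context (mv : measurable_fun setT v) (vM : forall p, `|v p| <= M).
Context (eps0 : 0 < eps).
Context (weak : forall phi : R * R -> R, test_function phi ->
  (forall i : bool, measurable_fun setT ('D_(dir R i) phi : R * R -> R)) ->
  \int[leb2 R]_(p in half_plane R)
     (v p * ('D_(dir R true) phi p + (1 - avg v eps p.1 p.2) * 'D_(dir R false) phi p))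
  + \int[leb R]_x (u0 x * phi (0, x)) = 0).
Context (mu0 : measurable_fun setT u0) (u0M : forall x, `|u0 x| <= M).
Context (vcont : forall X t, 0 <= t -> forall e : R, 0 < e ->
  exists2 del : R, 0 < del & forall s, 0 <= s -> `|s - t| <= del ->
    \int[leb R]_(x in `[- X, X]) `|v (s, x) - v (t, x)| <= e).
Context (Znd : {homo Z : x y / x <= y}) (Zmu : forall x y, Z y - Z x <= mu).
Context (u0Z : forall a b, a <= b -> \int[leb R]_(x in `[a, b]) u0 x = Z b - Z a).

Let M0 : 0 <= M. Proof. exact: le_trans (normr_ge0 _) (vM (0, 0)). Qed.

Lemma mass_split t a b c : a <= b -> b <= c ->
  mass v t a c = mass v t a b + mass v t b c.
Proof.
by move=> ab bc; apply: (@Rintegral_itv_split _ _ M) => //; exact: measurable_slice.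
Qed.

Lemma avg_lipschitz_space t x y : `|avg v eps t x - avg v eps t y| <= 2 * M / eps * `|x - y|.
Proof.
wlog xy : x y / x <= y => [h|].
  by have [/h//|/ltW/h] := leP x y; rewrite distrC [in leRHS]distrC.
have xe : x <= x + eps by rewrite lerDl ltW.
have ye : y <= y + eps by rewrite lerDl ltW.
have xye : x + eps <= y + eps by rewrite lerD2r.
have e1 := mass_split t xe xye; have e2 := mass_split t xy ye.
have b1 := mass_norm_le mv vM t xy; have b2 := mass_norm_le mv vM t xye.
rewrite /avg -mulrBr normrM normfV (gtr0_norm eps0) ler_pdivrMl//.
have -> : eps * (2 * M / eps * `|x - y|) = M * (y - x) + M * (y + eps - (x + eps)).
  by rewrite distrC ger0_norm ?subr_ge0//; field; rewrite gt_eqF.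
rewrite (_ : _ - _ = mass v t x y - mass v t (x + eps) (y + eps)).
  exact: le_trans (ler_normB _ _) (lerD b1 b2).
by move: e1 e2; move: (mass _ _ _ _) (mass _ _ _ _) => *; lra.
Qed.

(** In time this is [transport_step] with edges at rest, relative to which the flow has speed at
    most 1 + M. Averaging thus makes the speed Lipschitz although [v] is merely bounded. *)
Lemma avg_lipschitz : exists2 L, 0 <= L & forall s t x y, 0 <= s -> 0 <= t ->
  `|avg v eps s x - avg v eps t y| <= L * (`|s - t| + `|x - y|).
Proof.
have [C C0 dC] := @dstep_bounded R.
pose A := eps^-1 * (2 * (M * C * (1 + M))).
have MC0 : 0 <= M * C * (1 + M) by rewrite !mulr_ge0// addr_ge0.
have eV0 : 0 <= eps^-1 by rewrite invr_ge0 ltW.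
have A0 : 0 <= A by exact: (mulr_ge0 eV0 (mulr_ge0 (ler0n R 2) MC0)).
have time s h x : 0 <= s -> 0 <= h -> `|avg v eps (s + h) x - avg v eps s x| <= A * h.
  move=> s0 h0; rewrite /avg -mulrBr normrM normfV (gtr0_norm eps0) /A -mulrA.
  rewrite ler_pM2l ?invr_gt0//.
  have xe : x <= x + eps by rewrite lerDl ltW.
  have om t y : `|1 - avg v eps t y - 0| <= 1 + M.
    rewrite subr0 (le_trans (ler_normB _ _))// normr1 lerD2l.
    exact: (avg_norm_le mv vM eps0).
  have := @transport_step _ _ _ _ _ _ mv vM eps0 C0 dC weak vcont s h x (x + eps) 0 0 1 (1 + M).
  by rewrite !mul0r !addr0; apply => //; rewrite addr_ge0.
exists (A + 2 * M / eps).
  by rewrite addr_ge0// divr_ge0 ?mulr_ge0// ltW.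
move=> s t x y s0 t0; rewrite (le_trans (ler_distD (avg v eps t x) _ _))//.
have h2 := avg_lipschitz_space t x y.
have h1 : `|avg v eps s x - avg v eps t x| <= A * `|s - t|.
  wlog ts : s t s0 t0 {h2} / t <= s => [h|].
    have [/(h _ _ s0 t0)//|/ltW/(h _ _ t0 s0)] := leP t s.
    by rewrite distrC [in leRHS]distrC.
  have := @time t (s - t) x t0; rewrite subr_ge0 subrKC [`|s - t|]ger0_norm ?subr_ge0//; exact.
rewrite mulrDl !mulrDr; apply: le_trans (lerD h1 h2) _.
have b0 : 0 <= 2 * M / eps by rewrite divr_ge0 ?mulr_ge0// ltW.
have := mulr_ge0 A0 (normr_ge0 (x - y)); have := mulr_ge0 b0 (normr_ge0 (s - t)).
move: (A * _) (A * _) (2 * M / eps * _) (2 * M / eps * _) => *; lra.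
Qed.

(** Along a straight edge the speed changes by O(h) during a step h, because the average is
    Lipschitz; [transport_step] with [om] equal to [kap * h] then gives O(h^2). *)
Lemma euler_step_error : exists2 D, 0 <= D & forall s h a b, 0 <= s -> 0 <= h -> a <= b ->
  a - h * (1 - avg v eps (s + h) a) <= b - h * (1 - avg v eps (s + h) b) ->
  `|mass v (s + h) a b - mass v s (a - h * (1 - avg v eps (s + h) a))
      (b - h * (1 - avg v eps (s + h) b))| <= D * h ^+ 2.
Proof.
have [C C0 dC] := @dstep_bounded R; have [L L0 lip] := avg_lipschitz.
pose kap := L * (5 + 2 * M).
have kap0 : 0 <= kap by rewrite mulr_ge0// addr_ge0// mulr_ge0.
exists (2 * (M * C * kap)) => [|s h a b s0]; first exact: (mulr_ge0 (ler0n R 2) (mulr_ge0 (mulr_ge0 M0 C0) kap0)).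
rewrite le_eqVlt => /predU1P[<- _ _|h0 ab].
  by rewrite !mul0r !subr0 addr0 subrr normr0 expr0n mulr0.
set c1 := 1 - avg _ _ _ a; set c2 := 1 - avg _ _ _ b => ab'.
have cM x : `|1 - avg v eps (s + h) x| <= 1 + M.
  rewrite (le_trans (ler_normB _ _))// normr1 lerD2l.
  exact: (avg_norm_le mv vM eps0).
have near x : forall t y, s <= t <= s + h + h ->
    x - h * (1 - avg v eps (s + h) x) + (1 - avg v eps (s + h) x) * (t - s) <= y
     <= x - h * (1 - avg v eps (s + h) x) + (1 - avg v eps (s + h) x) * (t - s) + h ->
    `|1 - avg v eps t y - (1 - avg v eps (s + h) x)| <= kap * h.
  move=> t y tsh; have := cM x; set c := 1 - avg v eps (s + h) x => cle yx.
  rewrite (_ : _ - _ = avg v eps (s + h) x - avg v eps t y); last by rewrite /c; ring.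
  have t0 : 0 <= t by lra.
  have sh0 : 0 <= s + h by lra.
  apply: le_trans (lip _ _ _ _ sh0 t0) _; rewrite /kap -mulrA ler_wpM2l//.
  have tt : `|s + h - t| <= h by rewrite ler_norml; lra.
  have ct : `|c * (s + h - t)| <= (1 + M) * h by rewrite normrM ler_pM.
  have xy : `|x - y| <= (1 + M) * h + h.
    move: ct yx; have -> : x - h * c + c * (t - s) = x - c * (s + h - t) by ring.
    by rewrite !ler_norml; move: (c * _) ((1 + M) * h) => *; lra.
  apply: le_trans (lerD tt xy) _; rewrite -subr_ge0.
  have -> : (5 + 2 * M) * h - (h + ((1 + M) * h + h)) = (2 + M) * h by ring.
  by rewrite mulr_ge0 ?addr_ge0// ltW.
have kh0 : 0 <= kap * h by rewrite mulr_ge0// ltW.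
have ee x c : x - h * c + c * h = x by ring.
have := @transport_step _ _ _ _ _ _ mv vM eps0 C0 dC weak vcont s h
  (a - h * c1) (b - h * c2) c1 c2 h (kap * h) s0 (ltW h0) h0 kh0 ab'.
rewrite !ee => /(_ ab (near a) (near b)) h1; apply: le_trans h1 _.
by rewrite le_eqVlt; apply/orP; left; apply/eqP; ring.
Qed.

Lemma solution_transported : transported eps (1 + mu / eps) Z (avg v eps).
Proof.
have [C C0 dC] := @dstep_bounded R; have [L L0 lip] := avg_lipschitz.
have [D D0 serr] := euler_step_error.
have m0 a b : a <= b -> mass v 0 a b = Z b - Z a.
  by move=> ab; rewrite (initial_mass mv vM eps0 C0 dC weak mu0 u0M vcont ab) u0Z.
have VM t x : 0 <= t -> `|1 - avg v eps t x| <= 1 + M.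
  move=> _; rewrite (le_trans (ler_normB _ _))// normr1 lerD2l.
  exact: (avg_norm_le mv vM eps0).
have Vlip t x y : 0 <= t -> `|1 - avg v eps t x - (1 - avg v eps t y)| <= L * `|x - y|.
  move=> t0; rewrite (_ : _ - _ = avg v eps t y - avg v eps t x); last by ring.
  by have := lip t t y x t0 t0; rewrite subrr normr0 add0r [in leRHS]distrC.
have bnd t x : 0 <= t -> 0 <= mass v t x (x + eps) <= mu.
  move=> t0; apply: (mass_bounds D0 VM Vlip serr m0 Znd t0) => //.
  by rewrite lerDl ltW.
(* A first pass with the speed bound 1 + M gave [bnd]. The resulting second bound depends on the
   datum and on [eps] only, so that a time chosen from it serves all solutions. *)
have VK t x : 0 <= t -> `|1 - avg v eps t x| <= 1 + mu / eps.
  move=> /(bnd _ x)/andP[h1 h2]; rewrite (le_trans (ler_normB _ _))// normr1 lerD2l.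
  rewrite /avg normrM normfV (gtr0_norm eps0) (ger0_norm h1) mulrC.
  by rewrite ler_wpM2r// invr_ge0 ltW.
have eavg t x : eps * avg v eps t x = mass v t x (x + eps).
  by rewrite /avg mulVKf// gt_eqF.
have xe x : x <= x + eps by rewrite lerDl ltW.
split => //.
- by move=> x; rewrite eavg m0.
- by move=> T x a b T0; rewrite eavg; apply: (mass_le D0 VK Vlip serr m0 Znd T0 (xe x)).
- by move=> T x a b T0; rewrite eavg; apply: (mass_ge D0 VK Vlip serr m0 Znd T0 (xe x)).
Qed.

End Transported.

(** * Reduction to a bounded measurable representative *)

Section Representative.
Context {R : realType} (u : R * R -> R) (u0 : R -> R) (eps : R).
Context (eps0 : 0 < eps) (mu0 : measurable_fun setT u0).
Context (u01 : forall x, 0 <= u0 x <= 1).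

Let k : R -> R := rescale (\1_(`]-1, 0[%classic)) eps.

(** Truncation turns the essential bound into a pointwise one; being 1-Lipschitz, it keeps the
    modulus of continuity in time with values in L^1. *)
Definition clamp (M x : R) : R := Num.max (- M) (Num.min M x).

Lemma clamp_norm_le M x : 0 <= M -> `|clamp M x| <= M.
Proof. by move=> M0; rewrite /clamp ler_norml le_max lexx/= ge_max ge_min lexx; lra. Qed.

Lemma clamp_id M x : `|x| <= M -> clamp M x = x.
Proof.
rewrite ler_norml => /andP[h1 h2]; rewrite /clamp.
by rewrite (min_idPr h2) (max_idPr h1).
Qed.

Lemma clamp_lipschitz M x y : `|clamp M x - clamp M y| <= `|x - y|.
Proof.
rewrite /clamp /Num.max /Num.min.
case: (ltP M x) => h1; case: (ltP M y) => h2; repeat case: ifPn; rewrite -?leNgt => *;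
  rewrite ler_norml; have := ler_norm (x - y); have := ler_norm (- (x - y)); rewrite normrN; lra.
Qed.

Lemma ae_slices (N : set (R * R)) : measurable N -> leb2 R N = 0%E ->
  {ae leb R, forall t, leb R (xsection N t) = 0%E}.
Proof.
move=> mN N0.
have mx : measurable_fun setT (fun t => leb R (xsection N t)).
  exact: measurable_fun_xsection.
have [+ _] := ae_eq_integral_abs (leb R) measurableT mx.
have -> : (\int[leb R]_t `|leb R (xsection N t)| = 0)%E.
  by rewrite -[RHS]N0; apply: eq_integral => t _; rewrite gee0_abs.
by move=> /(_ erefl); apply: filterS => t; apply.
Qed.

Lemma ae_meets_itv (P : R -> Prop) (t d : R) : 0 < d -> {ae leb R, forall s, P s} ->
  exists2 s, t <= s <= t + d & P s.
Proof.
move=> d0 [N [mN N0 NP]]; apply: contrapT => h.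
have : (leb R `[t, (t + d)%R]%classic <= leb R N)%E.
  apply: le_measure; rewrite ?inE// => s /= /[!in_itv]/= ts.
  by apply: NP => Ps; apply: h; exists s.
rewrite N0 lebesgue_measure_itv/= lte_fin ltrDl d0 -EFinB lee_fin; lra.
Qed.

Lemma essentially_bounded (f : R * R -> R) : f \in Lfun (leb2 R) +oo%E ->
  measurable_fun setT f /\ exists M, {ae leb2 R, forall p, `|f p| <= M}.
Proof.
rewrite inE => /andP[/set_mem mf /set_mem hf]; split=> //.
move: hf; rewrite /= /finite_norm unlock; case: ifPn => [_ hf|/negP leb0 _].
  exact: (@ess_sup_inf.ess_supr_bounded _ _ _ (leb2 R) (fun p => `|f p|)).
(* The L^oo norm is defined by cases on whether the whole plane has positive measure; in the other
   case the whole plane serves as exceptional set. *)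
exists 0; exists setT; split => //.
by apply/eqP; rewrite eq_le measure_ge0 andbT leNgt; apply/negP.
Qed.

Context (sol : nonlocal_solution (fun w => 1 - w) k u0 u).

Let contu : C0_L1loc u. Proof. by case: sol. Qed.

Let mut t : 0 <= t -> measurable_fun setT (fun x => u (t, x)).
Proof. by move=> t0; case: (contu.1 t t0). Qed.

Lemma solution_representative : exists M, 1 <= M /\ exists v : R * R -> R,
  [/\ measurable_fun setT v, forall p, `|v p| <= M,
    {ae leb2 R, forall p, half_plane R p -> u p = v p} &
    forall p, half_plane R p -> v p = clamp M (u p)].
Proof.
have [+ _ _] := sol => /essentially_bounded[mf [M0 fM0]].
(* At least 1, so that [M] also bounds the datum. *)
pose M := Num.max 1 M0.
exists M; split; first by rewrite le_max lexx.
have M00 : 0 <= M by rewrite le_max ler01.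
exists (fun p => clamp M ((u \* \1_(half_plane R)) p)).
have hE p : half_plane R p -> (u \* \1_(half_plane R)) p = u p.
  by move=> hp /=; rewrite indicE mem_set// mulr1.
split.
- by apply: measurable_maxr => //; apply: measurable_minr.
- by move=> p; exact: clamp_norm_le.
- have [N [mN N0 NP]] := fM0; exists N; split => //.
  apply: subset_trans NP => p /=; apply: contra_not => pM hp.
  have uE : u p * \1_(half_plane R) p = u p by exact: hE.
  rewrite uE in pM *; rewrite clamp_id//.
  by rewrite (le_trans pM)// /M le_max lexx orbT.
- by move=> p hp; congr clamp; exact: hE.
Qed.

Lemma L1_modulus a b t (e : R) : 0 <= t -> 0 < e ->
  exists2 del : R, 0 < del & forall s, 0 <= s -> `|s - t| <= del ->
    (\int[leb R]_(x in `[a, b]) `|u (s, x) - u (t, x)|%:E < e%:E)%E.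
Proof.
move=> t0 e0; have := contu.2 `[a, b]%classic t (@segment_compact _ _ _) t0.
move=> /(_ [set y | (y < e%:E)%E]) /=.
have h0 : nbhs (0%:E : \bar R) [set y | (y < e%:E)%E].
  by apply: open_nbhs_nbhs; split; [exact: open_ereal_lt_ereal|rewrite /= lte_fin].
move=> /(_ h0); rewrite /nbhs/= /within/= => /nbhs_ballP[r r0 hr].
exists (r / 2); first exact: divr_gt0.
move=> s s0 st; apply: hr => //; rewrite /ball_ /= distrC.
by rewrite (le_lt_trans st)// ltr_pdivrMr// ltr_pMr// ltr1n.
Qed.

(** Equality almost everywhere in the plane gives nothing on a single slice. It holds on almost
    every slice, hence on slices arbitrarily close to [t], and the L^1 continuity of [u] and of its
    truncation carries it to [t]. *)
Lemma representative_slices (M : R) (v : R * R -> R) (t a b : R) : 0 <= M -> 0 <= t ->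
  measurable_fun setT v -> 
  {ae leb2 R, forall p, half_plane R p -> u p = v p} ->
  (forall p, half_plane R p -> v p = clamp M (u p)) ->
  ae_eq (leb R) `[a, b]%classic (fun x => (u (t, x))%:E) (fun x => (v (t, x))%:E).
Proof.
move=> M0 t0 mv [N [mN N0 Nuv]] vE.
have hp s x : 0 <= s -> half_plane R (s, x) by [].
have good := ae_slices mN N0.
have mD : measurable_fun `[a, b]%classic (fun x => (u (t, x) - v (t, x))%:E).
  apply/measurable_EFinP; apply: measurable_funTS; apply: measurable_funB.
    exact: mut.
  exact: measurable_slice.
have [+ _] := ae_eq_integral_abs (leb R) (measurable_itv `[a, b]) mD.
suff -> : (\int[leb R]_(x in `[a, b]) `|(u (t, x) - v (t, x))%:E| = 0)%E.
  move=> /(_ erefl); apply: filterS => x /[apply] /= /eqP.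
  by rewrite eqe subr_eq0 => /eqP ->.
apply/eqP; rewrite eq_le integral_ge0 ?andbT//.
apply/lee_addgt0Pr => e e0; rewrite add0e.
have e40 : 0 < e / 4 by rewrite divr_gt0.
have [del del0 hdel] := L1_modulus a b t0 e40.
have [s /andP[ts std] Ns] := ae_meets_itv t del0 good.
have s0 : 0 <= s := le_trans t0 ts.
have mus : measurable_fun `[a, b]%classic (fun x => `|u (s, x) - u (t, x)|%:E).
  apply/measurable_EFinP; apply: measurable_funTS; apply: measurableT_comp => //.
  by apply: measurable_funB; exact: mut.
have mvs : measurable_fun `[a, b]%classic (fun x => `|u (s, x) - v (s, x)|%:E).
  apply/measurable_EFinP; apply: measurable_funTS; apply: measurableT_comp => //.
  by apply: measurable_funB; [exact: mut|exact: measurable_slice].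
have uvs0 : (\int[leb R]_(x in `[a, b]) `|u (s, x) - v (s, x)|%:E = 0)%E.
  have mds : measurable_fun `[a, b]%classic (fun x => (u (s, x) - v (s, x))%:E).
    apply/measurable_EFinP; apply: measurable_funTS; apply: measurable_funB.
      exact: mut.
    exact: measurable_slice.
  have [_] := ae_eq_integral_abs (leb R) (measurable_itv `[a, b]) mds.
  apply; exists (xsection N s); split => //; first exact: measurable_xsection.
  move=> x /=; rewrite not_implyE => -[_ uv]; rewrite /xsection/= inE.
  by apply: Nuv => /= /(_ (hp s x s0)) uvE; apply: uv; rewrite uvE subrr.
have st : `|s - t| <= del by rewrite ger0_norm ?subr_ge0// lerBlDl.
have hs := ltW (hdel s s0 st).
(* Triangle inequality through the slice [s]: the change of [v] between the slices is at most that
   of [u], which is therefore counted twice. *)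
apply: (@le_trans _ _ (\int[leb R]_(x in `[a, b])
   (2%:E * `|u (s, x) - u (t, x)|%:E + `|u (s, x) - v (s, x)|%:E))%E).
  apply: ge0_le_integral => //.
  - exact/measurableT_comp.
  - by apply: emeasurable_funD => //; exact: measurable_funeM.
  - move=> x _; rewrite -EFinM -EFinD lee_fin.
    have := clamp_lipschitz M (u (s, x)) (u (t, x)); rewrite -!vE; [|exact: hp..].
    have := ler_distD (v (s, x)) (u (t, x)) (v (t, x)).
    have := ler_distD (u (s, x)) (u (t, x)) (v (s, x)).
    rewrite [`|u (t, x) - u (s, x)|]distrC.
    move: `|u (t, x) - v (s, x)| `|u (s, x) - u (t, x)| `|v (s, x) - v (t, x)|.
    move: `|u (t, x) - v (t, x)| `|u (s, x) - v (s, x)| => *; lra.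
rewrite ge0_integralD//; last by apply: measurable_funeM.
rewrite uvs0 adde0 ge0_integralZl//.
have two0 : (0 <= 2%:E :> \bar R)%E by rewrite lee_fin.
have h2 := lee_wpmul2l two0 hs.
by apply: le_trans h2 _; rewrite -EFinM lee_fin; lra.
Qed.

Lemma nonlocal_avg_representative (M : R) (v : R * R -> R) (t x : R) : 0 <= t ->
  measurable_fun setT v -> (forall p, `|v p| <= M) ->
  {ae leb2 R, forall p, half_plane R p -> u p = v p} ->
  (forall p, half_plane R p -> v p = clamp M (u p)) ->
  nonlocal_avg u k t x = avg v eps t x.
Proof.
move=> t0 mv vM uv vE.
have M0 : 0 <= M := le_trans (normr_ge0 _) (vM (0, 0)).
rewrite /nonlocal_avg /convolution /avg /mass.
transitivity (\int[leb R]_(y in `]x, x + eps[) (eps^-1 * u (t, y))).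
  rewrite [RHS]Rintegral_mkcond; apply: eq_Rintegral => y _.
  rewrite patchE /k /rescale indicE !mem_setE !in_itv/=.
  have -> : (-1 < (x - y) / eps < 0) = (x < y < x + eps).
    rewrite ltr_pdivlMr// ltr_pdivrMr// mul0r mulN1r.
    by apply/andP/andP => -[]; split; lra.
  by case: ifPn => _; rewrite /= ?mulr1 ?mulr0// mulrC.
have vi : (leb R).-integrable `[x, x + eps] (EFin \o (fun y => v (t, y))).
  by apply: (@bounded_integrable_itv _ _ M) => //; exact: measurable_slice.
transitivity (\int[leb R]_(y in `]x, x + eps[) (eps^-1 * v (t, y))).
  rewrite /Rintegral; congr fine; apply: ae_eq_integral => //.
  - by apply/measurable_EFinP; apply: measurable_funTS; apply: measurable_funM => //; exact: mut.
  - by apply/measurable_EFinP; apply: measurable_funTS; apply: measurable_funM => //; exact: measurable_slice.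
  - have := representative_slices x (x + eps) M0 t0 mv uv vE.
    apply: filterS => y + yx; rewrite /= !in_itv/= in yx *.
    by case/andP: yx => y1 y2; rewrite !ltW// => /(_ isT) [->].
rewrite RintegralZl//.
  congr (_ * _).
  rewrite Rintegral_itv_bndo_bndc; last first.
    by apply: integrableS vi => //; exact: subset_itv_oo_cc.
  apply: Rintegral_itv_obnd_cbnd.
  by apply: integrableS vi => //; exact: subset_itv_oc_cc.
by apply: integrableS vi => //; exact: subset_itv_oo_cc.
Qed.

Lemma solution_flow (Z : R -> R) (mu : R) :
  {homo Z : x y / x <= y} -> (forall x y, Z y - Z x <= mu) ->
  (forall a b, a <= b -> \int[leb R]_(x in `[a, b]) u0 x = Z b - Z a) ->
  exists2 w, transported eps (1 + mu / eps) Z w &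
    forall t x, 0 <= t -> nonlocal_avg u k t x = w t x.
Proof.
move=> Znd Zmu u0Z; have [M [M1 [v [mv vM uv vE]]]] := solution_representative.
have M0 : 0 <= M := le_trans ler01 M1.
have wE t x : 0 <= t -> nonlocal_avg u k t x = avg v eps t x.
  by move=> t0; exact: (@nonlocal_avg_representative M v).
exists (avg v eps) => //.
have u0M x : `|u0 x| <= M by rewrite ger0_norm; have := u01 x; lra.
have [_ _ wk] := sol.
apply: (solution_transported mv vM eps0 _ mu0 u0M _ Znd Zmu u0Z).
- move=> phi tphi mphi; rewrite -[RHS](wk phi tphi); congr (_ + _).
  have [+ _ _] := sol => /essentially_bounded[mf _].
  have mV : measurable_fun setT (fun p => 1 - avg v eps p.1 p.2).
    by apply: measurable_funB => //; exact: (measurable_avg mv vM eps0).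
  have mW : measurable_fun setT (fun p => 'D_(dir R true) phi p +
      (1 - avg v eps p.1 p.2) * 'D_(dir R false) phi p).
    by apply: measurable_funD => //; exact: measurable_funM.
  have -> : \int[leb2 R]_(p in half_plane R) (u p * ('D_(dir R true) phi p +
       (1 - nonlocal_avg u k p.1 p.2) * 'D_(dir R false) phi p)) =
     \int[leb2 R]_(p in half_plane R) ((u \* \1_(half_plane R)) p *
       ('D_(dir R true) phi p + (1 - avg v eps p.1 p.2) * 'D_(dir R false) phi p)).
    apply: eq_Rintegral => p; rewrite inE => hp; rewrite wE//=.
    by rewrite indicE mem_set// mulr1.
  rewrite /Rintegral; congr fine; apply: ae_eq_integral.
  + exact: measurable_half_plane.
  + by apply/measurable_EFinP; apply: measurable_funTS; exact: measurable_funM.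
  + by apply/measurable_EFinP; apply: measurable_funTS; exact: measurable_funM.
  + have [N [mN N0 NP]] := uv; exists N; split => //.
    apply: subset_trans NP => p /=; apply: contra_not => uvp hp.
    by rewrite -uvp// indicE mem_set// mulr1.
- move=> X t t0 e e0; have [del del0 hdel] := L1_modulus (- X) X t0 e0.
  exists del => // s s0 st; have := hdel s s0 st => /ltW h.
  have mvst : measurable_fun setT (fun x => `|v (s, x) - v (t, x)|).
    by apply: measurableT_comp => //; apply: measurable_funB; exact: measurable_slice.
  have ivst : (leb R).-integrable `[- X, X] (EFin \o (fun x => `|v (s, x) - v (t, x)|)).
    apply: (@bounded_integrable_itv _ _ (M + M)) => // x.
    by rewrite normr_id (le_trans (ler_normB _ _))// lerD.
  rewrite -lee_fin /Rintegral fineK; last exact: (integrable_fin_num _ ivst).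
  apply: le_trans h; apply: ge0_le_integral => //.
  + by apply/measurable_EFinP; apply: measurable_funTS.
  + apply/measurable_EFinP; apply: measurable_funTS; apply: measurableT_comp => //.
    by apply: measurable_funB; exact: mut.
  + by move=> x _; rewrite lee_fin !vE//; exact: clamp_lipschitz.
Qed.

End Representative.

(** * Variation of the window averages of a pair of blocks *)

Section TotalVariationPieces.
Context {R : realType}.
Implicit Types (f : R -> R) (a b : R).

Lemma nonincreasing_total_variation a b f : a <= b ->
  {in `[a, b] &, {homo f : x y /~ x <= y}} ->
  total_variation a b f = (f a - f b)%:E.
Proof.
move=> ab fni; rewrite -total_variationN nondecreasing_total_variation//.
  by congr EFin; rewrite /= opprK addrC.
by move=> x y xab yab xy; rewrite /= lerN2; exact: fni.
Qed.

Lemma total_variation_three_turns f a x1 x2 x3 b :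
  a <= x1 -> x1 <= x2 -> x2 <= x3 -> x3 <= b ->
  {in `[a, x1] &, {homo f : x y / x <= y}} ->
  {in `[x1, x2] &, {homo f : x y /~ x <= y}} ->
  {in `[x2, x3] &, {homo f : x y / x <= y}} ->
  {in `[x3, b] &, {homo f : x y /~ x <= y}} ->
  total_variation a b f = (2 * (f x1 - f x2 + f x3) - f a - f b)%:E.
Proof.
move=> a1 x12 x23 x3b h1 h2 h3 h4.
have x13 := le_trans x12 x23; have a3 := le_trans a1 x13.
rewrite (total_variationD f a3 x3b) (total_variationD f a1 x13).
rewrite (total_variationD f x12 x23).
rewrite (nondecreasing_total_variation a1 h1) (nonincreasing_total_variation x12 h2).
rewrite (nondecreasing_total_variation x23 h3) (nonincreasing_total_variation x3b h4).
by rewrite -!EFinD; congr EFin; ring.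
Qed.

(** At positive times the shape of [w] is unknown, but a lower bound on its variation is all that is
    wanted, and five values give it. The equality for monotone branches serves at time 0. *)
Lemma total_variation_three_ge f a x1 x2 x3 b :
  a <= x1 -> x1 <= x2 -> x2 <= x3 -> x3 <= b ->
  ((2 * (f x1 - f x2 + f x3) - f a - f b)%:E <= total_variation a b f)%E.
Proof.
move=> a1 x12 x23 x3b.
have x13 := le_trans x12 x23; have a3 := le_trans a1 x13.
rewrite (total_variationD f a3 x3b) (total_variationD f a1 x13).
rewrite (total_variationD f x12 x23).
have -> : (2 * (f x1 - f x2 + f x3) - f a - f b)%:E =
   ((f x1 - f a)%:E + ((f x1 - f x2)%:E + (f x3 - f x2)%:E) + (f x3 - f b)%:E)%E.
  by rewrite -!EFinD; congr EFin; ring.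
have tv x y : x <= y -> ((f y - f x)%:E <= total_variation x y f)%E.
  by move=> xy; rewrite (le_trans _ (total_variation_ge f xy))// lee_fin ler_norm.
have tv' x y : x <= y -> ((f x - f y)%:E <= total_variation x y f)%E.
  by move=> xy; rewrite (le_trans _ (total_variation_ge f xy))// lee_fin distrC ler_norm.
by rewrite !leeD ?tv ?tv'.
Qed.

Lemma le_total_variation_itv f a b c d : c <= a -> a <= b -> b <= d ->
  (total_variation a b f <= total_variation c d f)%E.
Proof.
move=> ca ab bd; have ad := le_trans ab bd.
rewrite (total_variationD f ca ad) (total_variationD f ab bd).
apply: (le_trans (leeDl _ (total_variation_ge0 f bd))).
exact: leeDr (total_variation_ge0 f ca).
Qed.

Context (g : nat -> R) (gS : forall n, g n <= g n.+1).

Let g_le n m : (n <= m)%N -> g n <= g m.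
Proof.
by move=> /subnK <-; elim: (m - n)%N => //= k IH; rewrite addSn (le_trans IH).
Qed.

Lemma total_variation_gaps f n :
  total_variation (g 0%N) (g n) f =
  (\sum_(0 <= i < n) total_variation (g i) (g i.+1) f)%E.
Proof.
elim: n => [|n IH]; first by rewrite total_variationxx big_geq.
by rewrite big_nat_recr//= -IH -total_variationD// g_le.
Qed.

Lemma TotVar_ge_gaps f (c : nat -> R) n :
  (forall i, (c i)%:E <= total_variation (g i) (g i.+1) f)%E ->
  ((\sum_(0 <= i < n) c i)%:E <= TotVar f)%E.
Proof.
move=> cf; have : (total_variation (g 0%N) (g n) f <= TotVar f)%E.
  by apply: ereal_sup_ubound; exists (g 0%N, g n) => //=; exact: g_le.
apply: le_trans; rewrite total_variation_gaps -sumEFin.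
by apply: lee_sum => i _; exact: cf.
Qed.

(** The cells exhaust the line to the right, and to the left of [g 0] the function is constant, so
    no variation escapes. *)
Lemma TotVar_le_gaps f (c : nat -> R) (S : R) :
  (forall x, exists n, x <= g n) ->
  {in `]-oo, g 0%N] &, forall x y, f x = f y} ->
  (forall i, total_variation (g i) (g i.+1) f <= (c i)%:E)%E ->
  (forall n, \sum_(0 <= i < n) c i <= S) ->
  (TotVar f <= S%:E)%E.
Proof.
move=> gy f0 cf cS; apply: ge_ereal_sup => _ [[a b] /= ab <-].
have [n bn] := gy b.
pose a' := Num.min a (g 0%N).
have a'0 : a' <= g 0%N by rewrite ge_min lexx orbT.
have a'b : a' <= a by rewrite ge_min lexx.
pose b' := Num.max b (g n).
apply: (le_trans (le_total_variation_itv f a'b ab bn)).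
rewrite (total_variationD f a'0 (g_le (leq0n n))).
rewrite nondecreasing_total_variation//; last first.
  move=> x y; rewrite !in_itv/= => /andP[_ x0] /andP[_ y0] _.
  by rewrite (f0 x y)// !in_itv.
rewrite (f0 (g 0%N) a') ?in_itv/= ?lexx// subrr add0e total_variation_gaps.
apply: (@le_trans _ _ (\sum_(0 <= i < n) (c i)%:E)%E); last by rewrite sumEFin lee_fin.
by apply: lee_sum => i _; exact: cf.
Qed.

End TotalVariationPieces.

(** * The primitive of a pair of blocks *)

Section Clip.
Context {R : realType}.
Implicit Types (l x y h e : R).

(** Primitive of the indicator of [[0, l]] that vanishes on the left. *)
Definition clip l x : R := Num.max 0 (Num.min x l).

Lemma clip_le0 l x : x <= 0 -> clip l x = 0.
Proof. by move=> x0; rewrite /clip; apply/max_idPl; rewrite ge_min x0. Qed.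

Lemma clip_ge l x : 0 <= l -> l <= x -> clip l x = l.
Proof. by move=> l0 lx; rewrite /clip (min_idPr lx); exact/max_idPr. Qed.

Lemma clip_id l x : 0 <= x -> x <= l -> clip l x = x.
Proof. by move=> x0 xl; rewrite /clip (min_idPl xl); exact/max_idPr. Qed.

Lemma clip_cases l x : 0 <= l ->
  [\/ x <= 0 /\ clip l x = 0, 0 <= x <= l /\ clip l x = x | l <= x /\ clip l x = l].
Proof.
move=> l0; have [x0|x0] := leP x 0; first by constructor 1; rewrite clip_le0.
have [xl|xl] := leP x l; last first.
  by constructor 3; split; [exact: ltW|rewrite clip_ge// ltW].
by constructor 2; split; [rewrite ltW|rewrite clip_id// ltW].
Qed.

Lemma clip_homo l x y : 0 <= l -> x <= y -> clip l x <= clip l y.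
Proof.
move=> l0 xy; have := clip_cases x l0; have := clip_cases y l0.
by case=> -[? ->]; case=> -[? ->]; lra.
Qed.

Lemma clip_ge0 l x : 0 <= l -> 0 <= clip l x.
Proof. by move=> l0; have := clip_cases x l0; case=> -[? ->]; lra. Qed.

Lemma clip_le l x : 0 <= l -> clip l x <= l.
Proof. by move=> l0; have := clip_cases x l0; case=> -[? ->]; lra. Qed.

(** Convexity of [clip] to the left of [l], in the form used for windows: the part of a block inside
    a window of length [h] grows as the window moves right, as long as its right end has not passed
    [l]. *)
Lemma clip_convex l x y h : 0 <= l -> 0 <= h -> x <= y -> y + h <= l ->
  clip l y - clip l x <= clip l (y + h) - clip l (x + h).
Proof.
move=> l0 h0 xy yh; have := clip_cases x l0; have := clip_cases y l0.
have := clip_cases (x + h) l0; have := clip_cases (y + h) l0.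
by case=> -[? ->]; case=> -[? ->]; case=> -[? ->]; case=> -[? ->]; lra.
Qed.

(** Concavity to the right of 0: the covered part of the block shrinks once the left end of the
    window has entered it. *)
Lemma clip_concave l x y h : 0 <= l -> 0 <= h -> x <= y -> 0 <= x ->
  clip l (y + h) - clip l (x + h) <= clip l y - clip l x.
Proof.
move=> l0 h0 xy x0; have := clip_cases x l0; have := clip_cases y l0.
have := clip_cases (x + h) l0; have := clip_cases (y + h) l0.
by case=> -[? ->]; case=> -[? ->]; case=> -[? ->]; case=> -[? ->]; lra.
Qed.

(* A primitive of the indicator of the two blocks [-5e/4, -e/2] and [0, 3e/4]. *)
Definition profile e y : R := clip (3 / 4 * e) (y + 5 / 4 * e) + clip (3 / 4 * e) y.

Lemma profile_homo e x y : 0 <= e -> x <= y -> profile e x <= profile e y.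
Proof. by move=> e0 xy; rewrite /profile lerD ?clip_homo; lra. Qed.

Lemma profile_left e y : 0 <= e -> y <= - (5 / 4) * e -> profile e y = 0.
Proof. by move=> e0 ye; rewrite /profile !clip_le0 ?addr0; lra. Qed.

Lemma profile_block1 e y : 0 <= e -> - (5 / 4) * e <= y <= - (1 / 2) * e ->
  profile e y = y + 5 / 4 * e.
Proof. by move=> e0 ye; rewrite /profile clip_id ?clip_le0 ?addr0; lra. Qed.

Lemma profile_dip e y : 0 <= e -> - (1 / 2) * e <= y <= 0 -> profile e y = 3 / 4 * e.
Proof. by move=> e0 ye; rewrite /profile clip_ge ?clip_le0 ?addr0; lra. Qed.

Lemma profile_block2 e y : 0 <= e -> 0 <= y <= 3 / 4 * e -> profile e y = 3 / 4 * e + y.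
Proof. by move=> e0 ye; rewrite /profile clip_ge ?clip_id; lra. Qed.

Lemma profile_right e y : 0 <= e -> 3 / 4 * e <= y -> profile e y = 3 / 2 * e.
Proof. by move=> e0 ye; rewrite /profile !clip_ge; lra. Qed.

Lemma window_le e h x y : 0 <= e -> 0 <= h ->
  clip (3 / 4 * e) (y + 5 / 4 * e) - clip (3 / 4 * e) (x + 5 / 4 * e) <=
  clip (3 / 4 * e) (y + h + 5 / 4 * e) - clip (3 / 4 * e) (x + h + 5 / 4 * e) ->
  clip (3 / 4 * e) y - clip (3 / 4 * e) x <=
  clip (3 / 4 * e) (y + h) - clip (3 / 4 * e) (x + h) ->
  profile e (x + h) - profile e x <= profile e (y + h) - profile e y.
Proof. by rewrite /profile; lra. Qed.

End Clip.

(** * Variation of the average over one piece, for a window finer, coarser or of the same scale *)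

Section Piece.
Context {R : realType} (Z : R -> R) (w : R -> R -> R) (c A e E h K T : R).
Context (A0 : 0 < A) (A1 : A <= 1 / 2) (e0 : 0 < e) (eE : e <= E).
Context (h0 : 0 < h) (hE : h <= E).
Context (Zloc : forall x y, - (6 * E) <= x <= 6 * E -> - (6 * E) <= y <= 6 * E ->
  Z (c + x) - Z (c + y) = A * (profile e x - profile e y)).
Context (tr : transported h K Z w) (K1 : 1 <= K) (T0 : 0 <= T) (KT : K * T <= h / 96).

Let TK : T <= K * T. Proof. by rewrite ler_peMl. Qed.

(* [lra] does not see section hypotheses. *)
Ltac lraP := move: (A0) (A1) (e0) (eE) (h0) (hE) (K1) (T0) (KT) (TK) => *; lra.

Lemma window0 (y : R) : - (5 * E) <= y <= 5 * E ->
  h * w 0 (c + y) = A * (profile e (y + h) - profile e y).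
Proof.
by move=> yE; rewrite (transported0 tr) -addrA Zloc//; lraP.
Qed.

Lemma window_speed t x : 0 <= t -> - K <= 1 - w t x <= K.
Proof. by move=> t0; rewrite -ler_norml; exact: (transported_speed tr). Qed.

(** Speeds are bounded by [K] in absolute value, so each end moves by at most [K * T]: the window
    carries no more than the initial mass of the window enlarged by that much on both sides. *)
Lemma window_crude_le (t y : R) : 0 <= t <= T -> - (5 * E) <= y <= 5 * E - h ->
  h * w t (c + y) <= A * (profile e (y + h + K * T) - profile e (y - K * T)).
Proof.
move=> /andP[t0 tT] yE.
have KtT : K * t <= K * T by rewrite ler_wpM2l// (le_trans ler01).
have Kt0 : 0 <= K * t by rewrite mulr_ge0// (le_trans ler01).
have h1 s x : 0 <= s <= t -> `|x - (c + y)| <= K * t -> 1 - w s x <= K.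
  by move=> /andP[s0 _] _; have /andP[] := window_speed x s0.
have h2 s x : 0 <= s <= t -> `|x - (c + y + h)| <= K * t -> - K <= 1 - w s x.
  by move=> /andP[s0 _] _; have /andP[] := window_speed x s0.
apply: le_trans (transported_le tr t0 h1 h2) _.
rewrite (_ : c + y + h - t * - K = c + (y + h + K * t)); last by ring.
rewrite (_ : c + y - t * K = c + (y - K * t)); last by ring.
rewrite Zloc; [|lraP|lraP]; rewrite ler_pM2l// lerB//; apply: profile_homo; lraP.
Qed.

Lemma window_crude_ge (t y : R) : 0 <= t <= T -> - (5 * E) <= y <= 5 * E - h ->
  A * (profile e (y + h - K * T) - profile e (y + K * T)) <= h * w t (c + y).
Proof.
move=> /andP[t0 tT] yE.
have KtT : K * t <= K * T by rewrite ler_wpM2l// (le_trans ler01).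
have Kt0 : 0 <= K * t by rewrite mulr_ge0// (le_trans ler01).
have h1 s x : 0 <= s <= t -> `|x - (c + y + h)| <= K * t -> 1 - w s x <= K.
  by move=> /andP[s0 _] _; have /andP[] := window_speed x s0.
have h2 s x : 0 <= s <= t -> `|x - (c + y)| <= K * t -> - K <= 1 - w s x.
  by move=> /andP[s0 _] _; have /andP[] := window_speed x s0.
apply: le_trans (transported_ge tr t0 h2 h1).
rewrite (_ : c + y + h - t * K = c + (y + h - K * t)); last by ring.
rewrite (_ : c + y - t * - K = c + (y + K * t)); last by ring.
rewrite Zloc; [|lraP|lraP]; rewrite ler_pM2l// lerB//; apply: profile_homo; lraP.
Qed.

(* One Euler-like refinement of the crude bounds: speeds are frozen at their
   values over the window itself, up to [K * T]. *)
Lemma window_le_frozen (y v v' : R) : - (4 * E) <= y <= 4 * E - 3 * h ->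
  0 <= v <= K -> 0 <= v' <= K ->
  h * (1 - v) <= A * (profile e (y + h - 2 * (K * T)) - profile e (y + 2 * (K * T))) ->
  A * (profile e (y + h + h + 2 * (K * T)) - profile e (y + h - 2 * (K * T))) <= h * (1 - v') ->
  h * w T (c + y) <= A * (profile e (y + h - T * v') - profile e (y - T * v)).
Proof.
move=> yE vK v'K hv hv'.
have KT0 : 0 <= K * T by rewrite mulr_ge0// (le_trans ler01).
have Tv : 0 <= T * v <= K * T.
  by rewrite mulr_ge0 ?(andP vK).1//= mulrC ler_wpM2r// (andP vK).2.
have Tv' : 0 <= T * v' <= K * T.
  by rewrite mulr_ge0 ?(andP v'K).1//= mulrC ler_wpM2r// (andP v'K).2.
(* A trajectory stays within [K * T] of its end of the window, and the crude bound at its current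
   position costs another [K * T]; hence the margins [2 * (K * T)]. *)
have h1 s x : 0 <= s <= T -> `|x - (c + y)| <= K * T -> 1 - w s x <= v.
  move=> sT; rewrite ler_norml => xy.
  have yE' : - (5 * E) <= x - c <= 5 * E - h by lraP.
  have := window_crude_ge sT yE'; rewrite subrKC => hw.
  have : h * (1 - v) <= h * w s x.
    apply: le_trans hv (le_trans _ hw); rewrite ler_pM2l// lerB//; apply: profile_homo; lraP.
  by rewrite ler_pM2l//; lraP.
have h2 s x : 0 <= s <= T -> `|x - (c + y + h)| <= K * T -> v' <= 1 - w s x.
  move=> sT; rewrite ler_norml => xy.
  have yE' : - (5 * E) <= x - c <= 5 * E - h by lraP.
  have := window_crude_le sT yE'; rewrite subrKC => hw.
  have : h * w s x <= h * (1 - v').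
    apply: le_trans hw (le_trans _ hv'); rewrite ler_pM2l// lerB//; apply: profile_homo; lraP.
  by rewrite ler_pM2l//; lraP.
apply: le_trans (transported_le tr T0 h1 h2) _.
by rewrite -!addrA Zloc// ?addrA//; lraP.
Qed.

Lemma window_ge_frozen (y v v' : R) : - (4 * E) <= y <= 4 * E - 3 * h ->
  0 <= v <= K -> 0 <= v' <= K ->
  A * (profile e (y + h + 2 * (K * T)) - profile e (y - 2 * (K * T))) <= h * (1 - v) ->
  h * (1 - v') <= A * (profile e (y + h + h - 2 * (K * T)) - profile e (y + h + 2 * (K * T))) ->
  A * (profile e (y + h - T * v') - profile e (y - T * v)) <= h * w T (c + y).
Proof.
move=> yE vK v'K hv hv'.
have KT0 : 0 <= K * T by rewrite mulr_ge0// (le_trans ler01).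
have Tv : 0 <= T * v <= K * T.
  by rewrite mulr_ge0 ?(andP vK).1//= mulrC ler_wpM2r// (andP vK).2.
have Tv' : 0 <= T * v' <= K * T.
  by rewrite mulr_ge0 ?(andP v'K).1//= mulrC ler_wpM2r// (andP v'K).2.
have h1 s x : 0 <= s <= T -> `|x - (c + y)| <= K * T -> v <= 1 - w s x.
  move=> sT; rewrite ler_norml => xy.
  have yE' : - (5 * E) <= x - c <= 5 * E - h by lraP.
  have := window_crude_le sT yE'; rewrite subrKC => hw.
  have : h * w s x <= h * (1 - v).
    apply: le_trans hw (le_trans _ hv); rewrite ler_pM2l// lerB//; apply: profile_homo; lraP.
  by rewrite ler_pM2l//; lraP.
have h2 s x : 0 <= s <= T -> `|x - (c + y + h)| <= K * T -> 1 - w s x <= v'.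
  move=> sT; rewrite ler_norml => xy.
  have yE' : - (5 * E) <= x - c <= 5 * E - h by lraP.
  have := window_crude_ge sT yE'; rewrite subrKC => hw.
  have : h * (1 - v') <= h * w s x.
    apply: le_trans hv' (le_trans _ hw); rewrite ler_pM2l// lerB//; apply: profile_homo; lraP.
  by rewrite ler_pM2l//; lraP.
apply: le_trans (transported_ge tr T0 h1 h2).
by rewrite -!addrA Zloc// ?addrA//; lraP.
Qed.

(* The bound on [c0] makes the initial variations summable over the pieces. *)
Definition gains (gain : R) : Prop := exists c0 cT : R,
  [/\ total_variation (c - 4 * E) (c + 4 * E) (w 0) = c0%:E,
      0 <= c0 <= 6 * E / h * A,
      (cT%:E <= total_variation (c - 4 * E) (c + 4 * E) (w T))%E &
      c0 + gain <= cT].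

Lemma window0_le (x y : R) : - (4 * E) <= x <= 4 * E -> - (4 * E) <= y <= 4 * E ->
  profile e (x + h) - profile e x <= profile e (y + h) - profile e y ->
  w 0 (c + x) <= w 0 (c + y).
Proof.
move=> xE yE xy; rewrite -(ler_pM2l h0) !window0; [|lraP|lraP].
by rewrite ler_pM2l.
Qed.

Lemma window0_bounds (y : R) : - (4 * E) <= y <= 4 * E ->
  0 <= h * w 0 (c + y) <= 3 / 2 * E * A.
Proof.
move=> yE; have e34 : 0 <= 3 / 4 * e by lraP.
rewrite window0; last lraP.
have up : profile e (y + h) <= 3 / 2 * e.
  have := clip_le (y + h + 5 / 4 * e) e34; have := clip_le (y + h) e34.
  by rewrite /profile; lraP.
have lo : 0 <= profile e y by rewrite addr_ge0 ?clip_ge0.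
have mo : profile e y <= profile e (y + h) by apply: profile_homo; lraP.
apply/andP; split; first by apply: mulr_ge0; [exact: ltW|rewrite subr_ge0].
by rewrite mulrC; apply: ler_wpM2r; [exact: ltW|lraP].
Qed.

(** There is no mass near the borders of the cell. Upper bounds are enough, since these values are
    subtracted in the lower bound of the variation. *)
Lemma window_ends t : 0 <= t <= T ->
  h * w t (c - 4 * E) <= 0 /\ h * w t (c + 4 * E) <= 0.
Proof.
move=> tT; have KT0 : 0 <= K * T by rewrite mulr_ge0// (le_trans ler01).
split; rewrite (le_trans (window_crude_le tT _))//; try lraP.
  by rewrite !(profile_left (ltW e0)) ?subrr ?mulr0//; lraP.
by rewrite !(profile_right (ltW e0)) ?subrr ?mulr0//; lraP.
Qed.

Lemma window0_ends : w 0 (c - 4 * E) = 0 /\ w 0 (c + 4 * E) = 0.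
Proof.
split; apply: (mulfI (lt0r_neq0 h0)); rewrite mulr0 window0; try lraP.
  by rewrite !(profile_left (ltW e0)) ?subrr ?mulr0//; lraP.
by rewrite !(profile_right (ltW e0)) ?subrr ?mulr0//; lraP.
Qed.

Lemma window0_total_variation (y1 y2 y3 : R) :
  - (4 * E) <= y1 -> y1 <= y2 -> y2 <= y3 -> y3 <= 4 * E ->
  (forall x y, x <= y -> y <= y1 ->
    profile e (x + h) - profile e x <= profile e (y + h) - profile e y) ->
  (forall x y, y1 <= x -> x <= y -> y <= y2 ->
    profile e (y + h) - profile e y <= profile e (x + h) - profile e x) ->
  (forall x y, y2 <= x -> x <= y -> y <= y3 ->
    profile e (x + h) - profile e x <= profile e (y + h) - profile e y) ->
  (forall x y, y3 <= x -> x <= y ->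
    profile e (y + h) - profile e y <= profile e (x + h) - profile e x) ->
  total_variation (c - 4 * E) (c + 4 * E) (w 0) =
  (2 * (w 0 (c + y1) - w 0 (c + y2) + w 0 (c + y3)))%:E.
Proof.
move=> y1E y12 y23 y3E m1 m2 m3 m4.
have cE x a b : (c + a <= x <= c + b) = (a <= x - c <= b).
  by rewrite lerBrDl lerBlDl.
have loc x : x = c + (x - c) by rewrite subrKC.
rewrite (@total_variation_three_turns _ (w 0) _ (c + y1) (c + y2) (c + y3)) ?lerD2l//.
- by have [-> ->] := window0_ends; rewrite !subr0.
- move=> x y; rewrite !in_itv/= !cE => /andP[x1 x2] /andP[z1 z2] xy.
  rewrite (loc x) (loc y); apply: window0_le; last by apply: m1; rewrite ?lerD2r.
    by rewrite x1 (le_trans x2)// (le_trans y12)// (le_trans y23).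
  by rewrite z1 (le_trans z2)// (le_trans y12)// (le_trans y23).
- move=> x y; rewrite !in_itv/= !cE => /andP[x1 x2] /andP[z1 z2] xy.
  rewrite (loc x) (loc y); apply: window0_le; last by apply: m2; rewrite ?lerD2r.
    by rewrite (le_trans y1E x1) (le_trans x2)// (le_trans y23).
  by rewrite (le_trans y1E z1) (le_trans z2)// (le_trans y23).
- move=> x y; rewrite !in_itv/= !cE => /andP[x1 x2] /andP[z1 z2] xy.
  rewrite (loc x) (loc y); apply: window0_le; last by apply: m3; rewrite ?lerD2r.
    by rewrite (le_trans x2)// andbT (le_trans _ x1)// (le_trans y1E).
  by rewrite (le_trans z2)// andbT (le_trans _ z1)// (le_trans y1E).
- move=> x y; rewrite !in_itv/= !cE => /andP[x1 x2] /andP[z1 z2] xy.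
  rewrite (loc x) (loc y); apply: window0_le; last by apply: m4; rewrite ?lerD2r.
    by rewrite x2 andbT (le_trans _ x1)// (le_trans y1E)// (le_trans y12).
  by rewrite z2 andbT (le_trans _ z1)// (le_trans y1E)// (le_trans y12).
Qed.

(** The turning points of time 0 are kept at time [T], where they need not be extremal, because the
    variation there is only bounded below. Each turning value counts twice, and a window mass is [h]
    times a value of [w]: whence [2 * d / h]. *)
Lemma turning_points_gain (y1 y2 y3 d : R) :
  - (4 * E) <= y1 -> y1 <= y2 -> y2 <= y3 -> y3 <= 4 * E ->
  (forall x y, x <= y -> y <= y1 ->
    profile e (x + h) - profile e x <= profile e (y + h) - profile e y) ->
  (forall x y, y1 <= x -> x <= y -> y <= y2 ->
    profile e (y + h) - profile e y <= profile e (x + h) - profile e x) ->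
  (forall x y, y2 <= x -> x <= y -> y <= y3 ->
    profile e (x + h) - profile e x <= profile e (y + h) - profile e y) ->
  (forall x y, y3 <= x -> x <= y ->
    profile e (y + h) - profile e y <= profile e (x + h) - profile e x) ->
  h * (w 0 (c + y1) - w 0 (c + y2) + w 0 (c + y3)) + d <=
    h * (w T (c + y1) - w T (c + y2) + w T (c + y3)) ->
  gains (2 * d / h).
Proof.
move=> y1E y12 y23 y3E m1 m2 m3 m4 hd.
have TT : 0 <= T <= T by rewrite T0 lexx.
have [l2 l3] : - (4 * E) <= y2 <= 4 * E /\ - (4 * E) <= y3 <= 4 * E.
  by split; [rewrite (le_trans y1E)//= (le_trans y23)|
    rewrite y3E andbT (le_trans y1E)// (le_trans y12)].
have l1 : - (4 * E) <= y1 <= 4 * E.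
  by rewrite y1E/= (le_trans y12)// (le_trans y23).
exists (2 * (w 0 (c + y1) - w 0 (c + y2) + w 0 (c + y3))).
exists (2 * (w T (c + y1) - w T (c + y2) + w T (c + y3)) - w T (c - 4 * E) - w T (c + 4 * E)).
split.
- exact: window0_total_variation.
- have w21 : h * w 0 (c + y2) <= h * w 0 (c + y1).
    by rewrite ler_pM2l// window0_le// m2.
  have /andP[b1 b1'] := window0_bounds l1; have /andP[b2 b2'] := window0_bounds l2.
  have /andP[b3 b3'] := window0_bounds l3; apply/andP; split.
    rewrite -(pmulr_rge0 _ h0) mulrCA mulrDr mulrBr; move: b3 w21.
    by move: (h * w 0 _) (h * w 0 _) (h * w 0 _) => *; lra.
  (* Two maxima, each at most [3 / 2 * E * A / h], count twice: this is the constant 6. *)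
  rewrite -(ler_pM2l h0) [leRHS](_ : _ = 6 * E * A); last by field; rewrite gt_eqF.
  rewrite mulrCA mulrDr mulrBr; move: b1' b2 b3'.
  by move: (h * w 0 _) (h * w 0 _) (h * w 0 _) => *; lra.
- by apply: total_variation_three_ge; rewrite lerD2l.
- have [wl wr] := window_ends TT.
  rewrite -(ler_pM2l h0) mulrDr [h * (2 * d / h)](_ : _ = 2 * d); last first.
    by field; rewrite gt_eqF.
  rewrite !(mulrBr h) ![h * (2 * _)]mulrCA.
  move: wl wr hd; move: (h * w T _) (h * w T _) (h * (w 0 _ - _ + _)) (h * (w T _ - _ + _)) => *; lra.
Qed.

(** At time 0 the average rises and then falls, so the three turning points coincide. The window
    from [- h / 2] to [h / 2] contains both blocks with a margin larger than [K * T], and the crude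
    bound already keeps its whole mass. *)
Lemma fine_piece_gain : 16 * e <= h -> gains 0.
Proof.
move=> eh; pose y1 := - (h / 2).
have KT0 : 0 <= K * T by rewrite mulr_ge0// (le_trans ler01).
have left0 y : y <= y1 -> profile e y = 0.
  by rewrite /y1 => yy; apply: profile_left; lraP.
have right0 y : y1 <= y -> profile e (y + h) = 3 / 2 * e.
  by rewrite /y1 => yy; apply: profile_right; lraP.
have up x y : x <= y -> y <= y1 ->
    profile e (x + h) - profile e x <= profile e (y + h) - profile e y.
  move=> xy yy; rewrite (left0 x (le_trans xy yy)) (left0 y yy) !subr0.
  by apply: profile_homo; lraP.
have down x y : y1 <= x -> x <= y ->
    profile e (y + h) - profile e y <= profile e (x + h) - profile e x.
  move=> yx xy; rewrite (right0 x yx) (right0 y (le_trans yx xy)) lerB//.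
  by apply: profile_homo; lraP.
have := @turning_points_gain y1 y1 y1 0.
rewrite mulr0 mul0r; apply => //.
- by rewrite /y1; lraP.
- by rewrite /y1; lraP.
- by move=> x y h1 h2 h3; exact: down.
- by move=> x y h1 h2 h3; exact: up.
rewrite addr0 !subrr !add0r window0; last by rewrite /y1; lraP.
have TT : 0 <= T <= T by rewrite T0 lexx.
have yE : - (5 * E) <= y1 <= 5 * E - h by rewrite /y1; lraP.
apply: le_trans (window_crude_ge TT yE).
rewrite right0// left0// (@profile_right _ e (_ - _)) ?(@profile_left _ e (_ + _))//;
  rewrite /y1; lraP.
Qed.

(** The ends of the window and the windows that determine their speeds lie in one block, so both
    speeds are 1 - A up to O(K T / h). The distance between the feet thus differs from [h] only at
    second order in time. *)
Lemma coarse_top (y : R) : - (4 * E) <= y <= 4 * E - 3 * h ->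
  (forall s s', - h <= s - y <= 3 * h -> - h <= s' - y <= 3 * h ->
    profile e s - profile e s' = s - s') ->
  A * h - 8 * K * T ^+ 2 / h <= h * w T (c + y).
Proof.
move=> yE aff; have K0 : 0 <= K := le_trans ler01 K1.
have KT0 : 0 <= K * T by rewrite mulr_ge0.
have b1 : profile e (y + h + 2 * (K * T)) - profile e (y - 2 * (K * T)) =
    h + 4 * (K * T) by rewrite aff; lraP.
have b2 : profile e (y + h + h - 2 * (K * T)) - profile e (y + h + 2 * (K * T)) =
    h - 4 * (K * T) by rewrite aff; lraP.
have b3 s s' : 0 <= s <= K * T -> 0 <= s' <= K * T ->
    profile e (y + h - s') - profile e (y - s) = h - s' + s.
  by move=> sK s'K; rewrite aff; lraP.
pose v := 1 - A * (1 + 4 * (K * T) / h); pose v' := 1 - A * (1 - 4 * (K * T) / h).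
have r1 : 4 * (K * T) / h <= 1 / 24 by rewrite ler_pdivrMr//; lraP.
have r0 : 0 <= 4 * (K * T) / h by exact: divr_ge0 (mulr_ge0 (ler0n R 4) KT0) (ltW h0).
have Ar : 0 <= A * (4 * (K * T) / h) <= A * (1 / 24).
  by rewrite (mulr_ge0 (ltW A0) r0)/= (ler_wpM2l (ltW A0) r1).
have [vK v'K] : 0 <= v <= K /\ 0 <= v' <= K.
  by rewrite /v /v' mulrDr mulrBr mulr1; split; lraP.
have hv : h * (1 - v) = A * (h + 4 * (K * T)) by rewrite /v; field; rewrite gt_eqF.
have hv' : h * (1 - v') = A * (h - 4 * (K * T)) by rewrite /v'; field; rewrite gt_eqF.
have Tv : 0 <= T * v <= K * T.
  by rewrite mulr_ge0 ?(andP vK).1//= mulrC ler_wpM2r// (andP vK).2.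
have Tv' : 0 <= T * v' <= K * T.
  by rewrite mulr_ge0 ?(andP v'K).1//= mulrC ler_wpM2r// (andP v'K).2.
(* Here v' - v equals 8 A K T / h; the resulting factor A^2 is bounded by 1. *)
have loss : A * h - 8 * K * T ^+ 2 / h <= A * (h - T * v' + T * v).
  have -> : A * (h - T * v' + T * v) = A * h - A ^+ 2 * (8 * K * T ^+ 2 / h).
    by rewrite /v /v'; field; rewrite gt_eqF.
  rewrite lerD2l lerN2 ler_piMl//.
    exact: divr_ge0 (mulr_ge0 (mulr_ge0 (ler0n R 8) K0) (sqr_ge0 T)) (ltW h0).
  by rewrite (expr_le1 _ (ltW A0))//; lraP.
apply: le_trans loss _; rewrite -(b3 _ _ Tv Tv').
by apply: window_ge_frozen; rewrite ?b1 ?b2 ?hv ?hv'.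
Qed.

Lemma coarse_piece_gain : 16 * h <= e -> gains (- (32 * K * T ^+ 2 / h ^+ 2)).
Proof.
(* Each point is one window length inside a block or the dip: this leaves room for the displacements
   on the left and, as [16 * h <= e], for the next window on the right. *)
move=> he; pose y1 := - (5 / 4) * e + h; pose y2 := - (1 / 2) * e + h; pose y3 := h.
have K0 : 0 <= K := le_trans ler01 K1.
have KT0 : 0 <= K * T by rewrite mulr_ge0.
have e34 : 0 <= 3 / 4 * e by lraP.
have z0 x : x <= 0 -> clip (3 / 4 * e) x = 0 by exact: clip_le0.
have zl x : 3 / 4 * e <= x -> clip (3 / 4 * e) x = 3 / 4 * e by exact: clip_ge.
have q : - (32 * K * T ^+ 2 / h ^+ 2) = 2 * (- (16 * K * T ^+ 2 / h)) / h.
  by field; rewrite gt_eqF.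
rewrite q; apply: (@turning_points_gain y1 y2 y3); rewrite /y1 /y2 /y3.
- lraP.
- lraP.
- lraP.
- lraP.
- move=> x y xy yy; apply: window_le => //; [lraP|lraP| |].
    rewrite -![_ + h + _]addrAC; apply: clip_convex => //; lraP.
  by rewrite (z0 x) ?(z0 y) ?subrr ?subr_ge0 ?clip_homo//; lraP.
- move=> x y yx xy yy.
  have := @clip_concave _ (3 / 4 * e) (x + 5 / 4 * e) (y + 5 / 4 * e) h e34.
  rewrite ![_ + 5 / 4 * e + h]addrAC /profile.
  rewrite (z0 (x + h)) ?(z0 x) ?(z0 (y + h)) ?(z0 y); lraP.
- move=> x y yx xy yy; apply: window_le => //; [lraP|lraP| |].
    by rewrite !zl ?subrr//; lraP.
  by apply: clip_convex => //; lraP.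
- move=> x y yx xy; have := @clip_concave _ (3 / 4 * e) x y h e34.
  rewrite /profile !(zl (_ + 5 / 4 * e)); lraP.
have blk1 z : - (5 / 4) * e <= z <= - (1 / 2) * e -> profile e z = z + 5 / 4 * e :=
  profile_block1 (ltW e0).
have dip z : - (1 / 2) * e <= z <= 0 -> profile e z = 3 / 4 * e := profile_dip (ltW e0).
have blk2 z : 0 <= z <= 3 / 4 * e -> profile e z = 3 / 4 * e + z :=
  profile_block2 (ltW e0).
have aff1 s s' : - h <= s - y1 <= 3 * h ->
    - h <= s' - y1 <= 3 * h -> profile e s - profile e s' = s - s'.
  by rewrite /y1 => sh sh'; rewrite !blk1; lraP.
have aff3 s s' : - h <= s - y3 <= 3 * h ->
    - h <= s' - y3 <= 3 * h -> profile e s - profile e s' = s - s'.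
  by rewrite /y3 => sh sh'; rewrite !blk2; lraP.
have TT : 0 <= T <= T by rewrite T0 lexx.
have bot : h * w T (c + y2) <= 0.
  have yE : - (5 * E) <= y2 <= 5 * E - h by rewrite /y2; lraP.
  apply: le_trans (window_crude_le TT yE) _.
  by rewrite /y2 !dip ?subrr ?mulr0//; lraP.
have i1 : h * w 0 (c + y1) = A * h.
  rewrite window0; last by rewrite /y1; lraP.
  by rewrite aff1; rewrite /y1; lraP.
have i3 : h * w 0 (c + y3) = A * h.
  rewrite window0; last by rewrite /y3; lraP.
  by rewrite aff3; rewrite /y3; lraP.
have i2 : h * w 0 (c + y2) = 0.
  rewrite window0 /y2; last lraP.
  by rewrite !dip ?subrr ?mulr0//; lraP.
have top1 : A * h - 8 * K * T ^+ 2 / h <= h * w T (c + y1).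
  by apply: coarse_top => //; rewrite /y1; lraP.
have top3 : A * h - 8 * K * T ^+ 2 / h <= h * w T (c + y3).
  by apply: coarse_top => //; rewrite /y3; lraP.
rewrite !mulrDr !mulrN.
move: top1 top3 bot i1 i2 i3; rewrite /y1 /y2 /y3.
have -> : 16 * K * T ^+ 2 / h = 8 * K * T ^+ 2 / h + 8 * K * T ^+ 2 / h by field; rewrite gt_eqF.
move: (8 * K * T ^+ 2 / h) => q8 *; lra.
Qed.

Lemma matching_bottom : e = h ->
  h * w T (c - 5 / 8 * e) <= A * (h / 2) - A ^+ 2 * T / 16.
Proof.
(* For every start in [[- e, - e / 2]] both ends lie in the blocks and the initial mass is
   [A * (e / 2)]. From the midpoint -3e/4 both ends would move with the same speed 1 - A/2; from a
   point further right, the window ahead of the right end holds less mass and that end is faster. *)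
move=> eh; pose y := - (5 / 8) * e.
have -> : c - 5 / 8 * e = c + y by rewrite /y; ring.
have K0 : 0 <= K := le_trans ler01 K1.
have KT0 : 0 <= K * T by rewrite mulr_ge0.
have blk1 z : - (5 / 4) * e <= z <= - (1 / 2) * e -> profile e z = z + 5 / 4 * e :=
  profile_block1 (ltW e0).
have blk2 z : 0 <= z <= 3 / 4 * e -> profile e z = 3 / 4 * e + z :=
  profile_block2 (ltW e0).
have rgt z : 3 / 4 * e <= z -> profile e z = 3 / 2 * e := profile_right (ltW e0).
have b1 : profile e (y + h - 2 * (K * T)) - profile e (y + 2 * (K * T)) =
    h / 2 - 4 * (K * T) by rewrite /y -eh blk2 ?blk1; lraP.
have b2 : profile e (y + h + h + 2 * (K * T)) - profile e (y + h - 2 * (K * T)) =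
    3 / 8 * h + 2 * (K * T) by rewrite /y -eh rgt ?blk2; lraP.
have b3 s s' : 0 <= s <= K * T -> 0 <= s' <= K * T ->
    profile e (y + h - s') - profile e (y - s) = h / 2 - s' + s.
  by move=> sK s'K; rewrite /y -eh blk2 ?blk1; lraP.
pose v := 1 - A * (1 / 2 - 4 * (K * T) / h); pose v' := 1 - A * (3 / 8 + 2 * (K * T) / h).
have r1 : (K * T) / h <= 1 / 96 by rewrite ler_pdivrMr//; lraP.
have r0 : 0 <= (K * T) / h by exact: divr_ge0 KT0 (ltW h0).
have Ar : 0 <= A * ((K * T) / h) <= A * (1 / 96).
  by rewrite (mulr_ge0 (ltW A0) r0)/= (ler_wpM2l (ltW A0) r1).
have vE : v = 1 - A / 2 + 4 * (A * ((K * T) / h)) by rewrite /v; ring.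
have v'E : v' = 1 - 3 / 8 * A - 2 * (A * ((K * T) / h)) by rewrite /v'; ring.
have [vK v'K] : 0 <= v <= K /\ 0 <= v' <= K by rewrite vE v'E; split; lraP.
have hv : h * (1 - v) = A * (h / 2 - 4 * (K * T)) by rewrite /v; field; rewrite gt_eqF.
have hv' : h * (1 - v') = A * (3 / 8 * h + 2 * (K * T)) by rewrite /v'; field; rewrite gt_eqF.
have Tv : 0 <= T * v <= K * T.
  by rewrite mulr_ge0 ?(andP vK).1//= mulrC ler_wpM2r// (andP vK).2.
have Tv' : 0 <= T * v' <= K * T.
  by rewrite mulr_ge0 ?(andP v'K).1//= mulrC ler_wpM2r// (andP v'K).2.
apply: (@le_trans _ _ (A * (h / 2 - T * v' + T * v))).
  rewrite -(b3 _ _ Tv Tv').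
  by apply: window_le_frozen; rewrite ?b1 ?b2 ?hv ?hv'//; rewrite /y; lraP.
have -> : A * (h / 2 - T * v' + T * v) = A * (h / 2) - A * T * (v' - v) by ring.
rewrite lerD2l lerN2.
have -> : A ^+ 2 * T / 16 = A * T * (A / 16) by field.
apply: ler_wpM2l; first by rewrite mulr_ge0// ltW.
(* v' - v is A/8 - 6 A K T / h, and K T <= h/96 makes it at least A/16. *)
by rewrite vE v'E; lraP.
Qed.

Lemma matching_piece_gain : e = h -> gains (A ^+ 2 * T / (8 * h)).
Proof.
(* The windows starting at [y1] and [y3] contain exactly one block, with a margin [e / 8] on both
   sides, while their ends move by at most [e / 96]. *)
move=> eh; pose y1 := - (11 / 8) * e; pose y2 := - (5 / 8) * e; pose y3 := - (1 / 8) * e.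
have K0 : 0 <= K := le_trans ler01 K1.
have KT0 : 0 <= K * T by rewrite mulr_ge0.
have e34 : 0 <= 3 / 4 * e by lraP.
have z0 x : x <= 0 -> clip (3 / 4 * e) x = 0 by exact: clip_le0.
have zl x : 3 / 4 * e <= x -> clip (3 / 4 * e) x = 3 / 4 * e by exact: clip_ge.
have q : A ^+ 2 * T / (8 * h) = 2 * (A ^+ 2 * T / 16) / h.
  by field; rewrite gt_eqF.
rewrite q; apply: (@turning_points_gain y1 y2 y3); rewrite /y1 /y2 /y3.
- lraP.
- lraP.
- lraP.
- lraP.
- move=> x y xy yy; rewrite !(@profile_left _ e x) ?(@profile_left _ e y) ?subr0; try lraP.
  by apply: profile_homo; lraP.
- move=> x y yx xy yy; rewrite -eh.
  (* The window has length [e] and the blocks start [5 / 4 * e] apart, so between the maxima its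
     mass is [3 / 4 * e] minus the increment of a single [clip] over [1 / 4 * e]. *)
  have := @clip_convex _ (3 / 4 * e) (x + e) (y + e) (1 / 4 * e) e34.
  rewrite /profile !(zl (_ + e + 5 / 4 * e)) ?(z0 x) ?(z0 y); try lraP.
  have -> : x + e + 1 / 4 * e = x + 5 / 4 * e by field.
  have -> : y + e + 1 / 4 * e = y + 5 / 4 * e by field.
  lraP.
- move=> x y yx xy yy; rewrite -eh.
  have := @clip_concave _ (3 / 4 * e) (x + e) (y + e) (1 / 4 * e) e34.
  rewrite /profile !(zl (_ + e + 5 / 4 * e)) ?(z0 x) ?(z0 y); try lraP.
  have -> : x + e + 1 / 4 * e = x + 5 / 4 * e by field.
  have -> : y + e + 1 / 4 * e = y + 5 / 4 * e by field.
  lraP.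
- move=> x y yx xy; rewrite !(@profile_right _ e (_ + h)); try lraP.
  by rewrite lerB//; apply: profile_homo; lraP.
have lft z : z <= - (5 / 4) * e -> profile e z = 0 := profile_left (ltW e0).
have blk1 z : - (5 / 4) * e <= z <= - (1 / 2) * e -> profile e z = z + 5 / 4 * e :=
  profile_block1 (ltW e0).
have dip z : - (1 / 2) * e <= z <= 0 -> profile e z = 3 / 4 * e := profile_dip (ltW e0).
have blk2 z : 0 <= z <= 3 / 4 * e -> profile e z = 3 / 4 * e + z :=
  profile_block2 (ltW e0).
have rgt z : 3 / 4 * e <= z -> profile e z = 3 / 2 * e := profile_right (ltW e0).
have TT : 0 <= T <= T by rewrite T0 lexx.
have top1 : h * w 0 (c + y1) <= h * w T (c + y1).
  have yE : - (5 * E) <= y1 <= 5 * E - h by rewrite /y1; lraP.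
  apply: le_trans (window_crude_ge TT yE); rewrite window0 /y1 -?eh; last lraP.
  by rewrite (dip (- (11 / 8) * e + e)) ?(lft (- (11 / 8) * e))
    ?(dip (- (11 / 8) * e + e - K * T)) ?(lft (- (11 / 8) * e + K * T)) //; lraP.
have top3 : h * w 0 (c + y3) <= h * w T (c + y3).
  have yE : - (5 * E) <= y3 <= 5 * E - h by rewrite /y3; lraP.
  apply: le_trans (window_crude_ge TT yE); rewrite window0 /y3 -?eh; last lraP.
  by rewrite (rgt (- (1 / 8) * e + e)) ?(dip (- (1 / 8) * e))
    ?(rgt (- (1 / 8) * e + e - K * T)) ?(dip (- (1 / 8) * e + K * T)) //; lraP.
have bot : h * w T (c + y2) <= A * (h / 2) - A ^+ 2 * T / 16.
  by rewrite [y2](_ : _ = - (5 / 8 * e)) ?matching_bottom// /y2; ring.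
have i2 : h * w 0 (c + y2) = A * (h / 2).
  rewrite window0 /y2; last lraP.
  by rewrite -eh blk2 ?blk1; [congr (_ * _); field|lraP..].
rewrite !mulrDr !mulrN.
move: top1 top3 bot i2; rewrite /y1 /y2 /y3 => *; lra.
Qed.

End Piece.

(** * The initial datum *)

Section Blocks.
Context {R : realType}.
Implicit Types (c e a b x : R).

Definition blocks c e x : R :=
  \1_(`[c - 5 / 4 * e, c - 1 / 2 * e]) x + \1_(`[c, c + 3 / 4 * e]) x.

Lemma blocksE c e x : blocks c e x =
  (c - 5 / 4 * e <= x <= c - 1 / 2 * e)%R%:R + (c <= x <= c + 3 / 4 * e)%R%:R.
Proof. by rewrite /blocks !indicE !mem_setE !in_itv. Qed.

Lemma blocks_block1 c e x : 0 < e -> c - 5 / 4 * e <= x <= c - 1 / 2 * e ->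
  blocks c e x = 1.
Proof.
move=> e0 xe; rewrite blocksE xe.
have -> : c <= x = false by apply: lt_geF; lra.
by rewrite addr0.
Qed.

Lemma blocks_block2 c e x : 0 < e -> c <= x <= c + 3 / 4 * e -> blocks c e x = 1.
Proof.
move=> e0 xe; rewrite blocksE xe.
have -> : x <= c - 1 / 2 * e = false by apply: lt_geF; lra.
by rewrite andbF add0r.
Qed.

Lemma blocks_left c e x : 0 < e -> x < c - 5 / 4 * e -> blocks c e x = 0.
Proof.
move=> e0 xe; rewrite blocksE (lt_geF xe).
have -> : c <= x = false by apply: lt_geF; lra.
by rewrite addr0.
Qed.

Lemma blocks_dip c e x : 0 < e -> c - 1 / 2 * e < x < c -> blocks c e x = 0.
Proof.
by move=> e0 /andP[xe xc]; rewrite blocksE (lt_geF xe) (lt_geF xc) andbF addr0.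
Qed.

Lemma blocks_right c e x : 0 < e -> c + 3 / 4 * e < x -> blocks c e x = 0.
Proof.
move=> e0 xe; rewrite blocksE (lt_geF xe) andbF.
have -> : x <= c - 1 / 2 * e = false by apply: lt_geF; lra.
by rewrite andbF addr0.
Qed.

Lemma blocks01 c e x : 0 < e -> 0 <= blocks c e x <= 1.
Proof.
move=> e0; have [xl|xl] := ltP x (c - 5 / 4 * e); first by rewrite blocks_left// lexx ler01.
have [xb|xb] := leP x (c - 1 / 2 * e); first by rewrite blocks_block1 ?xl// ler01 lexx.
have [xd|xd] := ltP x c; first by rewrite blocks_dip ?xb// lexx ler01.
have [xr|xr] := leP x (c + 3 / 4 * e); first by rewrite blocks_block2 ?xd// ler01 lexx.
by rewrite blocks_right// lexx ler01.
Qed.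

Lemma blocks_rise1 c e x y : 0 < e -> x <= y -> y <= c - 1 / 2 * e ->
  blocks c e x <= blocks c e y.
Proof.
move=> e0 xy yc; have [yl|yl] := ltP y (c - 5 / 4 * e).
  by rewrite !blocks_left//; exact: le_lt_trans yl.
by rewrite (@blocks_block1 _ _ y) ?yl//; have /andP[] := blocks01 c x e0.
Qed.

Lemma blocks_fall1 c e x y : 0 < e -> c - 5 / 4 * e <= x -> x <= y -> y < c ->
  blocks c e y <= blocks c e x.
Proof.
move=> e0 xl xy yc; have [xb|xb] := leP x (c - 1 / 2 * e).
  by rewrite (@blocks_block1 _ _ x) ?xl//; have /andP[] := blocks01 c y e0.
by rewrite !blocks_dip ?xb//= ?(lt_le_trans xb)//; exact: le_lt_trans yc.
Qed.

Lemma blocks_rise2 c e x y : 0 < e -> c - 1 / 2 * e < x -> x <= y ->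
  y <= c + 3 / 4 * e -> blocks c e x <= blocks c e y.
Proof.
move=> e0 xl xy yc; have [yb|yb] := ltP y c.
  by rewrite !blocks_dip ?xl//= ?(lt_le_trans xl)//; exact: le_lt_trans yb.
by rewrite (@blocks_block2 _ _ y) ?yb//; have /andP[] := blocks01 c x e0.
Qed.

Lemma blocks_fall2 c e x y : 0 < e -> c <= x -> x <= y ->
  blocks c e y <= blocks c e x.
Proof.
move=> e0 xl xy; have [xb|xb] := leP x (c + 3 / 4 * e).
  by rewrite (@blocks_block2 _ _ x) ?xl//; have /andP[] := blocks01 c y e0.
by rewrite !blocks_right//; exact: lt_le_trans xy.
Qed.

Lemma measurable_blocks c e : measurable_fun setT (blocks c e).
Proof. by apply: measurable_funD; exact: measurable_indic. Qed.

Lemma Rintegral_indic_itv q l a b : 0 <= l -> a <= b ->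
  \int[leb R]_(x in `[a, b]) \1_(`[q, q + l]) x = clip l (b - q) - clip l (a - q).
Proof.
move=> l0 ab; rewrite /Rintegral.
under eq_integral do rewrite /=.
rewrite integral_indic//= setIC.
have -> : `[a, b]%classic `&` `[q, q + l] = `[Num.max a q, Num.min b (q + l)]%classic.
  apply/seteqP; split=> x /=; rewrite !in_itv/= ge_max le_min.
    by move=> [/andP[-> ->] /andP[-> ->]].
  by move=> /andP[/andP[-> ->] /andP[-> ->]].
rewrite lebesgue_measure_itv/= lte_fin.
have [ca cb] := (clip_cases (a - q) l0, clip_cases (b - q) l0).
case: (leP a q) => aq; case: (leP b (q + l)) => bq; case: ltP => /= h;
  by case: ca => -[? ->]; case: cb => -[? ->]; lra.
Qed.

Lemma Rintegral_blocks c e a b : 0 <= e -> a <= b ->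
  \int[leb R]_(x in `[a, b]) blocks c e x = profile e (b - c) - profile e (a - c).
Proof.
move=> e0 ab.
have int1 q l : (leb R).-integrable `[a, b] (EFin \o (\1_(`[q, l]%classic) : R -> R)).
  apply: (@bounded_integrable_itv _ _ 1); first exact: measurable_indic.
  by move=> x; rewrite indicE; case: (_ \in _); rewrite ?normr1 ?normr0.
rewrite RintegralD// (_ : c - 1 / 2 * e = c - 5 / 4 * e + 3 / 4 * e); last by field.
rewrite !Rintegral_indic_itv; [|lra..].
have q x : x - (c - 5 / 4 * e) = x - c + 5 / 4 * e by lra.
by rewrite !q /profile; ring.
Qed.

End Blocks.

(** * Locally finite sums of far apart pieces *)

Section GapSum.
Context {R : realType} (E : R) (E0 : 0 < E).
Implicit Types (F : nat -> R -> R).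

(** Cells of half-width [4 * E] around the centres are adjacent. A piece lies within [5 / 4 * E] of
    its centre, so up to distance [6 * E] from a centre only its own piece is met: room for windows
    of length at most [E] starting in the cell and for their displacements. *)
Definition centre (i : nat) : R := 8 * E * i%:R.

Lemma centreS i : centre i.+1 = centre i + 8 * E.
Proof. by rewrite /centre -[i.+1%:R]natr1 mulrDr mulr1. Qed.

Lemma centre_le i j : (i <= j)%N -> centre i <= centre j.
Proof. by move=> ij; rewrite ler_pM2l ?ler_nat// mulr_gt0. Qed.

Lemma centre_lt i j : (i < j)%N -> centre i + 8 * E <= centre j.
Proof. by move=> /centre_le; rewrite centreS. Qed.

Lemma centre_cofinal x : exists n, x <= centre n - 4 * E.
Proof.
exists (Num.truncn (`|x| / E)).+1; rewrite /centre.
have := Num.Theory.truncnS_gt (`|x| / E); rewrite ltr_pdivrMr// => xn.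
have n1 : E <= (Num.truncn (`|x| / E)).+1%:R * E by rewrite ler_peMl ?(ltW E0)// ler1n.
have := E0; have := ler_norm x; lra.
Qed.

(* For functions [F i] vanishing left of [centre i - 2 * E], the truncation drops
   only zero terms: this is the locally finite sum of the whole sequence. *)
Definition gap_sum F x : R := \sum_(0 <= i < (Num.truncn (`|x| / E)).+1) F i x.

Lemma gap_sumE F n x : (forall i x, x <= centre i - 2 * E -> F i x = 0) ->
  x <= centre n - 2 * E -> gap_sum F x = \sum_(0 <= i < n) F i x.
Proof.
move=> F0 xn; rewrite /gap_sum.
have stab m k : (m <= k)%N -> x <= centre m - 2 * E ->
    \sum_(0 <= i < k) F i x = \sum_(0 <= i < m) F i x.
  move=> mk xm; rewrite (big_cat_nat (leq0n m) mk)/= [X in _ + X]big_nat_cond [X in _ + X]big1 ?addr0//.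
  by move=> i /andP[/andP[mi _] _]; rewrite F0// (le_trans xm)// lerB// centre_le.
set k := (Num.truncn _).+1.
have xk : x <= centre k - 2 * E.
  have := Num.Theory.truncnS_gt (`|x| / E); rewrite ltr_pdivrMr// -/k => xk.
  have n1 : E <= k%:R * E by rewrite ler_peMl ?(ltW E0)// ler1n.
  have := E0; have := ler_norm x; rewrite /centre; lra.
by rewrite -(stab k (maxn k n)) ?leq_maxl// (stab n (maxn k n)) ?leq_maxr.
Qed.

End GapSum.

(** * The datum, its primitive and its total variation *)

Section Datum.
Context {R : realType} (eps : nat -> R) (eps_gt0 : forall n, 0 < eps n)
  (eps_decr : forall n, eps n.+1 <= 16^-1 * eps n).
Local Notation E := (eps 0%N).

Lemma eps_le i j : (i <= j)%N -> eps j <= eps i.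
Proof.
move=> /subnK <-; elim: (j - i)%N => //= k IH; rewrite addSn.
by have := eps_decr (k + i); have := eps_gt0 (k + i); lra.
Qed.

Lemma eps_lt i j : (i < j)%N -> 16 * eps j <= eps i.
Proof. by move=> /eps_le ij; have := eps_decr i; lra. Qed.

Definition amp (i : nat) : R := (1 / 2) ^+ i.+1.

Lemma amp_gt0 i : 0 < amp i.
Proof. by rewrite exprn_gt0//; lra. Qed.

Lemma amp_le i : amp i <= 1 / 2.
Proof. by rewrite /amp exprS ler_piMr// ?exprn_ile1//; lra. Qed.

Lemma amp_sum n : \sum_(0 <= i < n) amp i <= 1.
Proof.
suff -> : \sum_(0 <= i < n) amp i = 1 - (1 / 2) ^+ n.
  by rewrite lerBlDr lerDl exprn_ge0//; lra.
elim: n => [|n IH]; first by rewrite big_geq// expr0 subrr.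
by rewrite big_nat_recr//= IH /amp exprS; lra.
Qed.

Definition datum_piece i (x : R) : R := amp i * blocks (centre E i) (eps i) x.
Definition primitive_piece i (x : R) : R := amp i * profile (eps i) (x - centre E i).
Definition datum : R -> R := gap_sum E datum_piece.
Definition datum_primitive : R -> R := gap_sum E primitive_piece.

Lemma datum_piece_left i x : x <= centre E i - 2 * E -> datum_piece i x = 0.
Proof.
move=> xi; rewrite /datum_piece blocks_left ?mulr0//.
by have := eps_le (leq0n i); have := eps_gt0 i; lra.
Qed.

Lemma primitive_piece_left i x : x <= centre E i - 2 * E -> primitive_piece i x = 0.
Proof.
move=> xi; have ei := eps_gt0 i; rewrite /primitive_piece profile_left ?mulr0// ?ltW//.
by have := eps_le (leq0n i); lra.
Qed.

Lemma datum_local i x : centre E i - 4 * E <= x <= centre E i + 4 * E ->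
  datum x = amp i * blocks (centre E i) (eps i) x.
Proof.
move=> /andP[xl xr]; have E0 := eps_gt0 0.
rewrite /datum (gap_sumE E0 (n := i.+1) datum_piece_left); last by rewrite centreS; lra.
rewrite big_nat_recr//= big_nat big1 ?add0r// => j /andP[_ ji].
rewrite /datum_piece blocks_right ?mulr0//.
by have := centre_lt E0 ji; have := eps_le (leq0n j); have := eps_gt0 j; lra.
Qed.

Lemma datum_primitive_local i x y :
  - (6 * E) <= x <= 6 * E -> - (6 * E) <= y <= 6 * E ->
  datum_primitive (centre E i + x) - datum_primitive (centre E i + y) =
  amp i * (profile (eps i) x - profile (eps i) y).
Proof.
have E0 := eps_gt0 0.
have loc z : - (6 * E) <= z <= 6 * E -> datum_primitive (centre E i + z) =
    \sum_(0 <= j < i) amp j * (3 / 2 * eps j) + amp i * profile (eps i) z.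
  move=> /andP[zl zr]; rewrite /datum_primitive.
  rewrite (gap_sumE E0 (n := i.+1) primitive_piece_left); last by rewrite centreS; lra.
  rewrite big_nat_recr//= /primitive_piece [_ + z - _]addrAC subrr add0r.
  congr (_ + _); apply: eq_big_nat => j /andP[_ ji]; rewrite profile_right// ?ltW//.
  by have := centre_lt E0 ji; have := eps_le (leq0n j); have := eps_gt0 j; lra.
by move=> xE yE; rewrite (loc x xE) (loc y yE); ring.
Qed.

Lemma datum_primitive_left x : x <= - (2 * E) -> datum_primitive x = 0.
Proof.
move=> xE; rewrite /datum_primitive (gap_sumE (eps_gt0 0) (n := 0%N) primitive_piece_left).
  by rewrite big_geq.
by rewrite /centre mulr0 add0r.
Qed.

Lemma datum_sumE n x : x <= centre E n - 4 * E ->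
  datum x = \sum_(0 <= i < n) datum_piece i x.
Proof.
move=> xn; apply: (gap_sumE (eps_gt0 0) datum_piece_left).
by have := eps_gt0 0; lra.
Qed.

Lemma datum_primitive_sumE n x : x <= centre E n - 4 * E ->
  datum_primitive x = \sum_(0 <= i < n) primitive_piece i x.
Proof.
move=> xn; apply: (gap_sumE (eps_gt0 0) primitive_piece_left).
by have := eps_gt0 0; lra.
Qed.

Let gap_le m n x : (m <= n)%N -> x <= centre E m - 4 * E -> x <= centre E n - 4 * E.
Proof. by move=> mn /le_trans; apply; rewrite lerB// centre_le. Qed.

Lemma datum_partial01 n x : 0 <= \sum_(0 <= i < n) datum_piece i x <= 1.
Proof.
apply/andP; split.
  apply: sumr_ge0 => i _; apply: mulr_ge0; first exact: ltW (amp_gt0 i).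
  by have /andP[] := blocks01 (centre E i) x (eps_gt0 i).
apply: le_trans (amp_sum n); apply: ler_sum => i _.
apply: ler_piMr; first exact: ltW (amp_gt0 i).
by have /andP[] := blocks01 (centre E i) x (eps_gt0 i).
Qed.

Lemma datum01 x : 0 <= datum x <= 1.
Proof.
by have [n xn] := centre_cofinal (eps_gt0 0) x; rewrite (datum_sumE xn) datum_partial01.
Qed.

Let measurable_partial n :
  measurable_fun setT (fun x => \sum_(0 <= i < n) datum_piece i x).
Proof.
by apply: measurable_sum => i; apply: measurable_funM => //; exact: measurable_blocks.
Qed.

Lemma measurable_datum : measurable_fun setT datum.
Proof.
apply: (measurable_fun_cvg measurable_partial) => x _.
have [n xn] := centre_cofinal (eps_gt0 0) x.
apply: cvg_near_cst; exists n => // m /= nm.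
by rewrite (datum_sumE (gap_le nm xn)).
Qed.

Lemma Rintegral_datum a b : a <= b ->
  \int[leb R]_(x in `[a, b]) datum x = datum_primitive b - datum_primitive a.
Proof.
move=> ab; have [n bn] := centre_cofinal (eps_gt0 0) b.
rewrite (datum_primitive_sumE bn) (datum_primitive_sumE (le_trans ab bn)).
transitivity (\int[leb R]_(x in `[a, b]) \sum_(0 <= i < n) datum_piece i x).
  apply: eq_Rintegral => x; rewrite inE/= in_itv/= => /andP[_ xb].
  exact: datum_sumE (le_trans xb bn).
elim: n {bn} => [|n IH].
  rewrite !big_geq// subrr -[RHS](mul0r (b - a)) -(Rintegral_itv_cst 0 ab).
  by apply: eq_Rintegral => x _; rewrite big_geq.
have ip m : (leb R).-integrable `[a, b]
    (EFin \o (fun x => \sum_(0 <= i < m) datum_piece i x)).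
  apply: (@bounded_integrable_itv _ _ 1) => // x.
  by have /andP[p0 p1] := datum_partial01 m x; rewrite ger0_norm.
have ib : (leb R).-integrable `[a, b] (EFin \o blocks (centre E n) (eps n)).
  apply: (@bounded_integrable_itv _ _ 1); first exact: measurable_blocks.
  by move=> x; have /andP[p0 p1] := blocks01 (centre E n) x (eps_gt0 n); rewrite ger0_norm.
rewrite !big_nat_recr//= opprD addrACA -IH.
transitivity (\int[leb R]_(x in `[a, b])
    (\sum_(0 <= i < n) datum_piece i x + datum_piece n x)).
  by apply: eq_Rintegral => x _; rewrite big_nat_recr.
rewrite RintegralD//; last first.
  by have := integrableZl _ (amp n) ib; exact.
rewrite RintegralZl// (Rintegral_blocks _ (ltW (eps_gt0 n)) ab).
by rewrite /primitive_piece mulrBr.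
Qed.

Lemma datum_primitive_homo : {homo datum_primitive : x y / x <= y}.
Proof.
move=> x y xy; have [n yn] := centre_cofinal (eps_gt0 0) y.
rewrite (datum_primitive_sumE yn) (datum_primitive_sumE (le_trans xy yn)).
apply: ler_sum => i _; apply: ler_wpM2l; first exact: ltW (amp_gt0 i).
by apply: profile_homo; [exact: ltW|rewrite lerB].
Qed.

(** Piece i has mass [amp i * (3 / 2 * eps i)]. The bound on the total mass is what fixes the
    maximal speed. *)
Lemma datum_primitive_range x : 0 <= datum_primitive x <= 3 / 2 * E.
Proof.
have [n xn] := centre_cofinal (eps_gt0 0) x; rewrite (datum_primitive_sumE xn).
have e34 i : 0 <= 3 / 4 * eps i by rewrite mulr_ge0 ?ltW//; lra.
apply/andP; split.
  apply: sumr_ge0 => i _; apply: mulr_ge0; first exact: ltW (amp_gt0 i).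
  by rewrite addr_ge0// clip_ge0.
apply: (@le_trans _ _ (\sum_(0 <= i < n) amp i * (3 / 2 * E))).
  apply: ler_sum => i _; apply: ler_wpM2l; first exact: ltW (amp_gt0 i).
  rewrite /profile.
  have := clip_le (x - centre E i + 5 / 4 * eps i) (e34 i).
  have := clip_le (x - centre E i) (e34 i); have := eps_le (leq0n i); lra.
rewrite -mulr_suml ler_piMl ?amp_sum// mulr_ge0 ?ltW//; lra.
Qed.

Lemma datum_primitive_diff x y : datum_primitive y - datum_primitive x <= 3 / 2 * E.
Proof.
have /andP[x0 _] := datum_primitive_range x.
by have /andP[_ y1] := datum_primitive_range y; rewrite lerBlDr (le_trans y1)// lerDl.
Qed.

(** Two blocks of height [amp i] rise and fall once each, which gives [4 * amp i] in each cell. *)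
Lemma datum_TotVar : (TotVar datum < +oo)%E.
Proof.
have E0 := eps_gt0 0.
apply: (@le_lt_trans _ _ 4%:E); last exact: ltry.
apply: (@TotVar_le_gaps _ (fun i => centre E i - 4 * E) _ _ (fun i => 4 * amp i)).
- by move=> n; rewrite centreS; lra.
- exact: centre_cofinal.
- by move=> x y; rewrite !in_itv/= => x0 y0; rewrite (datum_sumE x0) (datum_sumE y0) !big_geq.
- move=> i; have ei := eps_gt0 i; have eE := eps_le (leq0n i); have Ai := ltW (amp_gt0 i).
  rewrite centreS; set c := centre E i.
  have [l1 l2 l3 l4] : [/\ c - 4 * E <= c - eps i, c - eps i <= c - 1 / 4 * eps i,
    c - 1 / 4 * eps i <= c + 1 / 2 * eps i & c + 1 / 2 * eps i <= c + 8 * E - 4 * E].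
    by split; lra.
  rewrite (total_variation_three_turns l1 l2 l3 l4).
  + rewrite lee_fin !(@datum_local i) -/c; [|lra..].
    rewrite (@blocks_block1 _ c _ (c - eps i))//; last lra.
    rewrite (@blocks_dip _ c _ (c - 1 / 4 * eps i))//; last lra.
    rewrite (@blocks_block2 _ c _ (c + 1 / 2 * eps i))//; last lra.
    rewrite (@blocks_left _ c _ (c - 4 * E))//; last lra.
    by rewrite (@blocks_right _ c _ (c + 8 * E - 4 * E))//; lra.
  + move=> x y; rewrite !in_itv/= => xi yi xy.
    rewrite !(@datum_local i) -/c; [|lra..].
    by rewrite ler_wpM2l// blocks_rise1//; lra.
  + move=> x y; rewrite !in_itv/= => xi yi xy.
    rewrite !(@datum_local i) -/c; [|lra..].
    by rewrite ler_wpM2l// blocks_fall1//; lra.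
  + move=> x y; rewrite !in_itv/= => xi yi xy.
    rewrite !(@datum_local i) -/c; [|lra..].
    by rewrite ler_wpM2l// blocks_rise2//; lra.
  + move=> x y; rewrite !in_itv/= => xi yi xy.
    rewrite !(@datum_local i) -/c; [|lra..].
    by rewrite ler_wpM2l// blocks_fall2//; lra.
- by move=> n; rewrite -mulr_sumr; have := amp_sum n; lra.
Qed.

End Datum.

(** * Balance of gains and losses over all pieces *)

Section Growth.
Context {R : realType} (eps : nat -> R) (eps_gt0 : forall n, 0 < eps n)
  (eps_decr : forall n, eps n.+1 <= 16^-1 * eps n).
Local Notation E := (eps 0%N).

Lemma TotVar_growth n (K T : R) (w : R -> R -> R) :
  transported (eps n) K (datum_primitive eps) w -> 1 <= K -> 0 < T ->
  K * T <= eps n / 96 -> 256 * n.+1%:R * (K * T) < amp n ^+ 2 * eps n ->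
  (TotVar (w 0%R) < TotVar (w T))%E.
Proof.
have E0 := eps_gt0 0; have h0 := eps_gt0 n.
have hE := eps_le eps_gt0 eps_decr (leq0n n).
move=> tr K1 T0 KT nKT; have T0' := ltW T0; have A0 := @amp_gt0 R n.
pose q := 32 * K * T ^+ 2 / eps n ^+ 2; pose d := amp n ^+ 2 * T / (8 * eps n).
pose gain i := if (i < n)%N then - q else if i == n then d else 0.
have pieces i : gains w (centre E i) (amp i) E (eps n) T (gain i).
  have eE := eps_le eps_gt0 eps_decr (leq0n i).
  have Zloc := @datum_primitive_local _ _ eps_gt0 eps_decr i.
  rewrite /gain; case: ltngtP => [ni|ni|ni].
  - apply: (coarse_piece_gain (amp_gt0 i) (amp_le i) (eps_gt0 i) eE h0 hE Zloc tr K1 T0' KT).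
    exact: (eps_lt eps_gt0 eps_decr ni).
  - apply: (fine_piece_gain (amp_gt0 i) (amp_le i) (eps_gt0 i) eE h0 hE Zloc tr K1 T0' KT).
    exact: (eps_lt eps_gt0 eps_decr ni).
  - rewrite /d -ni in h0 hE tr KT *.
    exact: (matching_piece_gain (amp_gt0 i) (amp_le i) (eps_gt0 i) eE h0 hE Zloc tr K1 T0' KT).
have /choice[c0 /choice[cT piecesP]] := pieces.
(* The gain is linear in [T] and the n losses are quadratic; factoring out [T / (8 * eps n ^+ 2)]
   leaves the smallness condition, with 256 = 8 * 32. *)
have dq : 0 < d - n%:R * q.
  have -> : d - n%:R * q = T / (8 * eps n ^+ 2) *
      (amp n ^+ 2 * eps n - 256 * n%:R * (K * T)).
    by rewrite /d /q; field; rewrite gt_eqF.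
  rewrite mulr_gt0 ?divr_gt0 ?mulr_gt0 ?ltr0n ?exprn_gt0// subr_gt0 (le_lt_trans _ nKT)//.
  have KT0 : 0 <= K * T by rewrite mulr_ge0// (le_trans ler01).
  by apply: ler_wpM2r => //; apply: ler_wpM2l; rewrite ?ler0n ?ler_nat.
have coarse m : (m <= n)%N ->
    \sum_(0 <= i < m) c0 i - m%:R * q <= \sum_(0 <= i < m) cT i.
  elim: m => [|m IH] mn; first by rewrite !big_geq// mul0r subr0.
  rewrite !big_nat_recr//= -[m.+1%:R]natr1 mulrDl mul1r.
  have [_ _ _] := piecesP m; rewrite /gain mn; have := IH (ltnW mn); lra.
have total k : \sum_(0 <= i < n.+1 + k) c0 i + (d - n%:R * q) <=
    \sum_(0 <= i < n.+1 + k) cT i.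
  elim: k => [|k IH].
    rewrite addn0 !big_nat_recr//=; have := coarse n (leqnn n).
    by have [_ _ _] := piecesP n; rewrite /gain ltnn eqxx; lra.
  rewrite addnS; move: (n.+1 + k)%N (leq_addr k n.+1) IH => m nm IH.
  rewrite !big_nat_recr//=; have [_ _ _] := piecesP m.
  rewrite /gain ltnNge ltnW//= gtn_eqF//; lra.
have gS i : centre E i.+1 - 4 * E = centre E i + 4 * E by rewrite centreS; lra.
have g_le i : centre E i - 4 * E <= centre E i.+1 - 4 * E by rewrite gS; lra.
have upper S : (forall m, \sum_(0 <= i < m) c0 i <= S) -> (TotVar (w 0%R) <= S%:E)%E.
  apply: (TotVar_le_gaps g_le); first exact: centre_cofinal.
    have w0 x : x <= centre E 0 - 4 * E -> w 0 x = 0.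
      rewrite /centre mulr0 => x0; apply: (mulfI (lt0r_neq0 h0)).
      rewrite (transported0 tr) !(datum_primitive_left eps_gt0 eps_decr) ?subrr ?mulr0//; lra.
    by move=> x y; rewrite !in_itv/= => x0 y0; rewrite !w0.
  by move=> i; rewrite gS; have [-> _ _ _] := piecesP i.
have lower m : ((\sum_(0 <= i < m) cT i)%:E <= TotVar (w T))%E.
  by apply: (TotVar_ge_gaps g_le) => i; rewrite gS; have [_ _ + _] := piecesP i.
have c0_ge0 i : 0 <= c0 i by have [_ /andP[+ _] _ _] := piecesP i.
(* The variation at time [T] is not known to be finite; if it is infinite, the finiteness of the
   initial one settles the claim. *)
case wT : (TotVar (w T)) lower => [v| |] lower.
- apply: (@le_lt_trans _ _ (v - (d - n%:R * q))%:E); last by rewrite lte_fin; lra.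
  (* The sums run up to [n.+1 + m] so that the gain of piece [n] is counted for every [m]; the
     additional initial variations are nonnegative. *)
  apply: upper => m; have := lower (n.+1 + m)%N; rewrite lee_fin.
  have := total m; rewrite (@big_cat_nat _ _ _ m) ?leq_addl//=.
  have : 0 <= \sum_(m <= i < n.+1 + m) c0 i by exact: sumr_ge0.
  lra.
- apply: (@le_lt_trans _ _ (6 * E / eps n)%:E); last exact: ltry.
  apply: upper => m.
  apply: (@le_trans _ _ (\sum_(0 <= i < m) 6 * E / eps n * amp i)).
    by apply: ler_sum => i _; have [_ /andP[_ +] _ _] := piecesP i.
  rewrite -mulr_sumr ler_piMr ?amp_sum//.
  by rewrite divr_ge0 ?mulr_ge0// ltW.
- by have := lower 0%N.
Qed.

End Growth.

Unset Implicit Arguments.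

Theorem theorem1p4 (R : realType) (eps : nat -> R)
    (eps_gt0 : forall n, 0 < eps n)
    (eps_decr : forall n, eps n.+1 <= 16^-1 * eps n) :
  let V : R -> R := fun w => 1 - w in
  let eta : R -> R := \1_(`]-1, 0[%classic) in
  exists u0 : R -> R,
    [/\ measurable_fun setT u0,
        forall x, 0 <= u0 x <= 1,
        (TotVar u0 < +oo)%E &
        exists tau : nat -> R, forall n,
          0 < tau n /\
          forall u : R * R -> R,
            nonlocal_solution V (rescale eta (eps n)) u0 u ->
            {ae leb R, forall t : R, t \in `]0, tau n[ ->
              (TotVar (nonlocal_avg u (rescale eta (eps n)) 0)
                 < TotVar (nonlocal_avg u (rescale eta (eps n)) t))%E}].
Proof.
move=> V eta; exists (datum eps); split.
- exact: measurable_datum.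
- exact: datum01.
- exact: datum_TotVar.
pose K n := 1 + (3 / 2 * eps 0%N) / eps n.
have K1 n : 1 <= K n.
  by rewrite /K lerDl divr_ge0 ?mulr_ge0//; have := eps_gt0 n; have := eps_gt0 0%N; lra.
have K0 n : 0 < K n := lt_le_trans ltr01 (K1 n).
(* The first bound keeps displacements below [eps n / 96]; the second lets the linear gain exceed
   the n quadratic losses, with [n.+1] to avoid a zero denominator at [n = 0]. *)
exists (fun n => Num.min (eps n / (96 * K n))
  (amp n ^+ 2 * eps n / (256 * n.+1%:R * K n))) => n; split.
  by rewrite lt_min !divr_gt0 ?mulr_gt0 ?ltr0n ?exprn_gt0 ?amp_gt0.
(* The inequality is obtained at every time of the interval, and [tau] was chosen from [K n] before
   the solution [u]. *)
move=> u sol; apply: aeW => t; rewrite in_itv/= lt_min => /andP[t0 /andP[tK tA]].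
have [w tr wE] := solution_flow (eps_gt0 n) (measurable_datum eps_gt0 eps_decr)
  (datum01 eps_gt0 eps_decr) sol (datum_primitive_homo eps_gt0 eps_decr)
  (datum_primitive_diff eps_gt0 eps_decr) (Rintegral_datum eps_gt0 eps_decr).
have -> : nonlocal_avg u (rescale eta (eps n)) 0 = w 0 by apply/funext => x; exact: wE.
have -> : nonlocal_avg u (rescale eta (eps n)) t = w t.
  by apply/funext => x; apply: wE; exact: ltW.
apply: (TotVar_growth eps_gt0 eps_decr tr) => //.
- exact: K1.
- move: tK; rewrite ltr_pdivlMr ?mulr_gt0 ?ltr0n// -/(K n) ler_pdivlMr ?ltr0n// => tK.
  by rewrite mulrC mulrA mulrC ltW.
- by move: tA; rewrite ltr_pdivlMr ?mulr_gt0 ?ltr0n// -/(K n) mulrA mulrC.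
Qed.
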